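(* Let $\mathscr{M}=\{m_j\}_{j\in\mathbb{N}_0}$ be a weight sequence. Let $\alpha\in\mathbb{C}\setminus\{0\}$, $\delta\in\mathbb{R}$, $p_0=(p_{01},\dots,p_{0n})\in\mathbb{R}^n$, and let $q,s\in\mathcal{E}_{\mathscr{M}}(\mathbb{T}^1;\mathbb{R})$ with $q\ge0$ and $q_0:=\int_0^{2\pi}q(\tau)\,d\tau>0$. Consider the operator $P:\mathcal{E}_{\mathscr{M}}(\mathbb{T}^{n+1})\to\mathcal{E}_{\mathscr{M}}(\mathbb{T}^{n+1})$, in the variables $(t,x)\in\mathbb{T}^1\times\mathbb{T}^n$, given by $$Pu=\frac{\partial u}{\partial t}-\sum_{j=1}^np_{0j}\frac{\partial u}{\partial x_j}-(s(t)+i\delta q(t))u-\alpha q(t)\bar u .$$ Put $s_0=\int_0^{2\pi}s(\tau)\,d\tau$, $A_0=s_0+i\delta q_0$ and $B_0=\alpha q_0$. For $(\xi,\tau)\in\mathbb{Z}^n\times\mathbb{Z}$ consider the system $$(\ast)\qquad\begin{cases}\mathrm{Re}\left(A_0(\tau+\xi\cdot p_0)\right)=0,\\ 4\pi^2|\tau+\xi\cdot p_0|^2=|A_0|^2-|B_0|^2.\end{cases}$$ Suppose that one of the following conditions holds: (1) $|B_0|>|A_0|$; (2) $|B_0|\le|A_0|$, $|\alpha|>|\delta|$, and there is no $(\xi,\tau)\in\mathbb{Z}^{n+1}$ solution of $(\ast)$; (3) $|\alpha|<|\delta|$ and $s_0\ne0$; (4) $|\alpha|<|\delta|$, $s_0=0$,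 there is no $(\xi,\tau)\in\mathbb{Z}^{n+1}$ satisfying $(\ast)$, and for all $\varepsilon>0$ there exist $\gamma_\varepsilon,C_\varepsilon>0$ such that for every $(\xi,\tau)\in\mathbb{Z}^{n+1}$ with $\|\xi\|\ge\gamma_\varepsilon$, $$\left|2\pi\tau+2\pi(\xi\cdot p_0)-q_0\sqrt{\delta^2-|\alpha|^2}\right|\ge C_\varepsilon\inf_{j\in\mathbb{N}_0}\frac{m_j\,j!}{\varepsilon^j(1+\|\xi\|)^j}.$$ Then for all $f\in\mathcal{E}_{\mathscr{M}}(\mathbb{T}^{n+1})$ there exists $u\in\mathcal{E}_{\mathscr{M}}(\mathbb{T}^{n+1})$ such that $Pu=f$.
   Context: $\mathbb{T}^N\simeq\mathbb{R}^N/2\pi\mathbb{Z}^N$; $\|\cdot\|$ is the Euclidean norm; $\mathbb{N}_0=\{0,1,2,\dots\}$; $\xi\cdot p_0=\sum_j\xi_jp_{0j}$. A weight sequence is a sequence $\mathscr{M}=\{m_j\}_{j\in\mathbb{N}_0}$ of positive reals such that (i) $m_0=m_1=1$; (ii) $m_j^2\le m_{j-1}m_{j+1}$ for all $j\ge 1$; (iii) there is $H\ge1$ with $m_{j+k}\le H^{j+k}m_jm_k$ for all $j,k\in\mathbb{N}_0$. $\mathcal{E}_{\mathscr{M}}(\mathbb{T}^N)$ is the space of smooth functions $f:\mathbb{T}^N\to\mathbb{C}$ for which there exist $C,h>0$ with $\sup_{x\in\mathbb{T}^N}|\partial^\beta f(x)|\le Ch^{|\beta|}m_{|\beta|}|\beta|!$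 for all $\beta\in\mathbb{N}_0^N$; $\mathcal{E}_{\mathscr{M}}(\mathbb{T}^1;\mathbb{R})$ denotes the real-valued elements of $\mathcal{E}_{\mathscr{M}}(\mathbb{T}^1)$. *)

(* Defs.v *)
From Stdlib Require Import Reals ZArith.
From Coquelicot Require Import Coquelicot.
From mathcomp Require Import ssreflect ssrfun ssrbool eqtype ssrnat seq fintype bigop.

Set Implicit Arguments.
Unset Strict Implicit.
Unset Printing Implicit Defensive.

Local Open Scope R_scope.

Record weight_sequence (m : nat -> R) : Prop := WeightSequence {
  ws_pos : forall j : nat, 0 < m j;
  ws_m0 : m 0%N = 1;
  ws_m1 : m 1%N = 1;
  ws_log_convex :
    forall j : nat, (1 <= j)%N -> m j ^ 2 <= m j.-1 * m j.+1;
  ws_moderate_growth :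
    exists H : R, 1 <= H /\
      forall j k : nat, m (j + k)%N <= H ^ (j + k)%N * m j * m k
}.

(* The topology on [vec N] is Coquelicot's topology of uniform convergence on
   ['I_N -> R]; as ['I_N] is finite, it is the usual topology of R^N. *)
Definition vec (N : nat) : Type := 'I_N -> R.

Definition shift (N : nat) (x : vec N) (k : 'I_N) (h : R) : vec N :=
  fun i => if i == k then x i + h else x i.

(* Functions on the torus T^N = R^N / 2 pi Z^N are represented by the functions
   on R^N that are 2 pi-periodic in each variable. *)
Definition periodic (N : nat) (f : vec N -> C) : Prop :=
  forall (x : vec N) (k : 'I_N), f (shift x k (2 * PI)) = f x.

Definition ex_partial (N : nat) (k : 'I_N) (f : vec N -> C) (x : vec N) : Prop :=
  ex_derive (fun h : R => Re (f (shift x k h))) 0 /\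
  ex_derive (fun h : R => Im (f (shift x k h))) 0.

Definition partial (N : nat) (k : 'I_N) (f : vec N -> C) (x : vec N) : C :=
  (Derive (fun h : R => Re (f (shift x k h))) 0,
   Derive (fun h : R => Im (f (shift x k h))) 0).

Definition iter_partial (N : nat) (l : seq 'I_N) (f : vec N -> C) : vec N -> C :=
  foldr (@partial N) f l.

Definition smooth (N : nat) (f : vec N -> C) : Prop :=
  forall (l : seq 'I_N) (x : vec N),
    continuous (iter_partial l f) x /\
    forall k : 'I_N, ex_partial k (iter_partial l f) x.

Definition multi_order (N : nat) (beta : 'I_N -> nat) : nat :=
  \big[addn/0%N]_(k < N) beta k.

Definition multi_partial (N : nat) (beta : 'I_N -> nat) (f : vec N -> C) :
    vec N -> C :=
  iter_partial (flatten [seq nseq (beta k) k | k <- enum 'I_N]) f.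

Definition in_E (m : nat -> R) (N : nat) (f : vec N -> C) : Prop :=
  periodic f /\ smooth f /\
  exists K h : R, 0 < K /\ 0 < h /\
    forall (beta : 'I_N -> nat) (x : vec N),
      Cmod (multi_partial beta f x) <=
      K * h ^ multi_order beta * m (multi_order beta) *
        INR (fact (multi_order beta)).

Definition in_E1_real (m : nat -> R) (g : R -> R) : Prop :=
  in_E m (fun y : vec 1 => RtoC (g (y ord0))).

(* A point (t, x) of T^1 x T^n is a [z : vec n.+1] with t = z ord0 and
   x_j = z (lift ord0 j). *)
Definition operP (n : nat) (p0 : 'I_n -> R) (alpha : C) (delta : R)
    (s q : R -> R) (u : vec n.+1 -> C) (z : vec n.+1) : C :=
  let t := z ord0 in
  (partial ord0 u z
   - \big[Cplus/RtoC 0]_(j < n) (RtoC (p0 j) * partial (lift ord0 j) u z)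
   - (RtoC (s t) + Ci * RtoC delta * RtoC (q t)) * u z
   - alpha * RtoC (q t) * Cconj (u z))%C.

Definition dotZ (n : nat) (xi : 'I_n -> Z) (p0 : 'I_n -> R) : R :=
  \big[Rplus/0]_(j < n) (IZR (xi j) * p0 j).

Definition normZ (n : nat) (xi : 'I_n -> Z) : R :=
  sqrt (\big[Rplus/0]_(j < n) (IZR (xi j) ^ 2)).

Definition resonant (n : nat) (p0 : 'I_n -> R) (A0 B0 : C)
    (xi : 'I_n -> Z) (tau : Z) : Prop :=
  Re (A0 * RtoC (IZR tau + dotZ xi p0))%C = 0 /\
  4 * PI ^ 2 * Rabs (IZR tau + dotZ xi p0) ^ 2 = Cmod A0 ^ 2 - Cmod B0 ^ 2.

(* The infimum is over positive reals, hence finite, and [real] returns it. *)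
Definition small_divisor_bound (m : nat -> R) (n : nat) (p0 : 'I_n -> R)
    (theta : R) : Prop :=
  forall eps : R, 0 < eps ->
  exists gamma K : R, 0 < gamma /\ 0 < K /\
    forall (xi : 'I_n -> Z) (tau : Z), gamma <= normZ xi ->
      K * real (Inf_seq (fun j : nat =>
                  m j * INR (fact j) / (eps ^ j * (1 + normZ xi) ^ j)))
      <= Rabs (2 * PI * IZR tau + 2 * PI * dotZ xi p0 - theta).

(* Main.v *)
(** Write [D = d_t - p0 . grad_x] and [L v = i delta v + alpha conj v], so that
    [P u = D u - s u - q L u] and [L^2 = |alpha|^2 - delta^2].  Diagonalizing the
    real-linear map [L] reduces [P u = f] to scalar equations
    [D w - (s + z0 q) w = g], with [z0 = +- sqrt (|alpha|^2 - delta^2)] when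
    [|alpha| > |delta|], and [z0 = i sqrt (delta^2 - |alpha|^2)] when
    [|alpha| < |delta|].  Multiplication by the exponential of a primitive of the
    mean-zero part of [s + z0 q] makes the coefficient a constant [c], and
    [D w - c w = g] is solved by dividing the Fourier coefficients of [g] by
    [i (tau - p0 . xi) - c].  These divisors stay away from 0 if [Re c <> 0];
    otherwise they obey the small divisor bound, whose loss the decay of the
    coefficients of [g] absorbs because [m] has moderate growth.

    Fourier series also show that it is enough to bound the pure derivatives
    [d_k^j f]; this makes stability under products a one-variable Leibniz rule. *)

From Pilot Require Import Defs.
From Stdlib Require Import Reals ZArith Lra Lia Classical ClassicalEpsilon.
From Stdlib Require Import FunctionalExtensionality.
From Coquelicot Require Import Coquelicot.
From mathcomp Require Import ssreflect ssrfun ssrbool eqtype ssrnat seq fintype bigop.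

(* [ZArith] also exports a [shift]. *)
Import Pilot.Defs.

Set Implicit Arguments.
Unset Strict Implicit.
Unset Printing Implicit Defensive.

Local Open Scope R_scope.

(** * Partial derivatives and smooth functions *)

(** The term [conj u] couples the Fourier modes [zeta] and [- zeta]. Working with [L] before any
    expansion removes the coupling, because [D], [s] and [q] are real and so commute with [L]. The
    hypotheses then become statements about the mean [c] of [s + z0 q]. For [|alpha| > |delta|], the
    eigenvalues [+- lam] of [L] are real and the two values of [Re c] are proportional to
    [s0 + lam q0] and [s0 - lam q0], whose product is [|A0|^2 - |B0|^2]: (1) forces this case, and
    (1) as well as (2) makes the product nonzero. For [|alpha| < |delta|], [L / mu] with
    [mu = sqrt (delta^2 - |alpha|^2)] is a complex structure, so one scalar equation is enough; its
    [c] has real part [s0 / (2 PI)], and if [s0 = 0], then [|A0|^2 - |B0|^2 = (mu q0)^2] and a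
    vanishing divisor solves the resonant system.

    Fourier coefficients are kept as functions, joint eigenfunctions of the [d_k], obtained by
    averaging in one variable at a time. Thus only integrals over [[0, 2 PI]] occur, and identities
    between series are checked term by term. *)

Lemma C_eq (z w : C) : Re z = Re w -> Im z = Im w -> z = w.
Proof. by case: z w => [a b] [c d] /= -> ->. Qed.

Lemma Cmod_le_ReIm (z : C) : Cmod z <= Rabs (Re z) + Rabs (Im z).
Proof.
have -> : z = (RtoC (Re z) + Ci * RtoC (Im z))%C.
  by apply: C_eq; rewrite /Re /Im /=; ring.
apply: Rle_trans (Cmod_triangle _ _) _.
rewrite Cmod_mult Cmod_Ci !Cmod_R /Re /Im /=; apply: Req_le.
by rewrite !Rmult_0_l !Rmult_1_l !Rminus_0_r !Rplus_0_l !Rplus_0_r.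
Qed.

Lemma im_le_Cmod (z : C) : Rabs (Im z) <= Cmod z.
Proof. exact: Rle_trans (Rmax_r _ _) (Rmax_Cmod z). Qed.

Section Torus.
Variable N : nat.
Implicit Types (f g : vec N -> C) (x z : vec N) (k : 'I_N).

Lemma shift0 x k : shift x k 0 = x.
Proof.
by apply: functional_extensionality => i; rewrite /shift; case: eqP => _; lra.
Qed.

Lemma shift_shift x k a b : shift (shift x k a) k b = shift x k (a + b).
Proof.
by apply: functional_extensionality => i; rewrite /shift; case: eqP => _; lra.
Qed.

Lemma shiftC x k l a b : shift (shift x k a) l b = shift (shift x l b) k a.
Proof.
apply: functional_extensionality => i; rewrite /shift.
by case: eqP => _; case: eqP => _; lra.
Qed.

Lemma continuous_ReIm (T : UniformSpace) (f : T -> C) (x : T) :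
  continuous f x <->
  continuous (fun y => Re (f y)) x /\ continuous (fun y => Im (f y)) x.
Proof.
split=> [cf | [c1 c2]].
  split; apply: continuous_comp cf _; rewrite /Re /Im [f x]surjective_pairing.
    exact: continuous_fst.
  exact: continuous_snd.
apply/filterlim_locally => eps.
move/filterlim_locally: c1 => /(_ eps) c1; move/filterlim_locally: c2 => /(_ eps) c2.
by apply: filter_imp (filter_and _ _ c1 c2) => y [].
Qed.

Lemma continuous_shift x k h : continuous (fun s => shift x k s) h.
Proof.
apply/filterlim_locally => eps.
have := locally_ball h eps; apply: filter_imp => s bs i.
rewrite /shift; case: eqP => _; last exact: ball_center.
by move: bs; rewrite /ball /= /AbsRing_ball /abs /minus /plus /opp /=;
   replace (x i + s + - (x i + h)) with (s + - h) by ring.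
Qed.

Lemma continuous_shift_pair x l k h s :
  continuous (fun p : R * R => shift (shift x l (fst p)) k (snd p)) (h, s).
Proof.
apply/filterlim_locally => eps.
have e2 : 0 < eps / 2 by have := cond_pos eps; lra.
have := locally_ball ((h, s) : R * R) (mkposreal _ e2).
apply: filter_imp => -[h' s'] [] /= b1 b2 i.
move: b1 b2; rewrite /shift /ball /= /AbsRing_ball /abs /minus /plus /opp /=.
move=> /Rabs_def2 b1 /Rabs_def2 b2.
by case: eqP => _; case: eqP => _; apply: Rabs_def1; lra.
Qed.

Definition has_partial k f x (d : C) : Prop :=
  is_derive (fun h : R => Re (f (shift x k h))) 0 (Re d) /\
  is_derive (fun h : R => Im (f (shift x k h))) 0 (Im d).

Lemma has_partialP k f x d :
  has_partial k f x d -> ex_partial k f x /\ partial k f x = d.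
Proof.
case=> d1 d2; split; first by split; eexists; eauto.
by apply: C_eq; rewrite /partial /Re /Im /=; exact: is_derive_unique.
Qed.

Lemma ex_partial_has k f x : ex_partial k f x -> has_partial k f x (partial k f x).
Proof. by case=> e1 e2; split; exact: Derive_correct. Qed.

(** [partial] differentiates at 0 only; moving the base point along the axis gives the derivative at
    every point of the line, as needed for integration and for the mean value theorem. *)
Lemma is_derive_shift k (r : vec N -> R) x s d :
  is_derive (fun h => r (shift (shift x k s) k h)) 0 d ->
  is_derive (fun h => r (shift x k h)) s d.
Proof.
move=> dr; set F := fun h => r (shift x k h).
have dF : is_derive (fun h => F (s + h)) 0 d.
  by apply: is_derive_ext dr => h; rewrite shift_shift.
have := @is_derive_comp _ _ (fun h => F (s + h)) (fun h => h - s) s d 1.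
rewrite scal_one Rminus_diag => H.
apply: (@is_derive_ext R_AbsRing R_NormedModule (fun h => F (s + (h - s))) F) => [t|].
  by congr F; rewrite Rplus_comm /Rminus Rplus_assoc Rplus_opp_l Rplus_0_r.
by apply: H => //; auto_derive.
Qed.

Lemma has_partial_shift k f x d s :
  has_partial k f (shift x k s) d ->
  is_derive (fun h => Re (f (shift x k h))) s (Re d) /\
  is_derive (fun h => Im (f (shift x k h))) s (Im d).
Proof.
by case=> d1 d2; split; [apply: (@is_derive_shift k (fun y => Re (f y))) |
  apply: (@is_derive_shift k (fun y => Im (f y)))].
Qed.

Lemma has_partial_const k (c : C) x : has_partial k (fun _ => c) x (RtoC 0).
Proof. by split; exact: is_derive_const. Qed.

Lemma has_partial_plus k f g x a b :
  has_partial k f x a -> has_partial k g x b ->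
  has_partial k (fun y => f y + g y)%C x (a + b)%C.
Proof. by case=> a1 a2 [b1 b2]; split; exact: is_derive_plus. Qed.

Lemma has_partial_mult k f g x a b :
  has_partial k f x a -> has_partial k g x b ->
  has_partial k (fun y => f y * g y)%C x (a * g x + f x * b)%C.
Proof.
case=> a1 a2 [b1 b2].
split.
- have -> : Re (a * g x + f x * b)%C =
    (Re a * Re (g (shift x k 0)) + Re (f (shift x k 0)) * Re b) -
    (Im a * Im (g (shift x k 0)) + Im (f (shift x k 0)) * Im b).
    by rewrite shift0 /Re /Im /=; ring.
  apply: (is_derive_minus (fun h => Re (f (shift x k h)) * Re (g (shift x k h)))
    (fun h => Im (f (shift x k h)) * Im (g (shift x k h)))).
    by apply: is_derive_mult => //; exact: Rmult_comm.
  by apply: is_derive_mult => //; exact: Rmult_comm.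
- have -> : Im (a * g x + f x * b)%C =
    (Re a * Im (g (shift x k 0)) + Re (f (shift x k 0)) * Im b) +
    (Im a * Re (g (shift x k 0)) + Im (f (shift x k 0)) * Re b).
    by rewrite shift0 /Re /Im /=; ring.
  apply: (is_derive_plus (fun h => Re (f (shift x k h)) * Im (g (shift x k h)))
    (fun h => Im (f (shift x k h)) * Re (g (shift x k h)))).
    by apply: is_derive_mult => //; exact: Rmult_comm.
  by apply: is_derive_mult => //; exact: Rmult_comm.
Qed.

Lemma has_partial_conj k f x a :
  has_partial k f x a -> has_partial k (fun y => Cconj (f y)) x (Cconj a).
Proof. by case=> a1 a2; split => //; exact: is_derive_opp. Qed.

Lemma iter_partial_rcons l k f :
  iter_partial (rcons l k) f = iter_partial l (partial k f).
Proof. by rewrite /iter_partial foldr_rcons. Qed.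

Lemma smooth_continuous f : smooth f -> forall x, continuous f x.
Proof. by move=> sf x; have [] := sf [::] x. Qed.

Lemma smooth_ex_partial f k : smooth f -> forall x, ex_partial k f x.
Proof. by move=> sf x; have [_ /(_ k)] := sf [::] x. Qed.

Lemma smooth_has_partial f k x : smooth f -> has_partial k f x (partial k f x).
Proof. by move=> /smooth_ex_partial sf; exact: ex_partial_has. Qed.

Lemma smooth_partial f k : smooth f -> smooth (partial k f).
Proof. by move=> sf l x; have := sf (rcons l k) x; rewrite iter_partial_rcons. Qed.

Lemma smooth_iter f l : smooth f -> smooth (iter_partial l f).
Proof.
by move=> sf; elim: l => //= k l; exact: smooth_partial.
Qed.

(* The predicate [T] plays the role of a bisimulation for [smooth]. *)
Lemma smooth_coind (T : (vec N -> C) -> Prop) :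
  (forall f, T f -> (forall x, continuous f x) /\
     forall k, (forall x, ex_partial k f x) /\ T (partial k f)) ->
  forall f, T f -> smooth f.
Proof.
move=> HT f Tf l; elim/last_ind: l f Tf => [|l k IH] f Tf x.
  by have [cf df] := HT f Tf; split => // k; have [] := df k.
by rewrite iter_partial_rcons; apply: IH; have [_ /(_ k) []] := HT f Tf.
Qed.

(** The derivative of a product is a sum of products, so smooth products alone are not stable under
    [partial]. This closure is, and can serve as the bisimulation. *)
Inductive smooth_gen : (vec N -> C) -> Prop :=
| SG_smooth f : smooth f -> smooth_gen f
| SG_const c : smooth_gen (fun _ => c)
| SG_plus f g : smooth_gen f -> smooth_gen g -> smooth_gen (fun y => f y + g y)%C
| SG_mult f g : smooth_gen f -> smooth_gen g -> smooth_gen (fun y => f y * g y)%C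
| SG_conj f : smooth_gen f -> smooth_gen (fun y => Cconj (f y)).

Lemma continuous_Cplus (T : UniformSpace) (f g : T -> C) (x : T) :
  continuous f x -> continuous g x -> continuous (fun y => f y + g y)%C x.
Proof.
move=> /continuous_ReIm [f1 f2] /continuous_ReIm [g1 g2].
apply/continuous_ReIm; split.
- exact: (continuous_plus (fun y => Re (f y)) (fun y => Re (g y))).
- exact: (continuous_plus (fun y => Im (f y)) (fun y => Im (g y))).
Qed.

Lemma continuous_Cmult (T : UniformSpace) (f g : T -> C) (x : T) :
  continuous f x -> continuous g x -> continuous (fun y => f y * g y)%C x.
Proof.
move=> /continuous_ReIm [f1 f2] /continuous_ReIm [g1 g2].
apply/continuous_ReIm; split.
- apply: (continuous_minus (fun y => Re (f y) * Re (g y))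
    (fun y => Im (f y) * Im (g y))).
    exact: (continuous_mult (fun y => Re (f y)) (fun y => Re (g y))).
  exact: (continuous_mult (fun y => Im (f y)) (fun y => Im (g y))).
- apply: (continuous_plus (fun y => Re (f y) * Im (g y))
    (fun y => Im (f y) * Re (g y))).
    exact: (continuous_mult (fun y => Re (f y)) (fun y => Im (g y))).
  exact: (continuous_mult (fun y => Im (f y)) (fun y => Re (g y))).
Qed.

Lemma continuous_Cconj (T : UniformSpace) (f : T -> C) (x : T) :
  continuous f x -> continuous (fun y => Cconj (f y)) x.
Proof.
move=> /continuous_ReIm [f1 f2]; apply/continuous_ReIm; split => //.
exact: (continuous_opp (fun y => Im (f y))).
Qed.

Lemma partial_ext k f d :
  (forall x, has_partial k f x (d x)) ->
  (forall x, ex_partial k f x) /\ partial k f = d.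
Proof.
move=> H; split=> [x|]; first by case: (has_partialP (H x)).
by apply: functional_extensionality => x; case: (has_partialP (H x)).
Qed.

Lemma smooth_gen_smooth f : smooth_gen f -> smooth f.
Proof.
move: f; apply: smooth_coind => f; elim=> {f}.
- move=> f sf; split=> [|k]; first exact: smooth_continuous.
  by split; [exact: smooth_ex_partial | exact/SG_smooth/smooth_partial].
- move=> c; split=> [x|k]; first exact: continuous_const.
  have [? ->] := partial_ext (fun x => has_partial_const k c x).
  by split => //; exact: SG_const.
- move=> f g Gf [cf df] Gg [cg dg]; split=> [x|k]; first exact: continuous_Cplus.
  have [ef Gdf] := df k; have [eg Gdg] := dg k.
  have [? ->] := partial_ext (fun x => has_partial_plus
    (ex_partial_has (ef x)) (ex_partial_has (eg x))).
  by split => //; exact: SG_plus.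
- move=> f g Gf [cf df] Gg [cg dg]; split=> [x|k]; first exact: continuous_Cmult.
  have [ef Gdf] := df k; have [eg Gdg] := dg k.
  have [? ->] := partial_ext (fun x => has_partial_mult
    (ex_partial_has (ef x)) (ex_partial_has (eg x))).
  by split => //; apply: SG_plus; exact: SG_mult.
- move=> f Gf [cf df]; split=> [x|k]; first exact: continuous_Cconj.
  have [ef Gdf] := df k.
  have [? ->] := partial_ext (fun x => has_partial_conj (ex_partial_has (ef x))).
  by split => //; exact: SG_conj.
Qed.

Lemma smooth_const (c : C) : smooth (fun _ : vec N => c).
Proof. exact/smooth_gen_smooth/SG_const. Qed.

Lemma smooth_plus f g : smooth f -> smooth g -> smooth (fun y => f y + g y)%C.
Proof. by move=> sf sg; apply: smooth_gen_smooth; apply: SG_plus; apply: SG_smooth. Qed.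

Lemma smooth_mult f g : smooth f -> smooth g -> smooth (fun y => f y * g y)%C.
Proof. by move=> sf sg; apply: smooth_gen_smooth; apply: SG_mult; apply: SG_smooth. Qed.

Lemma smooth_conj f : smooth f -> smooth (fun y => Cconj (f y)).
Proof. by move=> sf; apply: smooth_gen_smooth; apply: SG_conj; apply: SG_smooth. Qed.

Lemma smooth_scal (c : C) f : smooth f -> smooth (fun y => c * f y)%C.
Proof. by move=> sf; apply: smooth_mult => //; exact: smooth_const. Qed.

Lemma partial_plus k f g : smooth f -> smooth g ->
  partial k (fun y => f y + g y)%C = (fun y => partial k f y + partial k g y)%C.
Proof.
move=> sf sg; apply: (proj2 (partial_ext _)) => x.
by apply: has_partial_plus; exact: smooth_has_partial.
Qed.

Lemma partial_mult k f g : smooth f -> smooth g ->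
  partial k (fun y => f y * g y)%C =
  (fun y => partial k f y * g y + f y * partial k g y)%C.
Proof.
move=> sf sg; apply: (proj2 (partial_ext _)) => x.
by apply: has_partial_mult; exact: smooth_has_partial.
Qed.

Lemma partial_scal k (c : C) f : smooth f ->
  partial k (fun y => c * f y)%C = (fun y => c * partial k f y)%C.
Proof.
move=> sf; apply: (proj2 (partial_ext _)) => x.
have := has_partial_mult (has_partial_const k c x) (smooth_has_partial k x sf).
by congr has_partial; ring.
Qed.

Lemma partial_conj k f : smooth f ->
  partial k (fun y => Cconj (f y)) = (fun y => Cconj (partial k f y)).
Proof.
move=> sf; apply: (proj2 (partial_ext _)) => x.
by apply: has_partial_conj; exact: smooth_has_partial.
Qed.

Lemma partial_const k (c : C) : partial k (fun _ => c) = (fun _ => RtoC 0).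
Proof. by apply: (proj2 (partial_ext _)) => x; exact: has_partial_const. Qed.

Lemma iter_partial_plus l f g : smooth f -> smooth g ->
  iter_partial l (fun y => f y + g y)%C =
  (fun y => iter_partial l f y + iter_partial l g y)%C.
Proof.
by move=> sf sg; elim: l => //= k l ->; rewrite partial_plus //; exact: smooth_iter.
Qed.

Lemma iter_partial_conj l f : smooth f ->
  iter_partial l (fun y => Cconj (f y)) = (fun y => Cconj (iter_partial l f y)).
Proof.
by move=> sf; elim: l => //= k l ->; rewrite partial_conj //; exact: smooth_iter.
Qed.

Lemma iter_partial0 l : iter_partial l (fun _ : vec N => RtoC 0) = (fun _ => RtoC 0).
Proof. by elim: l => //= k l ->; exact: partial_const. Qed.

End Torus.

Lemma is_derive_eq (F : R -> R) (x a b : R) : is_derive F x a -> a = b -> is_derive F x b.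
Proof. by move=> ? <-. Qed.

(** * Fourier projections in one variable *)

Lemma RInt_Rext (f g : R -> R) a b : (forall x, f x = g x) ->
  RInt f a b = RInt g a b.
Proof. by move=> H; apply: RInt_ext => x _. Qed.

Lemma RInt_Rplus (f g : R -> R) a b : ex_RInt f a b -> ex_RInt g a b ->
  RInt (fun x => f x + g x) a b = RInt f a b + RInt g a b.
Proof. exact: RInt_plus. Qed.

Lemma RInt_Rminus (f g : R -> R) a b : ex_RInt f a b -> ex_RInt g a b ->
  RInt (fun x => f x - g x) a b = RInt f a b - RInt g a b.
Proof. exact: RInt_minus. Qed.

Lemma RInt_Rscal (c : R) (f : R -> R) a b : ex_RInt f a b ->
  RInt (fun x => c * f x) a b = c * RInt f a b.
Proof. by move=> ef; exact: (RInt_scal f). Qed.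

Lemma IZR_2PI_cos (a : Z) : cos (IZR a * (2 * PI)) = 1.
Proof.
have H (m : nat) : cos (INR m * (2 * PI)) = 1.
  have -> : INR m * (2 * PI) = 0 + 2 * INR m * PI by ring.
  by rewrite cos_period cos_0.
case: (Z.le_ge_cases 0 a) => ha.
  by rewrite -(Z2Nat.id a ha) -INR_IZR_INZ.
rewrite -(Z.opp_involutive a) opp_IZR Ropp_mult_distr_l_reverse cos_neg.
by rewrite -(Z2Nat.id (- a)) -?INR_IZR_INZ //; lia.
Qed.

Lemma IZR_2PI_sin (a : Z) : sin (IZR a * (2 * PI)) = 0.
Proof.
have := sin2_cos2 (IZR a * (2 * PI)); rewrite IZR_2PI_cos /Rsqr => H.
by apply: Rsqr_0_uniq; rewrite /Rsqr; lra.
Qed.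

Lemma two_PI_gt0 : 0 < 2 * PI.
Proof. by have := PI_RGT_0; lra. Qed.

Section Average.
Variables (N : nat) (k : 'I_N).
Implicit Types (r : vec N -> R) (w : R -> R).

(** Integrating along the line through [z], rather than over the [k]-th coordinate, yields again a
    function of all variables, on which the shifts in every direction act as on [r]. *)
Definition av w r (z : vec N) : R :=
  RInt (fun s => r (shift z k s) * w s) 0 (2 * PI).

Lemma continuous_av_integrand w r z s :
  (forall x, continuous r x) -> (forall s, continuous w s) ->
  continuous (fun s => r (shift z k s) * w s) s.
Proof.
move=> cr cw; apply: (continuous_mult (fun s => r (shift z k s)) w) => //.
by apply: (continuous_comp (fun s => shift z k s) r) => //; exact: continuous_shift.
Qed.

Lemma ex_RInt_av w r z :
  (forall x, continuous r x) -> (forall s, continuous w s) ->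
  ex_RInt (fun s => r (shift z k s) * w s) 0 (2 * PI).
Proof.
by move=> cr cw; apply: ex_RInt_continuous => s _; exact: continuous_av_integrand.
Qed.

Lemma av_bound w r z M :
  (forall x, continuous r x) -> (forall s, continuous w s) ->
  (forall s, Rabs (w s) <= 1) -> (forall x, Rabs (r x) <= M) ->
  Rabs (av w r z) <= 2 * PI * M.
Proof.
move=> cr cw bw br; have := two_PI_gt0 => pi2.
have -> : 2 * PI * M = (2 * PI - 0) * M by ring.
apply: abs_RInt_le_const; [lra | exact: ex_RInt_av | move=> t _].
rewrite Rabs_mult -(Rmult_1_r M).
by apply: Rmult_le_compat => //; exact: Rabs_pos.
Qed.

Lemma av_minus w r1 r2 z :
  (forall x, continuous r1 x) -> (forall x, continuous r2 x) ->
  (forall s, continuous w s) ->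
  av w (fun y => r1 y - r2 y) z = av w r1 z - av w r2 z.
Proof.
move=> c1 c2 cw; rewrite /av.
rewrite -RInt_Rminus; [|exact: ex_RInt_av..].
by apply: RInt_Rext => s; ring.
Qed.

Lemma av_scal w (c : R) r z :
  (forall x, continuous r x) -> (forall s, continuous w s) ->
  av w (fun y => c * r y) z = c * av w r z.
Proof.
move=> c1 cw; rewrite /av.
rewrite -RInt_Rscal; [|exact: ex_RInt_av..].
by apply: RInt_Rext => s; ring.
Qed.

(** A tube lemma: pointwise continuity along a compact segment is uniform in a neighbourhood of the
    segment. *)
Lemma shift_uniform r z (eps : R) : (forall x, continuous r x) -> 0 < eps ->
  exists d : posreal, forall y, ball z d y ->
    forall s, 0 <= s <= 2 * PI -> Rabs (r (shift y k s) - r (shift z k s)) <= eps.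
Proof.
move=> cr he.
have e2 : 0 < eps / 2 by lra.
have ex t : exists d : posreal, forall p, ball (shift z k t) d p ->
    Rabs (r p - r (shift z k t)) < eps / 2.
  have /filterlim_locally/(_ (mkposreal _ e2)) [d Hd] := cr (shift z k t).
  by exists d => p /Hd.
pose del t := proj1_sig (constructive_indefinite_description _ (ex t)).
have Hdel t : forall p, ball (shift z k t) (del t) p ->
    Rabs (r p - r (shift z k t)) < eps / 2.
  by rewrite /del; case: constructive_indefinite_description.
have dpos t : 0 < del t / 2 by have := cond_pos (del t); lra.
(* The radii are halved because the argument of [r] moves twice: by [s - t] along the segment and by
   the distance from [z] to [y]. *)
have [d Hd] := compactness_value_1d 0 (2 * PI) (fun t => mkposreal _ (dpos t)).
exists d => y by_ s hs.
have [t [_ /= [ht hd]]] := NNPP _ (Hd s hs).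
have b1 : ball (shift z k t) (del t) (shift z k s).
  move=> i; rewrite /shift; case: eqP => _; last exact: ball_center.
  rewrite /ball /= /AbsRing_ball /abs /minus /plus /opp /=.
  replace (z i + s + - (z i + t)) with (s - t) by ring.
  by have := dpos t; lra.
have b2 : ball (shift z k t) (del t) (shift y k s).
  move=> i; have := by_ i; have := dpos t.
  rewrite /shift /ball /= /AbsRing_ball /abs /minus /plus /opp /=.
  move=> d0 /Rabs_def2 bi; move/Rabs_def2: ht => ht.
  by case: eqP => _; apply: Rabs_def1; lra.
have /Rabs_def2 := Hdel _ _ b1; have /Rabs_def2 := Hdel _ _ b2.
by move=> ? ?; apply: Rabs_le; lra.
Qed.

Lemma continuous_av w r z :
  (forall x, continuous r x) -> (forall s, continuous w s) ->
  (forall s, Rabs (w s) <= 1) -> continuous (av w r) z.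
Proof.
move=> cr cw bw; apply/filterlim_locally => eps.
have pi2 := two_PI_gt0.
have he : 0 < eps / (2 * (2 * PI)).
  by apply: Rdiv_lt_0_compat; [exact: cond_pos | lra].
have [d Hd] := shift_uniform z cr he.
exists d => y by_.
rewrite /ball /= /AbsRing_ball /abs /minus /plus /opp /=.
have -> : av w r y + - av w r z =
    RInt (fun s => r (shift y k s) * w s - r (shift z k s) * w s) 0 (2 * PI).
  rewrite RInt_Rminus //; exact: ex_RInt_av.
apply: Rle_lt_trans (_ : (2 * PI - 0) * (eps / (2 * (2 * PI))) < _).
  apply: abs_RInt_le_const; first lra.
    by apply: (@ex_RInt_minus R_NormedModule); exact: ex_RInt_av.
  move=> t ht; rewrite -Rmult_minus_distr_r Rabs_mult -[X in _ <= X]Rmult_1_r.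
  by apply: Rmult_le_compat; try exact: Rabs_pos; first exact: Hd.
have := cond_pos eps => e0.
replace ((2 * PI - 0) * (eps / (2 * (2 * PI)))) with (eps / 2) by (field; lra).
lra.
Qed.

Lemma is_derive_av l w r r' z :
  (forall x, continuous r x) -> (forall x, continuous r' x) ->
  (forall s, continuous w s) ->
  (forall x, is_derive (fun h => r (shift x l h)) 0 (r' x)) ->
  is_derive (fun h => av w r (shift z l h)) 0 (av w r' z).
Proof.
move=> cr cr' cw dr.
pose f h s := r (shift (shift z l h) k s) * w s.
have df u v : is_derive (fun h => f h v) u (r' (shift (shift z l u) k v) * w v).
  have := @is_derive_scal_l R_AbsRing R_NormedModule
    (fun h => r (shift (shift z l h) k v)) u (r' (shift (shift z l u) k v)) (w v).
  rewrite /scal /= /mult /=; apply.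
  rewrite shiftC; apply: (is_derive_ext (fun h => r (shift (shift z k v) l h))).
    by move=> t; rewrite shiftC.
  exact: is_derive_shift.
have -> : av w r' z = RInt (fun s => Derive (fun u => f u s) 0) 0 (2 * PI).
  apply: RInt_Rext => s; rewrite (is_derive_unique _ _ _ (df 0 s)).
  by rewrite shift0.
apply: (@is_derive_RInt_param f).
- by apply: filter_forall => h t _; eexists; exact: df.
- move=> t _; apply/continuity_2d_pt_filterlim.
  apply: (continuous_ext (fun p : R * R =>
     r' (shift (shift z l (fst p)) k (snd p)) * w (snd p))).
    by move=> p; rewrite (is_derive_unique _ _ _ (df _ _)).
  apply: (continuous_mult (fun p : R * R => r' (shift (shift z l (fst p)) k (snd p)))
     (fun p => w (snd p))).
    apply: (continuous_comp (fun p : R * R => shift (shift z l (fst p)) k (snd p)) r').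
      exact: continuous_shift_pair.
    exact: cr'.
  by apply: (continuous_comp snd w) => //; exact: continuous_snd.
- by apply: filter_forall => h; exact: ex_RInt_av.
Qed.

Definition wcos (a : Z) (s : R) := cos (IZR a * s).
Definition wsin (a : Z) (s : R) := sin (IZR a * s).

Lemma is_derive_wcos a s : is_derive (wcos a) s (- IZR a * wsin a s).
Proof. by rewrite /wcos /wsin; auto_derive => //; ring. Qed.

Lemma is_derive_wsin a s : is_derive (wsin a) s (IZR a * wcos a s).
Proof. by rewrite /wcos /wsin; auto_derive => //; ring. Qed.

Lemma continuous_wcos a s : continuous (wcos a) s.
Proof. by apply: ex_derive_continuous; eexists; exact: is_derive_wcos. Qed.

Lemma continuous_wsin a s : continuous (wsin a) s.
Proof. by apply: ex_derive_continuous; eexists; exact: is_derive_wsin. Qed.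

Lemma wcos_bound a s : Rabs (wcos a s) <= 1.
Proof. by apply: Rabs_le; exact: COS_bound. Qed.

Lemma wsin_bound a s : Rabs (wsin a s) <= 1.
Proof. by apply: Rabs_le; exact: SIN_bound. Qed.

Lemma wcos0 a : wcos a 0 = 1. Proof. by rewrite /wcos Rmult_0_r cos_0. Qed.
Lemma wsin0 a : wsin a 0 = 0. Proof. by rewrite /wsin Rmult_0_r sin_0. Qed.
Lemma wcos2PI a : wcos a (2 * PI) = 1. Proof. exact: IZR_2PI_cos. Qed.
Lemma wsin2PI a : wsin a (2 * PI) = 0. Proof. exact: IZR_2PI_sin. Qed.

(** Integration by parts; periodicity of [r] and of [w] cancels the boundary terms. *)
Lemma av_ibp w w' r r' z :
  (forall x, continuous r x) -> (forall x, continuous r' x) ->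
  (forall x, is_derive (fun h => r (shift x k h)) 0 (r' x)) ->
  (forall x, r (shift x k (2 * PI)) = r x) ->
  (forall s, is_derive w s (w' s)) -> (forall s, continuous w' s) ->
  w (2 * PI) = w 0 ->
  av w r' z = - av w' r z.
Proof.
move=> cr cr' dr pr dw cw' w2.
have cw s : continuous w s by apply: ex_derive_continuous; eexists; exact: dw.
have H : is_RInt (fun s => r' (shift z k s) * w s + r (shift z k s) * w' s) 0 (2 * PI)
    (minus (r (shift z k (2 * PI)) * w (2 * PI)) (r (shift z k 0) * w 0)).
  apply: (is_RInt_derive (fun s => r (shift z k s) * w s)) => s _.
    apply: (is_derive_mult (fun s => r (shift z k s)) w) => //.
      exact: is_derive_shift.
    exact: Rmult_comm.
  by apply: (continuous_plus (fun s => r' (shift z k s) * w s));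
     exact: continuous_av_integrand.
move: (is_RInt_unique _ _ _ _ H).
rewrite RInt_Rplus; [|exact: ex_RInt_av..].
rewrite pr shift0 w2 minus_eq_zero /av /plus /zero /=.
lra.
Qed.

End Average.

Section Fproj.
Variable N : nat.
Implicit Types (f g : vec N -> C) (k l : 'I_N) (a : Z).

(* Real and imaginary parts of [(2 PI)^-1 \int_0^{2 PI} f (z + s e_k) e^{- i a s} ds]:
   the component of [f] of frequency [a] in the variable [k]. *)
Definition fproj k a f : vec N -> C := fun z =>
  ((av k (wcos a) (fun y => Re (f y)) z + av k (wsin a) (fun y => Im (f y)) z) / (2 * PI),
   (av k (wcos a) (fun y => Im (f y)) z - av k (wsin a) (fun y => Re (f y)) z) / (2 * PI)).

Definition Cont f := forall x, continuous f x.

Lemma Cont_Re f : Cont f -> forall x, continuous (fun y => Re (f y)) x.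
Proof. by move=> cf x; case/continuous_ReIm: (cf x). Qed.

Lemma Cont_Im f : Cont f -> forall x, continuous (fun y => Im (f y)) x.
Proof. by move=> cf x; case/continuous_ReIm: (cf x). Qed.

#[local] Hint Resolve Cont_Re Cont_Im continuous_wcos continuous_wsin wcos_bound wsin_bound
  smooth_continuous : core.

Lemma Cont_fproj k a f : Cont f -> Cont (fproj k a f).
Proof.
move=> cf x; apply/continuous_ReIm; split; rewrite /fproj /Re /Im /=.
- apply: (continuous_mult (fun y => av k (wcos a) (fun y => Re (f y)) y +
    av k (wsin a) (fun y => Im (f y)) y) (fun _ => / (2 * PI))); last exact: continuous_const.
  by apply: (continuous_plus (av k (wcos a) (fun y => Re (f y)))
     (av k (wsin a) (fun y => Im (f y)))); apply: continuous_av; auto.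
- apply: (continuous_mult (fun y => av k (wcos a) (fun y => Im (f y)) y -
    av k (wsin a) (fun y => Re (f y)) y) (fun _ => / (2 * PI))); last exact: continuous_const.
  by apply: (continuous_minus (av k (wcos a) (fun y => Im (f y)))
     (av k (wsin a) (fun y => Re (f y)))); apply: continuous_av; auto.
Qed.

Lemma has_partial_fproj k a f l z : smooth f ->
  has_partial l (fproj k a f) z (fproj k a (partial l f) z).
Proof.
move=> sf; have sd := smooth_partial l sf.
have cf : Cont f by exact: smooth_continuous.
have cd : Cont (partial l f) by exact: smooth_continuous.
have A w : (forall s, continuous w s) ->
    is_derive (fun h => av k w (fun y => Re (f y)) (shift z l h)) 0
      (av k w (fun y => Re (partial l f y)) z).
  move=> cw; apply: is_derive_av; auto.
  by move=> x; case: (smooth_has_partial l x sf).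
have B w : (forall s, continuous w s) ->
    is_derive (fun h => av k w (fun y => Im (f y)) (shift z l h)) 0
      (av k w (fun y => Im (partial l f y)) z).
  move=> cw; apply: is_derive_av; auto.
  by move=> x; case: (smooth_has_partial l x sf).
have D (F : R -> R) d : is_derive F 0 d -> is_derive (fun h => F h / (2 * PI)) 0 (d / (2 * PI)).
  by move=> dF; have := @is_derive_scal_l R_AbsRing R_NormedModule F 0 d (/ (2 * PI)); apply.
split; rewrite /fproj /Re /Im /=; apply: D.
- by apply: (is_derive_plus (fun h => av k (wcos a) (fun y => fst (f y)) (shift z l h))
     (fun h => av k (wsin a) (fun y => snd (f y)) (shift z l h))); auto.
- by apply: (is_derive_minus (fun h => av k (wcos a) (fun y => snd (f y)) (shift z l h))
     (fun h => av k (wsin a) (fun y => fst (f y)) (shift z l h))); auto.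
Qed.

Lemma partial_fproj k a f l : smooth f ->
  partial l (fproj k a f) = fproj k a (partial l f).
Proof. by move=> sf; apply: (proj2 (partial_ext _)) => x; exact: has_partial_fproj. Qed.

Lemma smooth_fproj k a f : smooth f -> smooth (fproj k a f).
Proof.
move=> sf; apply: (@smooth_coind _ (fun h => exists2 g, smooth g & h = fproj k a g));
  last by exists f.
move=> h [g sg ->]; split; first by apply: Cont_fproj; exact: smooth_continuous.
move=> l; have [? ->] := partial_ext (fun x => has_partial_fproj k a l x sg).
by split => //; exists (partial l g) => //; exact: smooth_partial.
Qed.

Lemma periodic_fproj k a f : periodic f -> periodic (fproj k a f).
Proof.
move=> pf x l.
have A w (h : C -> R) : av k w (fun y => h (f y)) (shift x l (2 * PI)) =
    av k w (fun y => h (f y)) x.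
  by apply: RInt_Rext => s; rewrite shiftC pf.
by rewrite /fproj !A.
Qed.

Lemma fproj_partial k a f z : smooth f -> periodic f ->
  fproj k a (partial k f) z = (Ci * RtoC (IZR a) * fproj k a f z)%C.
Proof.
move=> sf pf; have sd := smooth_partial k sf.
have cf : Cont f by exact: smooth_continuous.
have cd : Cont (partial k f) by exact: smooth_continuous.
have df x := smooth_has_partial k x sf.
have cc c w s : (forall s, continuous w s) -> continuous (fun s : R => c * w s) s.
  by move=> cw; apply: (continuous_mult (fun _ => c) w) => //; exact: continuous_const.
have A (r r' : vec N -> R) : (forall x, continuous r x) -> (forall x, continuous r' x) ->
  (forall x, is_derive (fun h => r (shift x k h)) 0 (r' x)) ->
  (forall x, r (shift x k (2 * PI)) = r x) ->
  av k (wcos a) r' z = IZR a * av k (wsin a) r z /\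
  av k (wsin a) r' z = - (IZR a * av k (wcos a) r z).
  move=> cr cr' dr pr; split.
  - rewrite (@av_ibp _ k (wcos a) (fun s => - IZR a * wsin a s) r) //; auto.
    + have -> : av k (fun s => - IZR a * wsin a s) r z =
               av k (wsin a) (fun y => - IZR a * r y) z.
        by apply: RInt_Rext => s; ring.
      by rewrite av_scal; auto; ring.
    + exact: is_derive_wcos.
    + by rewrite wcos0 wcos2PI.
  - rewrite (@av_ibp _ k (wsin a) (fun s => IZR a * wcos a s) r) //; auto.
    + have -> : av k (fun s => IZR a * wcos a s) r z =
               av k (wcos a) (fun y => IZR a * r y) z.
        by apply: RInt_Rext => s; ring.
      by rewrite av_scal; auto; ring.
    + exact: is_derive_wsin.
    + by rewrite wsin0 wsin2PI.
have [] := A (fun y => Re (f y)) (fun y => Re (partial k f y)); auto.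
- by move=> x; case: (df x).
- by move=> x; rewrite pf.
move=> E1 E2.
have [] := A (fun y => Im (f y)) (fun y => Im (partial k f y)); auto.
- by move=> x; case: (df x).
- by move=> x; rewrite pf.
move=> E3 E4.
have := PI_neq0 => p0.
by apply: C_eq; move: E1 E2 E3 E4; rewrite /fproj /Re /Im /= => E1 E2 E3 E4;
   rewrite ?E1 ?E2 ?E3 ?E4; field.
Qed.

(** The factor 4 comes from estimating separately the two integrals in each of the real and
    imaginary parts. It is harmless, as the projection is iterated once per variable. *)
Lemma fproj_bound k a f M z : Cont f -> (forall x, Cmod (f x) <= M) ->
  Cmod (fproj k a f z) <= 4 * M.
Proof.
move=> cf bf; have pi2 := two_PI_gt0.
have b1 x : Rabs (Re (f x)) <= M by apply: Rle_trans (bf x); exact: re_le_Cmod.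
have b2 x : Rabs (Im (f x)) <= M by apply: Rle_trans (bf x); exact: im_le_Cmod.
have H x y : Rabs x <= 2 * PI * M -> Rabs y <= 2 * PI * M ->
    Rabs ((x + y) / (2 * PI)) <= 2 * M.
  move=> hx hy; rewrite Rabs_mult (Rabs_pos_eq (/ _)); last first.
    by left; exact: Rinv_0_lt_compat.
  apply: (Rmult_le_reg_r (2 * PI)) => //; rewrite Rmult_assoc Rinv_l ?Rmult_1_r; last lra.
  by apply: Rle_trans (Rabs_triang _ _) _; lra.
apply: Rle_trans (Cmod_le_ReIm _) _.
have -> : 4 * M = 2 * M + 2 * M by ring.
apply: Rplus_le_compat; rewrite /fproj /Re /Im /=; apply: H; rewrite ?Rabs_Ropp;
  by apply: av_bound; auto.
Qed.

Lemma fproj_minus k a f g z : Cont f -> Cont g ->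
  fproj k a (fun y => f y - g y)%C z = (fproj k a f z - fproj k a g z)%C.
Proof.
move=> cf cg; have := PI_neq0 => p0.
have L w (r1 r2 : vec N -> R) : (forall s, continuous w s) ->
    (forall x, continuous r1 x) -> (forall x, continuous r2 x) ->
    av k w (fun y => r1 y + - r2 y) z = av k w r1 z - av k w r2 z.
  by move=> cw c1 c2; exact: av_minus.
apply: C_eq; rewrite /fproj /Re /Im /=; rewrite !L; auto; field => //.
Qed.

Lemma fproj_scal k a (c : C) f z : Cont f ->
  fproj k a (fun y => c * f y)%C z = (c * fproj k a f z)%C.
Proof.
move=> cf; have := PI_neq0 => p0.
have S w (c1 c2 : R) (r1 r2 : vec N -> R) : (forall s, continuous w s) ->
    (forall x, continuous r1 x) -> (forall x, continuous r2 x) ->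
    av k w (fun y => c1 * r1 y - c2 * r2 y) z = c1 * av k w r1 z - c2 * av k w r2 z.
  move=> cw k1 k2; rewrite (@av_minus _ k w (fun y => c1 * r1 y) (fun y => c2 * r2 y)) //.
  - by rewrite !av_scal.
  - by move=> x; apply: (continuous_mult (fun _ => c1) r1) => //; exact: continuous_const.
  - by move=> x; apply: (continuous_mult (fun _ => c2) r2) => //; exact: continuous_const.
have S2 w (c1 c2 : R) (r1 r2 : vec N -> R) : (forall s, continuous w s) ->
    (forall x, continuous r1 x) -> (forall x, continuous r2 x) ->
    av k w (fun y => c1 * r1 y + c2 * r2 y) z = c1 * av k w r1 z + c2 * av k w r2 z.
  move=> cw k1 k2; have E := S w c1 (- c2) r1 r2 cw k1 k2.
  have -> : c1 * av k w r1 z + c2 * av k w r2 z = c1 * av k w r1 z - - c2 * av k w r2 z.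
    by ring.
  by rewrite -E; apply: RInt_Rext => s; ring.
apply: C_eq; rewrite /fproj /Re /Im /=; rewrite ?S ?S2; auto; field => //.
Qed.

Lemma is_derive0_const (F : R -> R) : (forall s, is_derive F s 0) ->
  forall s, F s = F 0.
Proof.
move=> dF s; case: (Rtotal_order s 0) => [h | [-> // | h]].
  by apply: eq_is_derive h => t _; exact: dF.
by symmetry; apply: eq_is_derive h => t _; exact: dF.
Qed.

(** The hypothesis makes [f (z + s e_k) e^{- i a s}] constant in [s], so its average is its value at
    [s = 0]. [E1] and [E2] are the real and imaginary parts of this. *)
Lemma fproj_eigen k a f z : smooth f ->
  (forall x, partial k f x = (Ci * RtoC (IZR a) * f x)%C) -> fproj k a f z = f z.
Proof.
move=> sf ef; have := PI_neq0 => p0.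
have cf : Cont f by exact: smooth_continuous.
have d s : is_derive (fun s => Re (f (shift z k s))) s (- IZR a * Im (f (shift z k s))) /\
           is_derive (fun s => Im (f (shift z k s))) s (IZR a * Re (f (shift z k s))).
  have [] := has_partial_shift (smooth_has_partial k (shift z k s) sf).
  rewrite ef => d1 d2; split; [apply: is_derive_eq d1 _ | apply: is_derive_eq d2 _];
    by rewrite /Re /Im /=; ring.
have E1 s : Re (f (shift z k s)) * wcos a s + Im (f (shift z k s)) * wsin a s = Re (f z).
  rewrite (@is_derive0_const (fun s => Re (f (shift z k s)) * wcos a s +
    Im (f (shift z k s)) * wsin a s)) ?shift0 ?wcos0 ?wsin0; first by ring.
  move=> t; have [d1 d2] := d t.
  apply: is_derive_eq; first exact: (is_derive_plus _ _ _ _ _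
   (is_derive_mult _ (wcos a) _ _ _ d1 (is_derive_wcos a t) Rmult_comm)
   (is_derive_mult _ (wsin a) _ _ _ d2 (is_derive_wsin a t) Rmult_comm)).
  by rewrite /plus /mult /=; ring.
have E2 s : Im (f (shift z k s)) * wcos a s - Re (f (shift z k s)) * wsin a s = Im (f z).
  rewrite (@is_derive0_const (fun s => Im (f (shift z k s)) * wcos a s -
    Re (f (shift z k s)) * wsin a s)) ?shift0 ?wcos0 ?wsin0; first by ring.
  move=> t; have [d1 d2] := d t.
  apply: is_derive_eq; first exact: (is_derive_minus _ _ _ _ _
   (is_derive_mult _ (wcos a) _ _ _ d2 (is_derive_wcos a t) Rmult_comm)
   (is_derive_mult _ (wsin a) _ _ _ d1 (is_derive_wsin a t) Rmult_comm)).
  by rewrite /minus /opp /plus /mult /=; ring.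
have XR w (cw : forall s, continuous w s) := ex_RInt_av k z (Cont_Re cf) cw.
have XI w (cw : forall s, continuous w s) := ex_RInt_av k z (Cont_Im cf) cw.
have I (c : R) : RInt (fun _ => c) 0 (2 * PI) = 2 * PI * c.
  by rewrite RInt_const /scal /= /mult /=; ring.
apply: C_eq; rewrite /fproj {1}/Re {1}/Im /= /av.
- rewrite -RInt_Rplus; [|exact: XR|exact: XI].
  by rewrite (RInt_Rext _ _ E1) I; field.
- rewrite -RInt_Rminus; [|exact: XI|exact: XR].
  by rewrite (RInt_Rext _ _ E2) I; field.
Qed.
End Fproj.

(** * Uniqueness of Fourier coefficients *)

Lemma RInt_ge_const (F : R -> R) a b m : a <= b -> (forall s, continuous F s) ->
  (forall s, a <= s <= b -> m <= F s) -> m * (b - a) <= RInt F a b.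
Proof.
move=> ab cF hF.
have <- : RInt (fun _ => m) a b = m * (b - a).
  by rewrite RInt_const /scal /= /mult /=; ring.
apply: RInt_le => // [||s hs]; first exact: ex_RInt_const.
  by apply: ex_RInt_continuous => s _; exact: cF.
by apply: hF; lra.
Qed.

(* The trigonometric polynomials [(1 + cos s)^p] concentrate at [0] modulo
   [2 PI]. *)
Lemma cos_moments_le0 (v : R -> R) : (forall s, continuous v s) ->
  v (2 * PI) = v 0 ->
  (forall a : Z, RInt (fun s => v s * wcos a s) 0 (2 * PI) = 0) -> v 0 <= 0.
Proof.
move=> cv v2 hv; apply: Rnot_lt_le => v0.
have pi1 := PI2_1; have pi0 := PI_RGT_0.
have ccos s : continuous (fun s => 1 + cos s) s.
  by apply: ex_derive_continuous; auto_derive.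
have cpow p s : continuous (fun s => (1 + cos s) ^ p) s.
  by apply: ex_derive_continuous; auto_derive.
have mult_cont (f g : R -> R) s : continuous f s -> continuous g s ->
    continuous (fun s => f s * g s) s by move=> cf cg; exact: continuous_mult.
(* The product formula for [cos (a s) cos s] expresses a moment of power [p + 1] by moments of power
   [p] at the frequencies [a], [a + 1] and [a - 1]; hence the induction is over all [a] at once. *)
have H p a : RInt (fun s => v s * wcos a s * (1 + cos s) ^ p) 0 (2 * PI) = 0.
  elim: p a => [|p IH] a.
    by apply: eq_trans (hv a); apply: RInt_Rext => s; rewrite pow_O; ring.
  have ex b : ex_RInt (fun s => v s * wcos b s * (1 + cos s) ^ p) 0 (2 * PI).
    apply: ex_RInt_continuous => s _; apply: (mult_cont (fun s => v s * wcos b s)) => //.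
    by apply: mult_cont => //; exact: continuous_wcos.
  have -> : RInt (fun s => v s * wcos a s * (1 + cos s) ^ p.+1) 0 (2 * PI) =
      RInt (fun s => v s * wcos a s * (1 + cos s) ^ p + / 2 *
        (v s * wcos (a + 1) s * (1 + cos s) ^ p + v s * wcos (a - 1) s * (1 + cos s) ^ p))
        0 (2 * PI).
    apply: RInt_Rext => s; rewrite /wcos plus_IZR minus_IZR.
    rewrite Rmult_plus_distr_r Rmult_minus_distr_r Rmult_1_l cos_plus cos_minus.
    by rewrite [_ ^ p.+1]/=; field.
  rewrite RInt_Rplus //; last first.
    by apply: (@ex_RInt_scal R_NormedModule); apply: (@ex_RInt_plus R_NormedModule).
  rewrite RInt_Rscal; last by apply: (@ex_RInt_plus R_NormedModule).
  by rewrite RInt_Rplus // !IH !Rplus_0_l Rmult_0_r.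
have {}H p : RInt (fun s => v s * (1 + cos s) ^ p) 0 (2 * PI) = 0.
  apply: eq_trans (H p 0%Z); apply: RInt_Rext => s.
  by rewrite /wcos Rmult_0_l cos_0 Rmult_1_r.
have c0 : 0 < v 0 / 2 by lra.
have near t : v t = v 0 -> exists d : posreal, forall s, Rabs (s - t) < d -> v 0 / 2 <= v s.
  move=> vt; have /filterlim_locally/(_ (mkposreal _ c0)) [d Hd] := cv t.
  exists d => s /Hd; rewrite vt /ball /= /AbsRing_ball /abs /minus /plus /opp /=.
  by move=> /Rabs_def2; lra.
have [d1 Hd1] := near 0 erefl; have [d2 Hd2] := near _ v2.
(* On the intervals of length [d] at both ends, [v] is at least [v 0 / 2]. The bound [d <= 1] keeps
   [d] below [PI / 2], where [cos] is positive. *)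
have [d [d0 [dd1 [dd2 dle]]]] : exists d, 0 < d /\ d < d1 /\ d < d2 /\ d <= 1.
  exists (Rmin (Rmin (d1 / 2) (d2 / 2)) 1).
  have := cond_pos d1; have := cond_pos d2 => *.
  split; first by do !apply: Rmin_glb_lt; lra.
  have := Rmin_l (Rmin (d1 / 2) (d2 / 2)) 1.
  have := Rmin_r (Rmin (d1 / 2) (d2 / 2)) 1.
  have := Rmin_l (d1 / 2) (d2 / 2); have := Rmin_r (d1 / 2) (d2 / 2); lra.
have [M [M0 HM]] : exists M, 0 <= M /\ forall s, 0 <= s <= 2 * PI -> Rabs (v s) <= M.
  have [||x [Hx _]] := continuity_ab_maj (fun s => Rabs (v s)) 0 (2 * PI); first lra.
    move=> s _; apply/continuity_pt_filterlim.
    by apply: (continuous_comp v Rabs) => //; exact: continuous_Rabs.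
  by exists (Rabs (v x)); split => //; exact: Rabs_pos.
(* The kernel [1 + cos s] is at least [q] on [[0, d / 2]] and at most [r] on [[d, 2 PI - d]]. The
   contradiction will come from [r < q]. *)
set r := 1 + cos d; set q := 1 + cos (d / 2).
have r0 : 0 < r by rewrite /r; have := cos_gt_0 d; lra.
have rq : r < q.
  by rewrite /r /q; have := cos_decreasing_1 (d / 2) d; lra.
have cosb s : d <= s <= 2 * PI - d -> 0 <= 1 + cos s <= r.
  move=> hs; split; first by have := COS_bound s; lra.
  rewrite /r; apply: Rplus_le_compat_l.
  case: (Rle_lt_dec s PI) => h; first by apply: cos_decr_1; lra.
  have -> : cos s = cos (2 * PI - s) by rewrite cos_minus cos_2PI sin_2PI; ring.
  by apply: cos_decr_1; lra.
(* The integral of [F] vanishes and is cut at [d / 2], [d] and [2 PI - d]. The pieces near the ends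
   are nonnegative, so the peak on [[0, d / 2]] has to be compensated by the middle piece. *)
have main p : v 0 / 2 * q ^ p * (d / 2) <= M * r ^ p * (2 * PI).
  set F := fun s => v s * (1 + cos s) ^ p.
  have cF s : continuous F s by exact: mult_cont.
  have ex a b : ex_RInt F a b by apply: ex_RInt_continuous => s _.
  have Ch a b c : RInt F a b + RInt F b c = RInt F a c by exact: (@RInt_Chasles R_CompleteNormedModule).
  have pw s : 0 <= (1 + cos s) ^ p by apply: pow_le; have := COS_bound s; lra.
  have I1 : v 0 / 2 * q ^ p * (d / 2 - 0) <= RInt F 0 (d / 2).
    apply: RInt_ge_const => //; first lra.
    move=> s hs; apply: Rmult_le_compat; first lra.
    - by apply: pow_le; lra.
    - by apply: Hd1; apply: Rabs_def1; lra.
    - apply: pow_incr; split; first lra.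
      by rewrite /q; apply: Rplus_le_compat_l; apply: cos_decr_1; lra.
  have I2 : 0 * (d - d / 2) <= RInt F (d / 2) d.
    apply: RInt_ge_const => //; first lra.
    move=> s hs; apply: Rmult_le_pos => //.
    by apply: Rle_trans (Hd1 s _); [lra | apply: Rabs_def1; lra].
  have I3 : - (M * r ^ p) * (2 * PI - d - d) <= RInt F d (2 * PI - d).
    apply: RInt_ge_const => //; first lra.
    move=> s hs.
    have : Rabs (F s) <= M * r ^ p.
      rewrite /F Rabs_mult (Rabs_pos_eq (_ ^ p)) //.
      apply: Rmult_le_compat => //; first exact: Rabs_pos.
        by apply: HM; lra.
      by apply: pow_incr; exact: cosb.
    by move=> /Rabs_le_between; lra.
  have I4 : 0 * (2 * PI - (2 * PI - d)) <= RInt F (2 * PI - d) (2 * PI).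
    apply: RInt_ge_const => //; first lra.
    move=> s hs; apply: Rmult_le_pos => //.
    by apply: Rle_trans (Hd2 s _); [lra | apply: Rabs_def1; lra].
  have := Ch 0 (d / 2) d; have := Ch 0 d (2 * PI - d); have := Ch 0 (2 * PI - d) (2 * PI).
  rewrite {3}/F H => e1 e2 e3.
  have : 0 <= M * r ^ p * (2 * d).
    by apply: Rmult_le_pos; [apply: Rmult_le_pos => //; apply: pow_le | ]; lra.
  by lra.
pose x := q / r - 1.
have x0 : 0 < x.
  have : 1 < q / r by apply: (Rmult_lt_reg_r r) => //; field_simplify; lra.
  by rewrite /x; lra.
have qE : q = r * (1 + x) by rewrite /x; field; lra.
(* After division by [r ^ p], Bernoulli's inequality makes the left side grow linearly in [p] while
   the right side stays constant. *)
have {}main p : v 0 / 2 * (d / 2) * (INR p * x) <= M * (2 * PI).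
  have rp : 0 < r ^ p by exact: pow_lt.
  have := main p; rewrite qE Rpow_mult_distr => hp.
  have bern : INR p * x <= (1 + x) ^ p by have := poly p x x0; lra.
  apply: (Rmult_le_reg_l (r ^ p)) => //.
  have : v 0 / 2 * (d / 2) * r ^ p * (INR p * x) <= v 0 / 2 * (d / 2) * r ^ p * (1 + x) ^ p.
    by apply: Rmult_le_compat_l => //; apply: Rmult_le_pos; [apply: Rmult_le_pos|]; lra.
  by lra.
have K0 : 0 < v 0 / 2 * (d / 2) * x.
  by apply: Rmult_lt_0_compat => //; apply: Rmult_lt_0_compat; lra.
have [p hp] := INR_unbounded (M * (2 * PI) / (v 0 / 2 * (d / 2) * x)).
have := main p.
have : M * (2 * PI) < INR p * (v 0 / 2 * (d / 2) * x).
  move: hp => /(Rmult_lt_compat_r _ _ _ K0); rewrite /Rdiv Rmult_assoc Rinv_l; first by lra.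
  by apply: Rgt_not_eq.
by lra.
Qed.

Section Eproj.
Variable N : nat.
Implicit Types (f g : vec N -> C) (k l : 'I_N) (zeta : 'I_N -> Z).

(** Adding the projections for [a] and [- a] isolates the cosine averages of [Re f] and of [Im f],
    since [wcos] is even and [wsin] odd in [a]. [cos_moments_le0] is then applied to a real function
    and to its opposite. *)
Lemma fproj_uniqueness k f : Cont f -> periodic f ->
  (forall a z, fproj k a f z = RtoC 0) -> forall z, f z = RtoC 0.
Proof.
move=> cf pf hf z.
have zero (r : vec N -> R) : (forall x, continuous r x) ->
    r (shift z k (2 * PI)) = r z ->
    (forall a, av k (wcos a) r z = 0) -> r z = 0.
  move=> cr pr hr.
  have cs s : continuous (fun s => r (shift z k s)) s.
    by apply: (continuous_comp (fun s => shift z k s) r) => //; exact: continuous_shift.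
  apply: Rle_antisym.
    have := @cos_moments_le0 (fun s => r (shift z k s)) cs.
    by rewrite shift0; apply.
  have := @cos_moments_le0 (fun s => - r (shift z k s)).
  rewrite shift0 => /(_ _ _ _)H; suff : - r z <= 0 by lra.
  apply: H; first by move=> s; exact: (continuous_opp (fun s => r (shift z k s))).
    by rewrite pr.
  move=> a; apply: (@eq_trans _ _ (av k (wcos a) (fun y => -1 * r y) z)).
    by apply: RInt_Rext => s; ring.
  by rewrite av_scal // ?hr ?Rmult_0_r // => s; exact: continuous_wcos.
have odd_sin a (r : vec N -> R) : (forall x, continuous r x) ->
    av k (wsin (- a)) r z = - av k (wsin a) r z.
  move=> cr; have -> : - av k (wsin a) r z = -1 * av k (wsin a) r z by ring.
  rewrite -av_scal => // [|s]; last exact: continuous_wsin.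
  by apply: RInt_Rext => s; rewrite /wsin opp_IZR Ropp_mult_distr_l_reverse sin_neg; ring.
have even_cos a (r : vec N -> R) : av k (wcos (- a)) r z = av k (wcos a) r z.
  by apply: RInt_Rext => s; rewrite /wcos opp_IZR Ropp_mult_distr_l_reverse cos_neg.
have pi2 := two_PI_gt0.
have split0 x y : x + y = 0 -> x - y = 0 -> x = 0 by lra.
have div0 x : x / (2 * PI) = 0 -> x = 0.
  move=> /(Rmult_eq_compat_r (2 * PI)); rewrite /Rdiv Rmult_assoc Rinv_l; lra.
have num a : av k (wcos a) (fun y => Re (f y)) z + av k (wsin a) (fun y => Im (f y)) z = 0 /\
    av k (wcos a) (fun y => Im (f y)) z - av k (wsin a) (fun y => Re (f y)) z = 0.
  by have := hf a z; rewrite /fproj => -[/div0 ? /div0 ?].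
apply: C_eq.
- apply: (zero (fun y => Re (f y))); [exact: Cont_Re | by rewrite pf | move=> a].
  have [h1 _] := num a; have [h2 _] := num (- a)%Z.
  move: h2; rewrite even_cos odd_sin; last exact: Cont_Im.
  by lra.
- apply: (zero (fun y => Im (f y))); [exact: Cont_Im | by rewrite pf | move=> a].
  have [_ h1] := num a; have [_ h2] := num (- a)%Z.
  move: h2; rewrite even_cos odd_sin; last exact: Cont_Re.
  by lra.
Qed.

Definition eproj (ks : seq 'I_N) zeta f : vec N -> C :=
  foldr (fun k g => fproj k (zeta k) g) f ks.

Lemma smooth_eproj ks zeta f : smooth f -> smooth (eproj ks zeta f).
Proof. by move=> sf; elim: ks => //= k ks; exact: smooth_fproj. Qed.

Lemma Cont_eproj ks zeta f : Cont f -> Cont (eproj ks zeta f).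
Proof. by move=> sf; elim: ks => //= k ks; exact: Cont_fproj. Qed.

Lemma periodic_eproj ks zeta f : periodic f -> periodic (eproj ks zeta f).
Proof. by move=> pf; elim: ks => //= k ks; exact: periodic_fproj. Qed.

Lemma partial_eproj ks zeta f l : smooth f ->
  partial l (eproj ks zeta f) = eproj ks zeta (partial l f).
Proof.
move=> sf; elim: ks => //= k ks IH.
by rewrite partial_fproj ?IH //; exact: smooth_eproj.
Qed.

Lemma eproj_scal ks zeta (c : C) f : Cont f ->
  eproj ks zeta (fun y => c * f y)%C = (fun y => c * eproj ks zeta f y)%C.
Proof.
move=> cf; elim: ks => //= k ks ->.
by apply: functional_extensionality => z; rewrite fproj_scal //; exact: Cont_eproj.
Qed.

Lemma eproj_minus ks zeta f g : Cont f -> Cont g ->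
  eproj ks zeta (fun y => f y - g y)%C =
  (fun y => eproj ks zeta f y - eproj ks zeta g y)%C.
Proof.
move=> cf cg; elim: ks => //= k ks ->.
by apply: functional_extensionality => z; rewrite fproj_minus //; exact: Cont_eproj.
Qed.

Lemma eproj_bound ks zeta f M z : Cont f -> (forall x, Cmod (f x) <= M) ->
  Cmod (eproj ks zeta f z) <= 4 ^ size ks * M.
Proof.
move=> cf bf; elim: ks z => [|k ks IH] z /=; first by rewrite Rmult_1_l.
by rewrite Rmult_assoc; apply: fproj_bound => //; exact: Cont_eproj.
Qed.

Lemma eproj_partial_eq ks zeta f k : smooth f -> periodic f -> k \in ks ->
  eproj ks zeta (partial k f) =
  (fun z => Ci * RtoC (IZR (zeta k)) * eproj ks zeta f z)%C.
Proof.
move=> sf pf; elim: ks => //= k' ks IH; rewrite inE => /orP[/eqP -> | kin].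
  apply: functional_extensionality => z.
  rewrite -partial_eproj // fproj_partial //; first exact: smooth_eproj.
  exact: periodic_eproj.
rewrite IH //; apply: functional_extensionality => z.
by rewrite fproj_scal //; apply: Cont_eproj; exact: smooth_continuous.
Qed.

Definition eigen zeta f : Prop :=
  forall k x, partial k f x = (Ci * RtoC (IZR (zeta k)) * f x)%C.

(** The component of [f] along the character [e^{i zeta . x}], kept as a function of [x] instead of
    a number. Its characteristic property is [eigen], so characters never have to be written
    down. *)
Definition ecoef zeta f : vec N -> C := eproj (enum 'I_N) zeta f.

Lemma eigen_ecoef zeta f : smooth f -> periodic f -> eigen zeta (ecoef zeta f).
Proof.
move=> sf pf k x; rewrite /ecoef partial_eproj // eproj_partial_eq //.
by rewrite mem_enum.
Qed.

Lemma eproj_eigen ks zeta f : smooth f -> eigen zeta f -> eproj ks zeta f = f.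
Proof.
move=> sf ef; elim: ks => //= k ks ->.
by apply: functional_extensionality => z; apply: fproj_eigen.
Qed.

(** Orthogonality of characters: projecting [d_k f] in two ways gives [i (zeta' k - zeta k)] times
    the projection of [f] equal to 0. *)
Lemma eproj_eigen_neq ks zeta zeta' f k : smooth f -> periodic f ->
  eigen zeta' f -> k \in ks -> zeta k <> zeta' k ->
  eproj ks zeta f = (fun _ => RtoC 0).
Proof.
move=> sf pf ef kin ne; apply: functional_extensionality => z.
have := eproj_partial_eq zeta sf pf kin.
have -> : partial k f = (fun y => (Ci * RtoC (IZR (zeta' k))) * f y)%C.
  by apply: functional_extensionality => y; exact: ef.
rewrite eproj_scal; last exact: smooth_continuous.
move/(congr1 (fun F => F z)) => E.
have {}E : (Ci * (RtoC (IZR (zeta' k) - IZR (zeta k)) * eproj ks zeta f z) = RtoC 0)%C.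
  by rewrite RtoC_minus -[RtoC 0](Cplus_opp_r (Ci * RtoC (IZR (zeta k)) * eproj ks zeta f z)%C) -{1}E; ring.
apply: NNPP => ne0; apply: (Cmult_neq_0 _ _ _ (Cmult_neq_0 _ _ _ ne0) E).
  by move=> [] /R1_neq_R0.
by case=> /Rminus_diag_uniq /eq_IZR e; case: ne.
Qed.

Lemma eproj_uniqueness ks f : uniq ks -> smooth f -> periodic f ->
  (forall zeta, eproj ks zeta f = (fun _ => RtoC 0)) -> f = (fun _ => RtoC 0).
Proof.
elim: ks => [|k ks IH] /=; first by move=> _ _ _ /(_ (fun _ => 0%Z)).
case/andP => knin uks sf pf H; apply: IH => // zeta.
apply: functional_extensionality => z; apply: (@fproj_uniqueness k).
- by apply: Cont_eproj; exact: smooth_continuous.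
- exact: periodic_eproj.
(* The frequency at [k] can be chosen freely: as [k] is not in [ks], changing [zeta] there leaves
   the projection over [ks] unchanged. *)
move=> a {}z; have := H (fun i => if i == k then a else zeta i); rewrite eqxx.
have -> : eproj ks (fun i => if i == k then a else zeta i) f = eproj ks zeta f.
  elim: ks knin {uks H} => //= k' ks IH; rewrite inE negb_or => /andP[kk' kn].
  by rewrite eq_sym (negbTE kk') IH.
by move/(congr1 (fun F => F z)).
Qed.

End Eproj.

(** * Series of smooth functions *)

(* Telescoping weights: they give the explicit remainder [K / (J + 1)]. *)
Definition btel (j : nat) : R := / (INR j + 1) - / (INR j + 2).

Lemma INR1_gt0 (j : nat) : 0 < INR j + 1.
Proof. by have := pos_INR j; lra. Qed.

Lemma btelE j : btel j = / ((INR j + 1) * (INR j + 2)).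
Proof. by rewrite /btel; have := pos_INR j => h; field; lra. Qed.

Lemma btel_ge0 j : 0 <= btel j.
Proof.
by rewrite btelE; left; apply: Rinv_0_lt_compat; have := pos_INR j => h; nra.
Qed.

Lemma le_of_forall_div (x y K : R) : (forall J : nat, x <= y + K / (INR J + 1)) -> x <= y.
Proof.
move=> H; apply: le_epsilon => eps e0.
have [J hJ] := INR_unbounded (K / eps).
apply: Rle_trans (H J) _; apply: Rplus_le_compat_l.
have j1 := INR1_gt0 J.
apply: (Rmult_le_reg_r (INR J + 1)) => //.
rewrite /Rdiv Rmult_assoc Rinv_l ?Rmult_1_r; last lra.
move: hJ => /(Rmult_lt_compat_r _ _ _ e0).
by rewrite /Rdiv Rmult_assoc Rinv_l; nra.
Qed.

Fixpoint psum (a : nat -> C) (J : nat) : C :=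
  if J is J'.+1 then (psum a J' + a J')%C else RtoC 0.

(** Convergence with a built-in rate. All series below are dominated by [btel] and converge at this
    rate, and a rate in this form survives linear combinations and the bounded projections. *)
Definition csum (a : nat -> C) (l : C) : Prop :=
  exists K, forall J, Cmod (l - psum a J) <= K / (INR J + 1).

Lemma Cmod_sym (a b : C) : Cmod (a - b) = Cmod (b - a).
Proof. by rewrite -Cmod_opp; congr Cmod; ring. Qed.

Lemma csum_uniq a l l' : csum a l -> csum a l' -> l = l'.
Proof.
move=> [K HK] [K' HK'].
have : Cmod (l - l') <= 0.
  apply: (@le_of_forall_div _ _ (K + K')) => J; rewrite Rplus_0_l.
  have -> : (l - l' = (l - psum a J) + (psum a J - l'))%C by ring.
  apply: Rle_trans (Cmod_triangle _ _) _; rewrite Rdiv_plus_distr.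
  by apply: Rplus_le_compat; rewrite // Cmod_sym.
move=> h; have /Cmod_eq_0 e : Cmod (l - l') = 0 by have := Cmod_ge_0 (l - l'); lra.
by have -> : l = (l - l' + l')%C; [ring | rewrite e; ring].
Qed.

Lemma psum_plus a b J : psum (fun j => a j + b j)%C J = (psum a J + psum b J)%C.
Proof. by elim: J => [|J IH] /=; [ring | rewrite IH; ring]. Qed.

Lemma psum_scal (c : C) a J : psum (fun j => c * a j)%C J = (c * psum a J)%C.
Proof. by elim: J => [|J IH] /=; [ring | rewrite IH; ring]. Qed.

Lemma csum_plus a b la lb : csum a la -> csum b lb ->
  csum (fun j => a j + b j)%C (la + lb)%C.
Proof.
move=> [K HK] [K' HK']; exists (K + K') => J.
rewrite psum_plus Rdiv_plus_distr.
have -> : (la + lb - (psum a J + psum b J) = (la - psum a J) + (lb - psum b J))%C by ring.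
by apply: Rle_trans (Cmod_triangle _ _) _; apply: Rplus_le_compat.
Qed.

Lemma csum_scal (c : C) a l : csum a l -> csum (fun j => c * a j)%C (c * l)%C.
Proof.
move=> [K HK]; exists (Cmod c * K) => J.
rewrite psum_scal (_ : (c * l - c * psum a J = c * (l - psum a J))%C); last by ring.
rewrite Cmod_mult /Rdiv Rmult_assoc.
by apply: Rmult_le_compat_l; [exact: Cmod_ge_0 | exact: HK].
Qed.

Lemma csum_0 : csum (fun _ => RtoC 0) (RtoC 0).
Proof.
exists 0 => J; have -> : psum (fun _ => RtoC 0) J = RtoC 0.
  by elim: J => //= J ->; ring.
by rewrite (_ : (RtoC 0 - RtoC 0 = RtoC 0)%C) ?Cmod_0 /Rdiv ?Rmult_0_l; [lra | ring].
Qed.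

Lemma psum_tail (a : nat -> C) K : (forall j, Cmod (a j) <= K * btel j) ->
  forall J d, Cmod (psum a (d + J) - psum a J) <=
    K * (/ (INR J + 1) - / (INR (d + J) + 1)).
Proof.
move=> ha J; elim=> [|d IH].
  rewrite add0n (_ : (psum a J - psum a J = RtoC 0)%C) ?Cmod_0; last by ring.
  by rewrite Rminus_diag Rmult_0_r; lra.
rewrite addSn [psum a _.+1]/=.
have -> : (psum a (d + J) + a (d + J)%N - psum a J =
  (psum a (d + J) - psum a J) + a (d + J)%N)%C by ring.
apply: Rle_trans (Cmod_triangle _ _) _.
apply: Rle_trans (Rplus_le_compat _ _ _ _ IH (ha (d + J)%N)) _.
by rewrite S_INR /btel (_ : INR (d + J) + 1 + 1 = INR (d + J) + 2); [right|]; ring.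
Qed.

Lemma psum_bound (a : nat -> C) K : (forall j, Cmod (a j) <= K * btel j) ->
  forall J, Cmod (psum a J) <= K.
Proof.
move=> ha J; have := psum_tail ha 0 J.
rewrite addn0 /= (_ : (psum a J - 0 = psum a J)%C); last by ring.
move=> h; apply: Rle_trans h _; rewrite Rplus_0_l Rinv_1.
have K0 : 0 <= K.
  have := Rle_trans _ _ _ (Cmod_ge_0 _) (ha 0%N).
  have : 0 < btel 0 by rewrite /btel /=; lra.
  by nra.
have : 0 < / (INR J + 1) by apply: Rinv_0_lt_compat; exact: INR1_gt0.
by nra.
Qed.

Lemma csum_exists (a : nat -> C) K : (forall j, Cmod (a j) <= K * btel j) ->
  exists l : C, forall J, Cmod (l - psum a J) <= 2 * K / (INR J + 1).
Proof.
move=> ha.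
have K0 : 0 <= K by apply: Rle_trans (psum_bound ha 0); exact: Cmod_ge_0.
have tail n J : (J <= n)%N -> Cmod (psum a n - psum a J) <= K / (INR J + 1).
  move=> /subnK <-; apply: Rle_trans (psum_tail ha J _) _.
  have : 0 < / (INR (n - J + J) + 1) by apply: Rinv_0_lt_compat; exact: INR1_gt0.
  by rewrite /Rdiv; nra.
have real_lim (p : C -> R) : (forall z z', Rabs (p z - p z') <= Cmod (z - z')) ->
    exists l : R, forall J, Rabs (l - p (psum a J)) <= K / (INR J + 1).
  move=> hp; set u := fun J => p (psum a J).
  have tu n J : (J <= n)%N -> Rabs (u n - u J) <= K / (INR J + 1).
    by move=> h; apply: Rle_trans (hp _ _) (tail _ _ h).
  have [l Hl] : ex_finite_lim_seq u.
    apply/ex_lim_seq_cauchy_corr => eps.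
    have [M HM] := INR_unbounded (K / eps).
    have sm : K / (INR M + 1) < eps.
      have m1 := INR1_gt0 M; have e0 := cond_pos eps.
      apply: (Rmult_lt_reg_r (INR M + 1)) => //.
      rewrite /Rdiv Rmult_assoc Rinv_l ?Rmult_1_r; last lra.
      move: HM => /(Rmult_lt_compat_r _ _ _ e0).
      by rewrite /Rdiv Rmult_assoc Rinv_l; nra.
    have mono n : (M <= n)%coq_nat -> K / (INR n + 1) <= K / (INR M + 1).
      move=> /le_INR h; apply: Rmult_le_compat_l => //.
      by apply: Rinv_le_contravar; [exact: INR1_gt0 | lra].
    exists M => n m hn hm; case: (leqP n m) => h.
      rewrite Rabs_minus_sym; apply: Rle_lt_trans (tu _ _ h) _.
      by apply: Rle_lt_trans (mono _ hn) sm.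
    apply: Rle_lt_trans (tu _ _ (ltnW h)) _.
    by apply: Rle_lt_trans (mono _ hm) sm.
  exists l => J; apply: le_epsilon => eps e0.
  move/is_lim_seq_spec: Hl => /(_ (mkposreal _ e0)) [M HM].
  have := HM (maxn M J) => /(_ _) /= H1.
  have {}H1 : Rabs (u (maxn M J) - l) < eps by apply: H1; apply/leP; exact: leq_maxl.
  have H2 := tu (maxn M J) J (leq_maxr _ _).
  have -> : l - p (psum a J) = (u (maxn M J) - u J) - (u (maxn M J) - l) by rewrite /u; ring.
  by apply: Rle_trans (Rabs_triang _ _) _; rewrite Rabs_Ropp; lra.
have [l1 H1] := real_lim Re (fun z z' => re_le_Cmod (z - z')%C).
have [l2 H2] := real_lim Im (fun z z' => im_le_Cmod (z - z')%C).
exists (l1, l2) => J; apply: Rle_trans (Cmod_le_ReIm _) _.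
have -> : 2 * K / (INR J + 1) = K / (INR J + 1) + K / (INR J + 1) by field; have := INR1_gt0 J; lra.
by apply: Rplus_le_compat; [exact: H1 | exact: H2].
Qed.

(** A choice operator makes the sum a total function of the terms; its value is meaningful only once
    some [csum a l] holds. *)
Definition Csum (a : nat -> C) : C := epsilon (inhabits (RtoC 0)) (csum a).

Lemma Csum_tail (a : nat -> C) K : (forall j, Cmod (a j) <= K * btel j) ->
  forall J, Cmod (Csum a - psum a J) <= 2 * K / (INR J + 1).
Proof.
move=> ha; have [l Hl] := csum_exists ha.
have cl : csum a l by exists (2 * K).
have -> // : Csum a = l.
by apply: (csum_uniq _ cl); apply: (epsilon_spec (inhabits (RtoC 0)) (csum a)); exists l.
Qed.

Lemma Csum_csum (a : nat -> C) K : (forall j, Cmod (a j) <= K * btel j) ->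
  csum a (Csum a).
Proof. by move=> ha; exists (2 * K); exact: Csum_tail. Qed.

Lemma csum_le (a : nat -> C) l K : csum a l -> (forall J, Cmod (psum a J) <= K) ->
  Cmod l <= K.
Proof.
move=> [K' HK'] H; apply: (@le_of_forall_div _ _ K') => J.
have -> : l = (psum a J + (l - psum a J))%C by ring.
by apply: Rle_trans (Cmod_triangle _ _) _; apply: Rplus_le_compat.
Qed.

(** A quadratic remainder bound, unlike a derivative, can be summed over a series; this is what
    makes differentiation term by term possible. *)
Lemma is_derive_quadratic (F : R -> R) d K :
  (forall h, Rabs (F h - F 0 - h * d) <= K * h ^ 2) -> is_derive F 0 d.
Proof.
move=> H; apply/is_derive_Reals => eps e0.
have K0 : 0 <= K by have := H 1; have := Rabs_pos (F 1 - F 0 - 1 * d); lra.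
have d0 : 0 < eps / (K + 1) by apply: Rdiv_lt_0_compat; lra.
exists (mkposreal _ d0) => h hne /= hlt; rewrite Rplus_0_l.
have h0 : 0 < Rabs h by exact: Rabs_pos_lt.
have -> : (F h - F 0) / h - d = (F h - F 0 - h * d) / h by field.
rewrite Rabs_mult Rabs_inv.
apply: (Rmult_lt_reg_r (Rabs h)) => //.
rewrite Rmult_assoc Rinv_l ?Rmult_1_r; last lra.
apply: Rle_lt_trans (H h) _.
rewrite (_ : h ^ 2 = Rabs h * Rabs h); last by rewrite -pow2_abs; ring.
rewrite -Rmult_assoc; apply: Rmult_lt_compat_r => //.
move: hlt => /(Rmult_lt_compat_r (K + 1)) => /(_ ltac:(lra)).
by rewrite /Rdiv Rmult_assoc Rinv_l; nra.
Qed.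

Lemma taylor2_bound (F F' F'' : R -> R) M h :
  (forall s, is_derive F s (F' s)) -> (forall s, is_derive F' s (F'' s)) ->
  (forall s, Rabs (F'' s) <= M) -> Rabs (F h - F 0 - h * F' 0) <= M * h ^ 2.
Proof.
move=> dF dF' bF.
have cont (G G' : R -> R) : (forall s, is_derive G s (G' s)) -> forall s, continuity_pt G s.
  by move=> dG s; apply/continuity_pt_filterlim; apply: ex_derive_continuous; eexists; exact: dG.
have [c [hc ->]] := MVT_gen F 0 h F' (fun s _ => dF s) (fun s _ => cont _ _ dF s).
have [e [_ ]] := MVT_gen F' 0 c F'' (fun s _ => dF' s) (fun s _ => cont _ _ dF' s).
rewrite !Rminus_0_r => E.
have -> : F' c * h - h * F' 0 = (F' c - F' 0) * h by ring.
rewrite E !Rabs_mult.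
have hch : Rabs c <= Rabs h.
  by move: hc; rewrite /Rmin /Rmax; case: Rle_dec => ? hc;
     rewrite /Rabs; do 2!case: Rcase_abs => ?; lra.
rewrite -pow2_abs; have := bF e; have := Rabs_pos (F'' e); have := Rabs_pos c.
have := Rabs_pos h => *.
have -> : M * Rabs h ^ 2 = M * Rabs h * Rabs h by ring.
by apply: Rmult_le_compat_r => //; apply: Rmult_le_compat.
Qed.

Section SmoothSeries.
Variable N : nat.
Implicit Types (t : nat -> vec N -> C) (k : 'I_N).

Lemma partial_taylor k f M x h : smooth f ->
  (forall y, Cmod (partial k (partial k f) y) <= M) ->
  Cmod (f (shift x k h) - f x - RtoC h * partial k f x) <= 2 * M * h ^ 2.
Proof.
move=> sf bf.
have d1 s := has_partial_shift (smooth_has_partial k (shift x k s) sf).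
have d2 s := has_partial_shift (smooth_has_partial k (shift x k s) (smooth_partial k sf)).
apply: Rle_trans (Cmod_le_ReIm _) _.
have -> : 2 * M * h ^ 2 = M * h ^ 2 + M * h ^ 2 by ring.
apply: Rplus_le_compat.
- have := @taylor2_bound _ _ _ M h (fun s => proj1 (d1 s)) (fun s => proj1 (d2 s)).
  rewrite shift0 => H.
  have -> : Re (f (shift x k h) - f x - RtoC h * partial k f x)%C =
     Re (f (shift x k h)) - Re (f x) - h * Re (partial k f x).
    by rewrite /Re /=; ring.
  by apply: H => s; apply: Rle_trans (bf _); exact: re_le_Cmod.
- have := @taylor2_bound _ _ _ M h (fun s => proj2 (d1 s)) (fun s => proj2 (d2 s)).
  rewrite shift0 => H.
  have -> : Im (f (shift x k h) - f x - RtoC h * partial k f x)%C =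
     Im (f (shift x k h)) - Im (f x) - h * Im (partial k f x).
    by rewrite /Im /=; ring.
  by apply: H => s; apply: Rle_trans (bf _); exact: im_le_Cmod.
Qed.

Definition summable t : Prop :=
  (forall j, smooth (t j)) /\
  forall l, exists K, forall j x, Cmod (iter_partial l (t j) x) <= K * btel j.

Definition fsum t : vec N -> C := fun x => Csum (fun j => t j x).

Lemma summable_partial k t : summable t -> summable (fun j => partial k (t j)).
Proof.
move=> [st bt]; split=> [j|l]; first exact: smooth_partial.
have [K HK] := bt (rcons l k); exists K => j x.
by rewrite -iter_partial_rcons.
Qed.

Lemma smooth_psum t J : (forall j, smooth (t j)) ->
  smooth (fun x => psum (fun j => t j x) J).
Proof.
by move=> st; elim: J => [|J IH] /=; [exact: smooth_const | exact: smooth_plus].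
Qed.

Lemma Cont_fsum t : summable t -> Cont (fsum t).
Proof.
move=> [st bt] x.
have [K HK] := bt [::].
have tail y J := @Csum_tail (fun j => t j y) K (fun j => HK j y) J.
apply/continuous_ReIm.
suff H (p : C -> R) : (forall z z', Rabs (p z - p z') <= Cmod (z - z')) ->
    (forall z, continuous p z) -> continuous (fun y => p (fsum t y)) x.
  split; apply: H.
  - by move=> z z'; exact: (re_le_Cmod (z - z')%C).
  - by move=> [? ?]; exact: continuous_fst.
  - by move=> z z'; exact: (im_le_Cmod (z - z')%C).
  - by move=> [? ?]; exact: continuous_snd.
move=> hp cp; apply/filterlim_locally => eps.
have e0 := cond_pos eps.
have [J HJ] := INR_unbounded (2 * K / (eps / 4)).
have sm : 2 * K / (INR J + 1) <= eps / 4.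
  have j1 := INR1_gt0 J.
  apply: (Rmult_le_reg_r (INR J + 1)) => //.
  rewrite /Rdiv Rmult_assoc Rinv_l ?Rmult_1_r; last lra.
  have e4 : 0 < eps / 4 by lra.
  move: HJ => /(Rmult_lt_compat_r _ _ _ e4).
  by rewrite {1}/Rdiv Rmult_assoc Rinv_l; [lra | lra].
have cS : continuous (fun y => p (psum (fun j => t j y) J)) x.
  apply: (continuous_comp (fun y => psum (fun j => t j y) J) p) => //.
  by apply: smooth_continuous; exact: smooth_psum.
have e2 : 0 < eps / 2 by lra.
move/filterlim_locally: cS => /(_ (mkposreal _ e2)); apply: filter_imp => y.
rewrite /ball /= /AbsRing_ball /abs /minus /plus /opp /= => /Rabs_def2 hb.
have /Rabs_le_between h1 := Rle_trans _ _ _ (hp _ _) (Rle_trans _ _ _ (tail x J) sm).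
have /Rabs_le_between h2 := Rle_trans _ _ _ (hp _ _) (Rle_trans _ _ _ (tail y J) sm).
by apply: Rabs_def1; rewrite /fsum; lra.
Qed.

(** The second-order Taylor remainder of the term [t j] is at most [2 K2 (btel j) h^2]; summing over
    [j] gives a remainder at most [2 K2 h^2] for the sum. *)
Lemma has_partial_fsum k t x : summable t ->
  has_partial k (fsum t) x (fsum (fun j => partial k (t j)) x).
Proof.
move=> [st bt].
have [K0 H0] := bt [::]; have [K1 H1] := bt [:: k]; have [K2 H2] := bt [:: k; k].
have main h : Cmod (fsum t (shift x k h) - fsum t x -
    RtoC h * fsum (fun j => partial k (t j)) x) <= 2 * K2 * h ^ 2.
  apply: (@csum_le (fun j => t j (shift x k h) + (RtoC (Ropp 1) * t j x +
      RtoC (- h) * partial k (t j) x))%C).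
    have -> : (fsum t (shift x k h) - fsum t x - RtoC h * fsum (fun j => partial k (t j)) x
      = fsum t (shift x k h) + (RtoC (Ropp 1) * fsum t x +
        RtoC (- h) * fsum (fun j => partial k (t j)) x))%C.
      by rewrite !RtoC_opp; ring.
    apply: csum_plus; first exact: Csum_csum (fun j => H0 j _).
    apply: csum_plus; apply: csum_scal; first exact: Csum_csum (fun j => H0 j _).
    exact: Csum_csum (fun j => H1 j x).
  apply: psum_bound => j.
  have -> : (t j (shift x k h) + (RtoC (Ropp 1) * t j x + RtoC (- h) * partial k (t j) x) =
     t j (shift x k h) - t j x - RtoC h * partial k (t j) x)%C.
    by rewrite !RtoC_opp; ring.
  have -> : 2 * K2 * h ^ 2 * btel j = 2 * (K2 * btel j) * h ^ 2 by ring.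
  by apply: partial_taylor => // y; exact: H2.
split; apply: (@is_derive_quadratic _ _ (2 * K2)) => h; apply: Rle_trans (main h).
- apply: Rle_trans (re_le_Cmod _); rewrite shift0; right; congr Rabs.
  by rewrite /Re /=; ring.
- apply: Rle_trans (im_le_Cmod _); rewrite shift0; right; congr Rabs.
  by rewrite /Im /=; ring.
Qed.

Lemma partial_fsum k t : summable t ->
  partial k (fsum t) = fsum (fun j => partial k (t j)).
Proof. by move=> st; apply: (proj2 (partial_ext _)) => x; exact: has_partial_fsum. Qed.

Lemma smooth_fsum t : summable t -> smooth (fsum t).
Proof.
move=> st; apply: (@smooth_coind _ (fun h => exists2 t, summable t & h = fsum t));
  last by exists t.
move=> h [{st}t st ->]; split; first exact: Cont_fsum.
move=> l; have [? ->] := partial_ext (fun x => has_partial_fsum l x st).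
by split => //; eexists; [exact: summable_partial st|].
Qed.

Lemma iter_partial_fsum l t : summable t ->
  iter_partial l (fsum t) = fsum (fun j => iter_partial l (t j)).
Proof.
elim/last_ind: l t => [|l k IH] t st //.
rewrite iter_partial_rcons partial_fsum // IH; last exact: summable_partial.
congr fsum; apply: functional_extensionality => j.
by rewrite iter_partial_rcons.
Qed.

Lemma periodic_fsum t : (forall j, periodic (t j)) -> periodic (fsum t).
Proof.
move=> pt x k; rewrite /fsum; congr Csum.
by apply: functional_extensionality => j; exact: pt.
Qed.

End SmoothSeries.

(** * Fourier series in the class E *)

(** This bounds a binomial coefficient by [2 ^ (j + k)]; the double induction is Pascal's rule. *)
Lemma fact_add_le (j k : nat) :
  INR (fact (j + k)) <= 2 ^ (j + k) * (INR (fact j) * INR (fact k)).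
Proof.
elim: j k => [|j IHj] k.
  rewrite add0n /= Rmult_1_l -[X in X <= _]Rmult_1_l.
  by apply: Rmult_le_compat_r; [exact: pos_INR | apply: pow_R1_Rle; lra].
elim: k => [|k IHk].
  rewrite addn0 [INR (fact 0)]/= Rmult_1_r -[X in X <= _]Rmult_1_l.
  by apply: Rmult_le_compat_r; [exact: pos_INR | apply: pow_R1_Rle; lra].
have FS p : INR (fact p.+1) = (INR p + 1) * INR (fact p) by rewrite fact_simpl mult_INR S_INR.
have -> : (j.+1 + k.+1 = (j + k.+1).+1)%N by rewrite addSn.
rewrite FS.
have H1 := IHj k.+1; move: IHk; rewrite addSnnS => H2.
have -> : INR (j + k.+1) + 1 = (INR j + 1) + (INR k + 1).
  by rewrite -plusE plus_INR S_INR; ring.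
rewrite [2 ^ _.+1]/= Rmult_plus_distr_r.
have {}H1 := Rmult_le_compat_l _ _ _ (Rlt_le _ _ (INR1_gt0 j)) H1.
have {}H2 := Rmult_le_compat_l _ _ _ (Rlt_le _ _ (INR1_gt0 k)) H2.
apply: Rle_trans (Rplus_le_compat _ _ _ _ H1 H2) _; right.
by rewrite !FS; ring.
Qed.

(** * Consequences of log-convexity and moderate growth *)

Section Weights.
Variables (m : nat -> R) (hm : weight_sequence m).

Let mpos j : 0 < m j := ws_pos hm j.

(** Log-convexity says that the ratios [m (p + 1) / m p] are nondecreasing; here two of them are
    compared at distance [d], with denominators cleared. *)
Lemma weight_cross p d : m p.+1 * m (d + p)%N <= m p * m (d + p).+1.
Proof.
elim: d => [|d IH]; first by rewrite add0n; right; ring.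
rewrite addSn; have := ws_log_convex hm (j := (d + p).+1) isT => /= hc.
apply: (Rmult_le_reg_r (m (d + p)%N)) => //.
have h1 := Rmult_le_compat_r _ _ _ (Rlt_le _ _ (mpos (d + p).+1)) IH.
have h2 := Rmult_le_compat_l _ _ _ (Rlt_le _ _ (mpos p)) hc.
by lra.
Qed.

(** Since [m 0 = 1], [m p] is the product of the first [p] ratios, while [m (p + q) / m q] is the
    product of [p] later and hence larger ones. *)
Lemma weight_submult p q : m p * m q <= m (p + q)%N.
Proof.
elim: p => [|p IH]; first by rewrite ws_m0 // Rmult_1_l; right.
apply: (Rmult_le_reg_r (m (p + q)%N)) => //.
have h1 := weight_cross p q; rewrite addnC in h1.
have h2 := Rmult_le_compat_r _ _ _ (Rlt_le _ _ (mpos (p + q).+1)) IH.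
have h3 := Rmult_le_compat_r _ _ _ (Rlt_le _ _ (mpos q)) h1.
by rewrite addSn; lra.
Qed.

Lemma weight_mono j : m j <= m j.+1.
Proof. by have := weight_submult 1 j; rewrite ws_m1 // Rmult_1_l. Qed.

Lemma weight_ge1 j : 1 <= m j.
Proof.
elim: j => [|j IH]; first by rewrite ws_m0 //; right.
exact: Rle_trans IH (weight_mono j).
Qed.

Definition wf (j : nat) : R := m j * INR (fact j).

Lemma fact_ge1 j : 1 <= INR (fact j).
Proof. by apply: (le_INR 1); exact: lt_O_fact. Qed.

Lemma wf_ge1 j : 1 <= wf j.
Proof.
rewrite -(Rmult_1_l 1); apply: Rmult_le_compat; [lra | lra | exact: weight_ge1 |].
exact: fact_ge1.
Qed.

Lemma wf_growth : exists G, 1 <= G /\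
  forall j k, wf (j + k)%N <= G ^ (j + k) * (wf j * wf k).
Proof.
have [H [H1 HH]] := ws_moderate_growth hm.
exists (H * 2); split; first lra.
move=> j k; rewrite /wf Rpow_mult_distr.
have := Rmult_le_compat _ _ _ _ (Rlt_le _ _ (mpos (j + k)%N)) (pos_INR _) (HH j k) (fact_add_le j k).
by move=> h; apply: Rle_trans h _; right; ring.
Qed.

End Weights.

(** * Enumeration of the frequencies with polynomially bounded codes *)

Section Enumeration.
Variable N : nat.
Implicit Types zeta : 'I_N -> Z.

Definition znat (a : Z) : nat :=
  if Z.leb 0 a then Nat.mul 2 (Z.abs_nat a) else S (Nat.mul 2 (Z.abs_nat a)).

Lemma znat_inj : injective znat.
Proof.
move=> a b; rewrite /znat.
have := Zabs2Nat.id_abs a; have := Zabs2Nat.id_abs b.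
by case: (Z.leb_spec 0 a) => ?; case: (Z.leb_spec 0 b) => ?; lia.
Qed.

(* Injective because [(a+b)^2 <= (a+b)^2 + a < (a+b+1)^2]; polynomially bounded,
   unlike the generic countable encodings. *)
Definition pairn (a b : nat) : nat := Nat.add (Nat.mul (Nat.add a b) (Nat.add a b)) a.

Lemma pairn_inj a b c d : pairn a b = pairn c d -> a = c /\ b = d.
Proof.
rewrite /pairn => H.
have [h | [h | h]] := PeanoNat.Nat.lt_trichotomy (Nat.add a b) (Nat.add c d).
- by nia.
- by rewrite h in H; lia.
- by nia.
Qed.

Definition encs : seq nat -> nat := foldr pairn 0%N.

Lemma encs_inj s t : size s = size t -> encs s = encs t -> s = t.
Proof.
elim: s t => [|a s IH] [|b t] //= [hst] /pairn_inj [-> h].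
by rewrite (IH t).
Qed.

Definition enc zeta : nat := encs [seq znat (zeta k) | k <- enum 'I_N].

Lemma enc_inj zeta zeta' : enc zeta = enc zeta' -> zeta = zeta'.
Proof.
move/encs_inj; rewrite !size_map => /(_ erefl) /eq_in_map H.
apply: functional_extensionality => k; apply: znat_inj; apply: H.
by rewrite mem_enum.
Qed.

Definition dec (j : nat) : 'I_N -> Z :=
  epsilon (inhabits (fun _ => 0%Z)) (fun zeta => enc zeta = j).

Lemma encK zeta : dec (enc zeta) = zeta.
Proof.
apply: enc_inj; apply: (epsilon_spec _ (fun z => enc z = enc zeta)).
by exists zeta.
Qed.

(** If [a + 1 <= Y] and the code [e] of the tail satisfies [e + 1 <= Y^d], then [pairn a e + 1 <= (a
    + e + 1)^2 <= (Y Y^d)^2], so each entry turns the degree [d] into [2 d + 2]. *)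
Fixpoint encdeg (L : nat) : nat := if L is L'.+1 then (encdeg L').*2.+2 else 0%N.

Lemma encs_bound (Y : R) s : 1 <= Y -> (forall a, a \in s -> INR a + 1 <= Y) ->
  INR (encs s) + 1 <= Y ^ encdeg (size s).
Proof.
move=> Y1; elim: s => [|a s IH] hs /=; first lra.
have ha : INR a + 1 <= Y by apply: hs; rewrite inE eqxx.
have {}IH : INR (encs s) + 1 <= Y ^ encdeg (size s).
  by apply: IH => b bs; apply: hs; rewrite inE bs orbT.
set e := encs s in IH *; rewrite -addnn pow_add.
set Z := Y ^ _ in IH *; rewrite /pairn plus_INR mult_INR plus_INR.
have a0 := pos_INR a; have e0 := pos_INR e.
have h : (INR a + 1) * (INR e + 1) <= Y * Z by apply: Rmult_le_compat; lra.
have h2 : INR a + INR e + 1 <= Y * Z by nra.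
have : (INR a + INR e + 1) * (INR a + INR e + 1) <= (Y * Z) * (Y * Z).
  by apply: Rmult_le_compat; lra.
by nra.
Qed.

(** The maximum norm is convenient because one component attains it, and the pure derivatives in
    that direction alone then control the coefficient. The 1 added in [zsize] keeps its powers away
    from 0. *)
Definition zmax zeta : nat := \max_(k < N) Z.abs_nat (zeta k).
Definition zsize zeta : R := 1 + INR (zmax zeta).

Lemma zsize_ge1 zeta : 1 <= zsize zeta.
Proof. by rewrite /zsize; have := pos_INR (zmax zeta); lra. Qed.

Lemma INR_abs_nat a : INR (Z.abs_nat a) = Rabs (IZR a).
Proof. by rewrite INR_IZR_INZ Zabs2Nat.id_abs abs_IZR. Qed.

Lemma zmax_ge zeta k : Rabs (IZR (zeta k)) <= INR (zmax zeta).
Proof.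
rewrite -INR_abs_nat; apply: le_INR; apply/leP.
exact: (@leq_bigmax _ (fun k => Z.abs_nat (zeta k)) k).
Qed.

Lemma zmax_attained zeta : zmax zeta <> 0%N ->
  exists k, INR (zmax zeta) = Rabs (IZR (zeta k)).
Proof.
move=> h; case: (posnP N) => [N0 | N0].
  by case: h; rewrite /zmax big1 // => i; have := ltn_ord i; rewrite {2}N0.
have [|k hk] := @eq_bigmax _ (fun k : 'I_N => Z.abs_nat (zeta k)); first by rewrite card_ord.
by exists k; rewrite -INR_abs_nat /zmax hk.
Qed.

Definition enc_exp : nat := (encdeg N).*2.

Lemma enc_bound zeta : INR (enc zeta) + 1 <= (2 * zsize zeta) ^ encdeg N.
Proof.
have x1 := zsize_ge1 zeta.
have -> : encdeg N = encdeg (size [seq znat (zeta k) | k <- enum 'I_N]).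
  by rewrite size_map size_enum_ord.
apply: encs_bound => [|a /mapP [k _ ->]]; first lra.
have := zmax_ge zeta k; rewrite -INR_abs_nat /zsize /znat => hk.
by case: Z.leb; rewrite ?S_INR mult_INR [INR 2]/=; lra.
Qed.

(** The inverse of [btel e] is at most [2 (e + 1)^2], and codes grow polynomially: giving up
    [enc_exp] powers of [zsize] buys domination by the summable weights. *)
Lemma enc_btel zeta :
  1 <= 2 * 2 ^ enc_exp * zsize zeta ^ enc_exp * btel (enc zeta).
Proof.
have H := enc_bound zeta.
have -> : 2 * 2 ^ enc_exp * zsize zeta ^ enc_exp * btel (enc zeta) =
  2 * ((2 * zsize zeta) ^ encdeg N * (2 * zsize zeta) ^ encdeg N) * btel (enc zeta).
  by rewrite /enc_exp -addnn !pow_add Rpow_mult_distr; ring.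
set P := _ ^ encdeg N in H *.
have e0 := pos_INR (enc zeta); set e := INR _ in H e0 *.
rewrite btelE -/e.
have q0 : 0 < (e + 1) * (e + 2) by nra.
apply: (Rmult_le_reg_r ((e + 1) * (e + 2))) => //.
rewrite Rmult_assoc Rinv_l; last lra.
by nra.
Qed.

End Enumeration.

Lemma flatten_nseq_single (T : eqType) (s : seq T) k j : uniq s ->
  flatten [seq nseq (if i == k then j else 0%N) i | i <- s] =
  if k \in s then nseq j k else [::].
Proof.
elim: s => //= i s IH /andP[nin us]; rewrite IH // inE eq_sym.
case: (eqVneq k i) => [e | _] //=.
by rewrite e (negbTE nin) cats0.
Qed.

(** * Decay of Fourier coefficients and Fourier multipliers *)

Section Synthesis.
Variables (m : nat -> R) (hm : weight_sequence m) (n : nat).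
Let N := n.+1.
Implicit Types (f g : vec N -> C) (zeta : 'I_N -> Z) (c : ('I_N -> Z) -> C).

(* Only the pure derivatives are bounded, which is equivalent to [in_E m f]:
   [in_E_pureE] and [pureE_in_E]. *)
Definition pureE f : Prop := periodic f /\ smooth f /\
  exists K h, 0 < K /\ 0 < h /\ forall k j x,
    Cmod (iter_partial (nseq j k) f x) <= K * h ^ j * wf m j.

Lemma in_E_pureE f : in_E m f -> pureE f.
Proof.
case=> pf [sf [K [h [K0 [h0 H]]]]]; split=> //; split=> //.
exists K, h; split=> //; split=> // k j x.
have := H (fun i => if i == k then j else 0%N) x.
have -> : multi_order (fun i => if i == k then j else 0%N) = j.
  by rewrite /multi_order -big_mkcond big_pred1_eq.
rewrite /multi_partial.
have -> : flatten [seq nseq (if i == k then j else 0%N) i | i <- enum 'I_N] = nseq j k.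
  by rewrite flatten_nseq_single ?enum_uniq // mem_enum.
by rewrite /wf Rmult_assoc.
Qed.

Definition zprod zeta (l : seq 'I_N) : C :=
  foldr (fun k z => Ci * RtoC (IZR (zeta k)) * z)%C (RtoC 1) l.

Lemma eigen_iter zeta f l : smooth f -> eigen zeta f ->
  iter_partial l f = (fun x => zprod zeta l * f x)%C.
Proof.
move=> sf ef; elim: l => [|k l IH] /=.
  by apply: functional_extensionality => x; ring.
rewrite -/(iter_partial l f) IH partial_scal //.
by apply: functional_extensionality => x; rewrite ef; ring.
Qed.

Lemma zprod_bound zeta l : Cmod (zprod zeta l) <= zsize zeta ^ size l.
Proof.
elim: l => [|k l IH] /=; first by rewrite Cmod_1; right.
rewrite !Cmod_mult Cmod_Ci Rmult_1_l Cmod_R.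
apply: Rmult_le_compat => //; try exact: Rabs_pos; try exact: Cmod_ge_0.
by have := zmax_ge zeta k; rewrite /zsize; lra.
Qed.

Lemma zprod_nseq zeta k j : Cmod (zprod zeta (nseq j k)) = Rabs (IZR (zeta k)) ^ j.
Proof.
elim: j => [|j IH] /=; first by rewrite Cmod_1.
by rewrite !Cmod_mult Cmod_Ci Rmult_1_l Cmod_R IH.
Qed.

(** Projecting [d_k^j f], where [k] is the direction of the largest component, produces the factor
    [|zeta k|^j]. For [zeta <> 0], [zsize zeta <= 2 |zeta k|], which accounts for the 2 in the rate;
    at [zeta = 0] the supremum of [f] suffices. [4 ^ N] comes from the projections. *)
Lemma ecoef_decay f : pureE f -> exists A h, 0 < A /\ 1 <= h /\
  forall zeta j x, Cmod (ecoef zeta f x) * zsize zeta ^ j <= A * h ^ j * wf m j.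
Proof.
case=> pf [sf [K [h [K0 [h0 H]]]]].
pose h1 := Rmax h 1.
have h11 : 1 <= h1 by exact: Rmax_r.
have hh1 : h <= h1 by exact: Rmax_l.
have p4 : 0 < 4 ^ N by apply: pow_lt; lra.
have cf : Cont f by exact: smooth_continuous.
exists (4 ^ N * K), (2 * h1); split; first exact: Rmult_lt_0_compat.
split; first lra.
move=> zeta j x; have w1 := wf_ge1 hm j.
have hp : 1 <= (2 * h1) ^ j by apply: pow_R1_Rle; lra.
case: (eqVneq (zmax zeta) 0%N) => [z0 | /eqP z0].
  rewrite /zsize z0 [INR 0]/= Rplus_0_r pow1 Rmult_1_r.
  have b0 : Cmod (ecoef zeta f x) <= 4 ^ N * K.
    rewrite -{2}(size_enum_ord N); apply: eproj_bound => // y.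
    have := H ord0 0%N y; rewrite /= /wf ws_m0 //=; lra.
  have q : 1 <= (2 * h1) ^ j * wf m j.
    by rewrite -{1}(Rmult_1_l 1); apply: Rmult_le_compat; lra.
  have Kp : 0 <= 4 ^ N * K by left; exact: Rmult_lt_0_compat.
  by have := Rmult_le_compat_l _ _ _ Kp q; lra.
have [k hk] := zmax_attained z0.
have zk : zsize zeta <= 2 * Rabs (IZR (zeta k)).
  rewrite /zsize -hk; have : 1 <= INR (zmax zeta) by apply: (le_INR 1); lia.
  by lra.
have E : ecoef zeta (iter_partial (nseq j k) f) x =
    (zprod zeta (nseq j k) * ecoef zeta f x)%C.
  have <- := congr1 (fun F => F x)
    (eigen_iter (nseq j k) (smooth_eproj _ _ sf) (eigen_ecoef zeta sf pf)).
  congr (_ x); rewrite /ecoef; elim: j {w1 hp} => //= j IH.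
  by rewrite -/(iter_partial _ _) -IH partial_eproj //; exact: smooth_iter.
have : Rabs (IZR (zeta k)) ^ j * Cmod (ecoef zeta f x) <= 4 ^ N * (K * h ^ j * wf m j).
  rewrite -zprod_nseq -Cmod_mult -E.
  have := eproj_bound (enum 'I_N) zeta x (smooth_continuous (smooth_iter (nseq j k) sf))
    (fun y => H k j y).
  by rewrite size_enum_ord.
move=> b; have c0 := Cmod_ge_0 (ecoef zeta f x); have x1 := zsize_ge1 zeta.
have b1 : zsize zeta ^ j <= 2 ^ j * Rabs (IZR (zeta k)) ^ j.
  by rewrite -Rpow_mult_distr; apply: pow_incr; lra.
have b2 : h ^ j <= h1 ^ j by apply: pow_incr; lra.
have t0 : 0 < 2 ^ j by apply: pow_lt; lra.
apply: Rle_trans (Rmult_le_compat_l _ _ _ c0 b1) _.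
rewrite Rpow_mult_distr.
have := Rmult_le_compat_l _ _ _ (Rlt_le _ _ t0) b.
have : 2 ^ j * (4 ^ N * K * wf m j) * h ^ j <= 2 ^ j * (4 ^ N * K * wf m j) * h1 ^ j.
  apply: Rmult_le_compat_l => //; apply: Rmult_le_pos; first lra.
  by apply: Rmult_le_pos; [apply: Rmult_le_pos; lra | lra].
by lra.
Qed.

(* Says that [|c zeta| inf_j (wf m j / (eps * zsize zeta) ^ j)] is bounded, with
   the infimum replaced by its lower bounds [v]. *)
Definition coef_ok c : Prop := forall eps, 0 < eps -> exists K, 0 < K /\
  forall zeta v, 0 <= v -> (forall j, v <= wf m j / (eps * zsize zeta) ^ j) ->
    Cmod (c zeta) * v <= K.

(** The decay of [ecoef] at order [j + k] splits, by moderate growth, into the desired decay at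
    order [j] and a factor of order [k]. As [k] is arbitrary, this factor is controlled by the
    infimum that [coef_ok] pairs with [c]. *)
Lemma coef_decay c f : pureE f -> coef_ok c -> exists A G, 0 < A /\ 1 <= G /\
  forall zeta j x, Cmod (c zeta * ecoef zeta f x) * zsize zeta ^ j <= A * G ^ j * wf m j.
Proof.
move=> Ef cok; have [A [h [A0 [h1 H]]]] := ecoef_decay Ef.
have [G0 [G1 HG]] := wf_growth hm.
(* [B] joins the rate of decay and the constant of moderate growth. With [eps = / B], the estimates
   obtained for [v] are exactly those that [coef_ok] requires; [v] itself is the decay quotient of
   order [j] for [ecoef] alone, normalized. *)
pose B := h * G0; have B1 : 1 <= B by rewrite /B; nra.
have eps0 : 0 < / B by apply: Rinv_0_lt_compat; lra.
have [K [K0 HK]] := cok _ eps0.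
exists (K * A), B; split; first exact: Rmult_lt_0_compat.
split=> // zeta j x.
have x1 := zsize_ge1 zeta.
have w0 p : 0 < wf m p by have := wf_ge1 hm p; lra.
have D0 : 0 < A * B ^ j * wf m j.
  by apply: Rmult_lt_0_compat => //; apply: Rmult_lt_0_compat => //; apply: pow_lt; lra.
pose v := Cmod (ecoef zeta f x) * zsize zeta ^ j / (A * B ^ j * wf m j).
have e0 := Cmod_ge_0 (ecoef zeta f x).
have xp p : 0 < zsize zeta ^ p by apply: pow_lt; lra.
have Bp p : 0 < B ^ p by apply: pow_lt; lra.
have v0 : 0 <= v.
  by apply: Rdiv_le_0_compat => //; apply: Rmult_le_pos => //; left.
have := HK zeta v v0 => /(_ _) hv.
have {}hv : Cmod (c zeta) * v <= K.
  apply: hv => k.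
  have Hjk := H zeta (j + k)%N x; have Gjk := HG j k.
  apply: (Rmult_le_reg_r (zsize zeta ^ k * (A * B ^ j * wf m j))).
    exact: Rmult_lt_0_compat.
  have -> : wf m k / (/ B * zsize zeta) ^ k * (zsize zeta ^ k * (A * B ^ j * wf m j)) =
      A * (B ^ j * B ^ k) * (wf m j * wf m k).
    rewrite Rpow_mult_distr pow_inv; field; have := Bp k; have := xp k; lra.
  have -> : v * (zsize zeta ^ k * (A * B ^ j * wf m j)) =
      Cmod (ecoef zeta f x) * (zsize zeta ^ j * zsize zeta ^ k).
    by rewrite /v; field; have := Bp j; have := w0 j; lra.
  rewrite -!pow_add plusE; apply: Rle_trans Hjk _.
  have Ah : 0 <= A * h ^ (j + k) by apply: Rmult_le_pos; [lra | apply: pow_le; lra].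
  by have := Rmult_le_compat_l _ _ _ Ah Gjk; rewrite /B Rpow_mult_distr; lra.
rewrite Cmod_mult.
have -> : Cmod (c zeta) * Cmod (ecoef zeta f x) * zsize zeta ^ j =
    Cmod (c zeta) * v * (A * B ^ j * wf m j).
  by rewrite /v; field; have := Bp j; have := w0 j; lra.
have -> : K * A * B ^ j * wf m j = K * (A * B ^ j * wf m j) by ring.
by apply: Rmult_le_compat_r => //; lra.
Qed.

(* [dec j] is arbitrary when [j] is not a code; such terms are set to 0. *)
Definition fterm c f (j : nat) : vec N -> C :=
  if Nat.eqb (enc (dec j : 'I_N -> Z)) j then (fun x => c (dec j) * ecoef (dec j) f x)%C
  else (fun _ => RtoC 0).

(** The Fourier multiplier with symbol [c]. Symbol 1 gives the Fourier series of [f], and the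
    inverse divisors give the solution operator. *)
Definition fsynth c f : vec N -> C := fsum (fterm c f).

Lemma smooth_fterm c f j : smooth f -> smooth (fterm c f j).
Proof.
move=> sf; rewrite /fterm; case: ifP => _; last exact: smooth_const.
by apply: smooth_scal; exact: smooth_eproj.
Qed.

Lemma periodic_fterm c f j : periodic f -> periodic (fterm c f j).
Proof.
move=> pf; rewrite /fterm; case: ifP => _ //.
by move=> x k; rewrite /ecoef (periodic_eproj _ _ pf).
Qed.

Lemma eigen_fterm c f j : smooth f -> periodic f -> eigen (@dec N j) (fterm c f j).
Proof.
move=> sf pf k x; rewrite /fterm; case: ifP => _; last by rewrite partial_const; ring.
rewrite partial_scal; last exact: smooth_eproj.
by rewrite (eigen_ecoef _ sf pf); ring.
Qed.

(** The decay is used at order [L + D]: [L] powers of [zsize] pay for the derivatives and [D] for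
    [btel]. A derivative in any direction costs at most one factor [zsize], so only the length of
    [l] enters; this is how mixed derivatives are recovered from pure ones. *)
Lemma fterm_bounds c f : pureE f -> coef_ok c -> exists K h, 0 < K /\ 0 < h /\
  forall l j x, Cmod (iter_partial l (fterm c f j) x) <=
    K * h ^ size l * wf m (size l) * btel j.
Proof.
move=> Ef cok; have [pf [sf _]] := Ef.
have [A [G [A0 [G1 H]]]] := coef_decay Ef cok.
have [G0 [G01 HG]] := wf_growth hm.
pose D := enc_exp N; pose E := 2 * 2 ^ D.
have E0 : 0 < E by apply: Rmult_lt_0_compat; [lra | apply: pow_lt; lra].
have w0 p : 0 < wf m p by have := wf_ge1 hm p; lra.
have Gp p : 0 < G ^ p by apply: pow_lt; lra.
have G0p p : 0 < G0 ^ p by apply: pow_lt; lra.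
have HE zeta : 1 <= E * zsize zeta ^ D * btel (enc zeta) := enc_btel zeta.
clearbody E D.
exists (E * (A * G ^ D * G0 ^ D * wf m D)), (G * G0); split.
  by do !apply: Rmult_lt_0_compat => //.
split; first nra.
move=> l j x; set L := size l.
have K0 : 0 <= E * (A * G ^ D * G0 ^ D * wf m D) * (G * G0) ^ L * wf m L * btel j.
  apply: Rmult_le_pos; last exact: btel_ge0.
  by left; do !apply: Rmult_lt_0_compat => //; apply: pow_lt; nra.
rewrite (eigen_iter l (smooth_fterm c j sf) (eigen_fterm c j sf pf)) Cmod_mult.
rewrite {1}/fterm; case: PeanoNat.Nat.eqb_spec => [ej | _]; last first.
  by rewrite Cmod_0 Rmult_0_r.
set zeta := @dec N j in ej *.
have x1 := zsize_ge1 zeta.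
have Hl := zprod_bound zeta l.
have Hd := HE zeta; rewrite ej in Hd.
have Hc := H zeta (L + D)%N x; have Hg := HG L D.
have c0 := Cmod_ge_0 (c zeta * ecoef zeta f x)%C.
set y := Cmod (c zeta * _)%C in c0 Hc *.
have b0 := btel_ge0 j.
apply: Rle_trans (Rmult_le_compat_r _ _ _ c0 Hl) _; rewrite -/L.
have z0 : 0 <= zsize zeta ^ L * y by apply: Rmult_le_pos => //; apply: pow_le; lra.
have := Rmult_le_compat_l _ _ _ z0 Hd; rewrite Rmult_1_r => h1.
apply: Rle_trans h1 _.
have -> : zsize zeta ^ L * y * (E * zsize zeta ^ D * btel j) =
    E * btel j * (y * zsize zeta ^ (L + D)) by rewrite pow_add; ring.
have Eb : 0 <= E * btel j by apply: Rmult_le_pos; lra.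
apply: Rle_trans (Rmult_le_compat_l _ _ _ Eb Hc) _.
have AG : 0 <= E * btel j * (A * G ^ (L + D)).
  by apply: Rmult_le_pos => //; apply: Rmult_le_pos; [lra | left].
have := Rmult_le_compat_l _ _ _ AG Hg => h2.
rewrite -[_ * (_ * wf m _)]Rmult_assoc; apply: Rle_trans h2 _; right.
by rewrite Rpow_mult_distr !pow_add; ring.
Qed.

Lemma summable_fterm c f : pureE f -> coef_ok c -> summable (fterm c f).
Proof.
move=> Ef cok; have [K [h [_ [_ H]]]] := fterm_bounds Ef cok.
split=> [j | l]; first by apply: smooth_fterm; case: Ef => _ [].
by exists (K * h ^ size l * wf m (size l)) => j x; exact: H.
Qed.

Lemma size_multi_index (beta : 'I_N -> nat) :
  size (flatten [seq nseq (beta k) k | k <- enum 'I_N]) = multi_order beta.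
Proof.
rewrite size_flatten /shape -map_comp sumnE big_map big_enum.
by apply: eq_bigr => k _ /=; rewrite size_nseq.
Qed.

Lemma in_E_fsynth c f : pureE f -> coef_ok c -> in_E m (fsynth c f).
Proof.
move=> Ef cok; have sm := summable_fterm Ef cok; have [pf [sf _]] := Ef.
split; first by apply: periodic_fsum => j; exact: periodic_fterm.
split; first exact: smooth_fsum.
have [K [h [K0 [h0 H]]]] := fterm_bounds Ef cok.
exists K, h; split=> //; split=> // beta x.
rewrite /multi_partial iter_partial_fsum // -size_multi_index.
set l := flatten _.
rewrite Rmult_assoc -/(wf m (size l)).
apply: (@csum_le (fun j => iter_partial l (fterm c f j) x)).
  exact: Csum_csum (fun j => H l j x).
exact: psum_bound (fun j => H l j x).
Qed.

(** The estimate of order 0 already gives [v <= 1], because [wf m 0 = 1]. *)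
Lemma coef_ok_bounded c K : 0 < K -> (forall zeta, Cmod (c zeta) <= K) -> coef_ok c.
Proof.
move=> K0 H eps e0; exists K; split=> // zeta v v0 /(_ 0%N).
rewrite /wf ws_m0 //= /Rdiv Rinv_1 !Rmult_1_r => v1.
by rewrite -(Rmult_1_r K); apply: Rmult_le_compat => //; exact: Cmod_ge_0.
Qed.

(** By orthogonality only the term of index [enc zeta] contributes, so the coefficient of a partial
    sum is exact as soon as this index has been passed. *)
Lemma ecoef_psum zeta f J : pureE f ->
  ecoef zeta (fun x => psum (fun j => fterm (fun _ => RtoC 1) f j x) J) =
  if (enc zeta < J)%N then ecoef zeta f else (fun _ => RtoC 0).
Proof.
move=> Ef; have [pf [sf _]] := Ef; set t := fterm _ f.
have st j : smooth (t j) by exact: smooth_fterm.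
have zero : ecoef zeta (fun _ => RtoC 0) = (fun _ => RtoC 0).
  have -> : (fun _ : vec N => RtoC 0) = (fun x => RtoC 0 * RtoC 0)%C.
    by apply: functional_extensionality => x; ring.
  rewrite /ecoef eproj_scal; last by move=> x; exact: continuous_const.
  by apply: functional_extensionality => x; ring.
have each j : ecoef zeta (t j) = if j == enc zeta then ecoef zeta f else (fun _ => RtoC 0).
  case: eqP => [-> | ne].
    rewrite /t /fterm encK PeanoNat.Nat.eqb_refl.
    rewrite (_ : (fun x => RtoC 1 * ecoef zeta f x)%C = ecoef zeta f); last first.
      by apply: functional_extensionality => x; ring.
    by apply: eproj_eigen; [exact: smooth_eproj | exact: eigen_ecoef].
  case: (classic (exists k, zeta k <> @dec N j k)) => [[k hk] | hne].
    apply: (eproj_eigen_neq (st j) (periodic_fterm _ _ pf) (eigen_fterm _ _ sf pf) _ hk).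
    by rewrite mem_enum.
  (* Here [j] decodes to [zeta] without being its code. The guard in [fterm] makes this term 0;
     without it [zeta] would be counted more than once. *)
  have e : dec j = zeta.
    apply: functional_extensionality => k; apply: NNPP => h; apply: hne; exists k.
    by move=> h'; apply: h.
  rewrite /t /fterm e; case: PeanoNat.Nat.eqb_spec => [e' | _]; last exact: zero.
  by case: ne.
elim: J => [|J IH]; first exact: zero.
have -> : (fun x => psum (fun j => t j x) J.+1) =
    (fun x => psum (fun j => t j x) J - RtoC (Ropp 1) * t J x)%C.
  by apply: functional_extensionality => x /=; rewrite RtoC_opp; ring.
have ct : Cont (t J) by exact: smooth_continuous.
rewrite /ecoef eproj_minus; first last.
- by apply: smooth_continuous; exact: smooth_scal.
- by apply: smooth_continuous; exact: smooth_psum.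
rewrite eproj_scal // -!/(ecoef _ _) IH each ltnS.
apply: functional_extensionality => x; rewrite RtoC_opp.
by case: ltngtP => [h|h|h]; rewrite ?(ltnW h) ?h ?leqnn //; ring.
Qed.

Lemma fsynth1 f : pureE f -> fsynth (fun _ => RtoC 1) f = f.
Proof.
move=> Ef; have [pf [sf _]] := Ef; set c := fun _ => RtoC 1.
have cok : coef_ok c.
  by apply: (@coef_ok_bounded _ 1) => [|z]; [lra | rewrite Cmod_1; right].
have sm := summable_fterm Ef cok; have [_ bt] := sm.
have sw : smooth (fsynth c f) by exact: smooth_fsum.
have cw : Cont (fsynth c f) by exact: smooth_continuous.
have cf : Cont f by exact: smooth_continuous.
have E zeta : ecoef zeta (fsynth c f) = ecoef zeta f.
  apply: functional_extensionality => x.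
  have [K HK] := bt [::].
  pose S J := fun y => psum (fun j => fterm c f j y) J.
  have cS J : Cont (S J).
    by apply: smooth_continuous; apply: smooth_psum; case: sm.
  have main J : Cmod (ecoef zeta (fsynth c f) x - ecoef zeta f x) <=
      0 + (4 ^ N * (2 * K)) / (INR J + 1).
    (* Beyond [J] for the rate of convergence, and beyond [enc zeta] so that the partial sum already
       has the coefficient of [f]. *)
    pose J' := (J + enc zeta).+1.
    have := ecoef_psum zeta J' Ef; rewrite ltnS leq_addl -/c -/(S J') => <-.
    have -> : (ecoef zeta (fsynth c f) x - ecoef zeta (S J') x)%C =
        ecoef zeta (fun y => fsynth c f y - S J' y)%C x by rewrite /ecoef eproj_minus.
    have bw y : Cmod (fsynth c f y - S J' y) <= 2 * K / (INR J' + 1).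
      exact: (Csum_tail (fun j => HK j y)).
    have cd : Cont (fun y => fsynth c f y - S J' y)%C.
      have -> : (fun y => fsynth c f y - S J' y)%C =
          (fun y => fsynth c f y + RtoC (Ropp 1) * S J' y)%C.
        by apply: functional_extensionality => y; rewrite RtoC_opp; ring.
      apply: smooth_continuous; apply: smooth_plus => //; apply: smooth_scal.
      by apply: smooth_psum; case: sm.
    have := eproj_bound (enum 'I_N) zeta x cd bw.
    rewrite size_enum_ord Rplus_0_l /Rdiv -Rmult_assoc => hb.
    apply: Rle_trans hb _; apply: Rmult_le_compat_l.
      apply: Rmult_le_pos; first by apply: pow_le; lra.
      have := Rle_trans _ _ _ (Cmod_ge_0 _) (HK 0%N x).
      by have : 0 < btel 0 by [rewrite /btel /=; lra]; nra.
    apply: Rinv_le_contravar; first exact: INR1_gt0.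
    have : INR J <= INR J' by apply: le_INR; rewrite /J' -plusE; lia.
    by lra.
  have h := le_of_forall_div main.
  have {}h : Cmod (ecoef zeta (fsynth c f) x - ecoef zeta f x) = 0.
    by apply: Rle_antisym h _; exact: Cmod_ge_0.
  have -> : (ecoef zeta (fsynth c f) x =
    ecoef zeta (fsynth c f) x - ecoef zeta f x + ecoef zeta f x)%C by ring.
  by rewrite (Cmod_eq_0 _ h); ring.
pose d := fun y => (fsynth c f y + RtoC (Ropp 1) * f y)%C.
have dE : d = (fun y => fsynth c f y - f y)%C.
  by apply: functional_extensionality => y; rewrite /d RtoC_opp; ring.
have d0 : d = (fun _ => RtoC 0).
  apply: (@eproj_uniqueness _ (enum 'I_N)); first exact: enum_uniq.
  - by apply: smooth_plus => //; exact: smooth_scal.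
  - have pw : periodic (fsynth c f).
      by apply: periodic_fsum => j; exact: periodic_fterm.
    by move=> y k; rewrite /d pw pf.
  - move=> zeta; rewrite dE eproj_minus // -!/(ecoef _ _) E.
    by apply: functional_extensionality => y; ring.
apply: functional_extensionality => y.
have : d y = RtoC 0 by rewrite d0.
rewrite dE => h; have -> : (fsynth c f y = fsynth c f y - f y + f y)%C by ring.
by rewrite h; ring.
Qed.

Lemma pureE_in_E f : pureE f -> in_E m f.
Proof.
move=> Ef; rewrite -(fsynth1 Ef); apply: in_E_fsynth => //.
by apply: (@coef_ok_bounded _ 1) => [|z]; [lra | rewrite Cmod_1; right].
Qed.

End Synthesis.

(** * Products, linear equations and functions of t *)

Lemma nseqSr (T : Type) j (x : T) : nseq j.+1 x = rcons (nseq j x) x.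
Proof. by elim: j => //= j {1}->. Qed.

Section PureE.
Variables (m : nat -> R) (hm : weight_sequence m) (n : nat).
Implicit Types (f g a phi : vec n.+1 -> C) (k : 'I_n.+1).

Let wpos j : 0 < wf m j.
Proof. by have := wf_ge1 hm j; lra. Qed.

Lemma pureE_smooth f : pureE m f -> smooth f.
Proof. by case=> _ []. Qed.

(** The parameter [h0] serves to enlarge the rate of one function to that of another before the two
    are combined. *)
Lemma pureE_bound f h0 : pureE m f -> exists K h, 0 < K /\ h0 <= h /\ 1 <= h /\
  forall k j x, Cmod (iter_partial (nseq j k) f x) <= K * h ^ j * wf m j.
Proof.
move=> [_ [_ [K [h [K0 [hp H]]]]]]; exists K, (Rmax h (Rmax h0 1)); split=> //.
have m1 := Rmax_l h (Rmax h0 1); have m2 := Rmax_r h (Rmax h0 1).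
have m3 := Rmax_l h0 1; have m4 := Rmax_r h0 1.
split; first lra; split; first lra.
move=> k j x; apply: Rle_trans (H k j x) _.
apply: Rmult_le_compat_r; first by left.
by apply: Rmult_le_compat_l; [lra | apply: pow_incr; lra].
Qed.

Lemma pureE_const (c : C) : pureE m (fun _ : vec n.+1 => c).
Proof.
split=> //; split; first exact: smooth_const.
exists (Cmod c + 1), 1; have c0 := Cmod_ge_0 c; split; first lra; split; first lra.
move=> k j x; rewrite pow1 Rmult_1_r; have w1 := wf_ge1 hm j.
apply: (@Rle_trans _ (Cmod c)); last by nra.
case: j {w1} => [|j]; first exact: Rle_refl.
by rewrite nseqSr iter_partial_rcons partial_const iter_partial0 Cmod_0.
Qed.

Lemma iter_nseqS j k f : iter_partial (nseq j.+1 k) f = iter_partial (nseq j k) (partial k f).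
Proof. by rewrite nseqSr iter_partial_rcons. Qed.

Lemma pureE_plus f g : pureE m f -> pureE m g -> pureE m (fun x => f x + g x)%C.
Proof.
move=> Ef Eg; have [pf [sf _]] := Ef; have [pg [sg _]] := Eg.
split; first by move=> x k; rewrite pf pg.
split; first exact: smooth_plus.
have [K [h [K0 [_ [h1 H]]]]] := pureE_bound 0 Ef.
have [K' [h' [K0' [hh [h1' H']]]]] := pureE_bound h Eg.
exists (K + K'), h'; split; first lra; split; first lra.
move=> k j x; rewrite iter_partial_plus //.
apply: Rle_trans (Cmod_triangle _ _) _; rewrite !Rmult_plus_distr_r.
apply: Rplus_le_compat; last exact: H'.
apply: Rle_trans (H k j x) _; apply: Rmult_le_compat_r; first by left.
by apply: Rmult_le_compat_l; [lra | apply: pow_incr; lra].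
Qed.

Lemma pureE_conj f : pureE m f -> pureE m (fun x => Cconj (f x)).
Proof.
move=> [pf [sf [K [h [K0 [h0 H]]]]]].
split; first by move=> x k; rewrite pf.
split; first exact: smooth_conj.
exists K, h; split=> //; split=> // k j x; rewrite iter_partial_conj //.
by rewrite Cmod_conj.
Qed.

(* The factor [p! q! (p+q+j+1)! / (p+q+1)!] satisfies the recursion
   [b (p, q, j+1) = b (p+1, q, j) + b (p, q+1, j)] of the Leibniz rule. *)
Lemma leibniz_bound f g k A K rho J : smooth f -> smooth g -> 0 <= A -> 0 <= K -> 0 <= rho ->
  (forall p x, Cmod (iter_partial (nseq p k) f x) <= A * rho ^ p * wf m p) ->
  (forall q x, (q <= J)%N -> Cmod (iter_partial (nseq q k) g x) <= K * rho ^ q * wf m q) ->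
  forall j p q x, (q + j <= J)%N ->
  Cmod (iter_partial (nseq j k)
     (fun y => iter_partial (nseq p k) f y * iter_partial (nseq q k) g y)%C x) <=
  A * K * rho ^ (p + q + j) * m (p + q + j)%N *
   (INR (fact p) * INR (fact q) * INR (fact (p + q + j).+1) / INR (fact (p + q).+1)).
Proof.
move=> sf sg A0 K0 r0 Hf Hg; have mpos j : 0 < m j by exact: ws_pos hm j.
have fpos j : 0 < INR (fact j) by exact: INR_fact_lt_0.
elim=> [|j IH] p q x hq.
  rewrite addn0 [nseq 0 k]/= [iter_partial [::] _]/= Cmod_mult.
  have hq' : (q <= J)%N by rewrite addn0 in hq.
  have B := Rmult_le_compat _ _ _ _ (Cmod_ge_0 _) (Cmod_ge_0 _) (Hf p x) (Hg q x hq').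
  apply: Rle_trans B _; rewrite /wf pow_add.
  have sub := weight_submult hm p q.
  have -> : INR (fact p) * INR (fact q) * INR (fact (p + q).+1) / INR (fact (p + q).+1) =
     INR (fact p) * INR (fact q) by field; have := fpos (p + q).+1; lra.
  have P0 : 0 <= A * K * (rho ^ p * rho ^ q) * (INR (fact p) * INR (fact q)).
    have rp j : 0 <= rho ^ j by exact: pow_le.
    have := fpos p; have := fpos q => *.
    by do !apply: Rmult_le_pos => //; lra.
  have := Rmult_le_compat_l _ _ _ P0 sub.
  by lra.
have sp : smooth (iter_partial (nseq p k) f) by exact: smooth_iter.
have sq : smooth (iter_partial (nseq q k) g) by exact: smooth_iter.
have hq1 : (q.+1 + j <= J)%N by rewrite addSnnS.
have hq0 : (q + j <= J)%N by apply: leq_trans hq; rewrite addnS.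
rewrite iter_nseqS partial_mult // iter_partial_plus; [|apply: smooth_mult..] => //;
  try exact: smooth_partial.
apply: Rle_trans (Cmod_triangle _ _) _.
have I1 := IH p.+1 q x hq0; have I2 := IH p q.+1 x hq1.
apply: Rle_trans (Rplus_le_compat _ _ _ _ I1 I2) _.
have -> : (p.+1 + q + j = p + q + j.+1)%N by rewrite addSn addSn addnS.
have -> : (p + q.+1 + j = p + q + j.+1)%N by rewrite !addnS addSn.
rewrite !(addSn, addnS); right.
have FS i : INR (fact i.+1) = (INR i + 1) * INR (fact i) by rewrite fact_simpl mult_INR S_INR.
(* Once the common factors are removed, the recursion is [(p + 1) + (q + 1) = p + q + 2]. *)
rewrite (FS (p + q).+1) (FS p) (FS q) (S_INR (p + q)) (plus_INR p q).
field; have := fpos (p + q).+1; have := pos_INR p; have := pos_INR q => *; split; lra.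
Qed.

Lemma fact_ratio0 (X : R) : INR (fact 0) * INR (fact 0) * X / INR (fact (0 + 0).+1) = X.
Proof. by rewrite [fact _]/= [fact (_).+1]/= [INR _]/=; field. Qed.

Lemma pureE_mult f g : pureE m f -> pureE m g -> pureE m (fun x => f x * g x)%C.
Proof.
move=> Ef Eg; have [pf [sf _]] := Ef; have [pg [sg _]] := Eg.
split; first by move=> x k; rewrite pf pg.
split; first exact: smooth_mult.
have [K [h [K0 [_ [h1 H]]]]] := pureE_bound 0 Ef.
have [K' [h' [K0' [hh [h1' H']]]]] := pureE_bound h Eg.
(* The Leibniz bound at [p = q = 0] has [(j + 1)!] in place of [j!]; the doubled rate absorbs the
   factor [j + 1 <= 2 ^ j]. *)
exists (K * K'), (2 * h'); split; first exact: Rmult_lt_0_compat.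
split; first lra.
move=> k j x.
have := @leibniz_bound f g k K K' h' j sf sg _ _ _ _ _ j 0%N 0%N x (leqnn j) => L.
apply: Rle_trans (L _ _ _ _ _) _; try lra.
- move=> p y; apply: Rle_trans (H k p y) _; apply: Rmult_le_compat_r; first by left.
  by apply: Rmult_le_compat_l; [lra | apply: pow_incr; lra].
- by move=> q y _; exact: H'.
rewrite fact_ratio0 !add0n fact_simpl mult_INR S_INR /wf.
have bern : INR j + 1 <= 2 ^ j by have := poly j 1 Rlt_0_1; rewrite (_ : 1 + 1 = 2); lra.
have P0 : 0 <= K * K' * h' ^ j * m j * INR (fact j).
  have := INR_fact_lt_0 j; have := ws_pos hm j; have : 0 <= h' ^ j by apply: pow_le; lra.
  by move=> *; do !apply: Rmult_le_pos => //; lra.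
have := Rmult_le_compat_l _ _ _ P0 bern.
by rewrite Rpow_mult_distr; lra.
Qed.

(** The functions [b phi] with [b] smooth are stable under derivatives, since
    [d_t (b phi) = (d_t b + b a) phi]; they form the bisimulation. *)
Lemma smooth_linear_ode a phi : smooth a -> Cont phi ->
  (forall x, has_partial ord0 phi x (a x * phi x)%C) ->
  (forall k x, k != ord0 -> has_partial k phi x (RtoC 0)) -> smooth phi.
Proof.
move=> sa cphi d0 dk.
apply: (@smooth_coind _ (fun h => exists2 b, smooth b & h = (fun x => b x * phi x)%C));
  last first.
  exists (fun _ => RtoC 1); first exact: smooth_const.
  by apply: functional_extensionality => x; ring.
move=> h [b sb ->]; split.
  by move=> x; apply: continuous_Cmult; [exact: smooth_continuous | exact: cphi].
move=> k; case: (eqVneq k ord0) => [-> | ne].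
  have [? ->] := partial_ext (fun x => has_partial_mult (smooth_has_partial ord0 x sb) (d0 x)).
  split=> //; exists (fun x => partial ord0 b x + b x * a x)%C.
    by apply: smooth_plus; [exact: smooth_partial | exact: smooth_mult].
  by apply: functional_extensionality => x; ring.
have [? ->] := partial_ext (fun x => has_partial_mult (smooth_has_partial k x sb) (dk k x ne)).
split=> //; exists (partial k b); first exact: smooth_partial.
by apply: functional_extensionality => x; ring.
Qed.

(** The equation [d_t phi = a phi] replaces a theorem on compositions with [exp]. The Leibniz bound
    for the derivative of order [J] of [a phi] carries [(J + 1)!], which is exactly the factorial
    wanted at order [J + 1]. With [rho >= A] and [m] nondecreasing, the induction closes without a
    growing constant. *)
Lemma pureE_linear_ode a phi M : pureE m a -> Cont phi -> periodic phi ->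
  (forall x, Cmod (phi x) <= M) ->
  (forall x, has_partial ord0 phi x (a x * phi x)%C) ->
  (forall k x, k != ord0 -> has_partial k phi x (RtoC 0)) -> pureE m phi.
Proof.
move=> Ea cphi pphi bphi d0 dk; have [_ [sa _]] := Ea.
have sphi := smooth_linear_ode sa cphi d0 dk.
split=> //; split=> //.
have [A [h [A0 [_ [h1 H]]]]] := pureE_bound 0 Ea.
pose rho := Rmax h A; have rh : h <= rho by exact: Rmax_l.
have rA : A <= rho by exact: Rmax_r.
have M0 : 0 <= M by apply: Rle_trans (bphi (fun _ => 0)); exact: Cmod_ge_0.
have rp j : 0 < rho ^ j by apply: pow_lt; lra.
have E0 : partial ord0 phi = (fun x => a x * phi x)%C by case: (partial_ext d0).
(* All orders up to [J] are treated together: the derivative of order [J + 1] of [phi] is that of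
   order [J] of [a phi], which involves all lower derivatives of [phi]. *)
have claim J q x : (q <= J)%N ->
    Cmod (iter_partial (nseq q ord0) phi x) <= (M + 1) * rho ^ q * wf m q.
  elim: J q x => [|J IH] q x.
    rewrite leqn0 => /eqP -> /=; rewrite Rmult_1_r.
    by have := wf_ge1 hm 0; have := bphi x; nra.
  rewrite leq_eqVlt => /orP[/eqP -> | ]; last by rewrite ltnS; exact: IH.
  rewrite iter_nseqS E0.
  have := @leibniz_bound a phi ord0 A (M + 1) rho J sa sphi _ _ _ _ IH J 0%N 0%N x (leqnn J) => L.
  apply: Rle_trans (L _ _ _ _) _; try lra.
    move=> p y; apply: Rle_trans (H ord0 p y) _; apply: Rmult_le_compat_r; first by left.
    by apply: Rmult_le_compat_l; [lra | apply: pow_incr; lra].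
  rewrite fact_ratio0 !add0n /wf [rho ^ J.+1]/=.
  have mono := weight_mono hm J; have mp := ws_pos hm J; have fp := INR_fact_lt_0 J.+1.
  have h2 : A * m J <= rho * m J.+1 by apply: Rmult_le_compat; lra.
  have P0 : 0 <= (M + 1) * rho ^ J * INR (fact J.+1).
    by have := rp J => *; do !apply: Rmult_le_pos; lra.
  by have := Rmult_le_compat_l _ _ _ P0 h2; lra.
exists (M + 1), rho; split; first lra; split; first lra.
move=> k j x; case: (eqVneq k ord0) => [-> | ne]; first exact: claim (leqnn j).
case: j => [|j]; first exact: (claim 0%N 0%N).
rewrite iter_nseqS; have [_ ->] := partial_ext (fun x => dk k x ne).
rewrite iter_partial0 Cmod_0.
have r0 := rp j.+1; have w0 := wpos j.+1.
by apply: Rmult_le_pos; [apply: Rmult_le_pos; lra | lra].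
Qed.

Definition tlift (F : vec 1 -> C) : vec n.+1 -> C := fun z => F (fun _ => z ord0).

Lemma shift_tlift (z : vec n.+1) h :
  (fun _ => shift z ord0 h ord0) = shift (fun _ => z ord0) ord0 h :> vec 1.
Proof.
by apply: functional_extensionality => i; rewrite (ord1 i) /shift !eqxx.
Qed.

Lemma has_partial_tlift F z : smooth F ->
  has_partial ord0 (tlift F) z (tlift (partial ord0 F) z).
Proof.
move=> sF; have [d1 d2] := smooth_has_partial ord0 (fun _ => z ord0) sF.
split; [apply: is_derive_ext d1 | apply: is_derive_ext d2] => h;
  by rewrite /tlift shift_tlift.
Qed.

Lemma has_partial_tlift0 F k z : k != ord0 -> has_partial k (tlift F) z (RtoC 0).
Proof.
move=> ne; have E h : tlift F (shift z k h) = tlift F z.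
  by congr F; apply: functional_extensionality => i; rewrite /shift eq_sym (negbTE ne).
split; [apply: (is_derive_ext (fun _ => Re (tlift F z))) |
        apply: (is_derive_ext (fun _ => Im (tlift F z)))];
  by [move=> h; rewrite E | exact: is_derive_const].
Qed.

Lemma smooth_tlift F : smooth F -> smooth (tlift F).
Proof.
move=> sF; apply: (@smooth_coind _ (fun h => exists2 G, smooth G & h = tlift G));
  last by exists F.
move=> h [G sG ->]; split=> [x | k].
  apply: (continuous_comp (fun z : vec n.+1 => (fun _ => z ord0) : vec 1) G).
    apply/filterlim_locally => eps; have := locally_ball x eps.
    by apply: filter_imp => y hy i; exact: hy.
  exact: smooth_continuous.
case: (eqVneq k ord0) => [-> | ne].
  have [? ->] := partial_ext (fun x => has_partial_tlift x sG).
  by split=> //; exists (partial ord0 G) => //; exact: smooth_partial.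
have [? ->] := partial_ext (fun x => has_partial_tlift0 G x ne).
by split=> //; exists (fun _ => RtoC 0) => //; exact: smooth_const.
Qed.

Lemma pureE_tlift F : in_E m F -> pureE m (tlift F).
Proof.
move=> /in_E_pureE [pF [sF [K [h [K0 [h0 H]]]]]].
split.
  move=> x k; case: (eqVneq k ord0) => [-> | ne].
    by rewrite /tlift shift_tlift pF.
  by congr F; apply: functional_extensionality => i; rewrite /shift eq_sym (negbTE ne).
split; first exact: smooth_tlift.
exists K, h; split=> //; split=> // k j x.
case: (eqVneq k ord0) => [-> | ne].
  have -> : iter_partial (nseq j ord0) (tlift F) = tlift (iter_partial (nseq j ord0) F).
    elim: j => //= j IH; rewrite -/(iter_partial _ _) IH.
    by have [_ ->] := partial_ext (fun x => has_partial_tlift x (smooth_iter (nseq j ord0) sF)).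
  exact: H.
case: j => [|j]; first exact: (H ord0 0%N).
rewrite iter_nseqS; have [_ ->] := partial_ext (fun x => has_partial_tlift0 F x ne).
rewrite iter_partial0 Cmod_0; left.
by apply: Rmult_lt_0_compat => //; apply: Rmult_lt_0_compat => //; exact: pow_lt.
Qed.

Lemma pureE_real_t (g : R -> R) : in_E1_real m g ->
  pureE m (fun z : vec n.+1 => RtoC (g (z ord0))).
Proof. exact: pureE_tlift. Qed.

End PureE.

(** * The transport operator *)

Lemma periodic_bounded (F : R -> R) : (forall t, continuous F t) ->
  (forall t, F (t + 2 * PI) = F t) -> exists M, forall t, Rabs (F t) <= M.
Proof.
move=> cF pF; have pi2 := two_PI_gt0.
have pN p t : F (t + INR p * (2 * PI)) = F t.
  elim: p t => [|p IH] t; first by rewrite /= Rmult_0_l Rplus_0_r.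
  by rewrite S_INR Rmult_plus_distr_r Rmult_1_l -Rplus_assoc pF.
have pZ k t : F (t + IZR k * (2 * PI)) = F t.
  case: (Z.le_ge_cases 0 k) => hk.
    by rewrite -(Z2Nat.id k hk) -INR_IZR_INZ pN.
  rewrite -[in RHS](Rplus_0_r t) -(Rplus_opp_r (IZR k * (2 * PI))) -Rplus_assoc.
  rewrite Ropp_mult_distr_l -opp_IZR -(Z2Nat.id (- k)); last lia.
  by rewrite -INR_IZR_INZ pN.
have [||x [Hx _]] := continuity_ab_maj (fun s => Rabs (F s)) 0 (2 * PI); first lra.
  move=> s _; apply/continuity_pt_filterlim.
  by apply: (continuous_comp F Rabs) => //; exact: continuous_Rabs.
exists (Rabs (F x)) => t; set k := Int_part (t / (2 * PI)).
rewrite -(pZ (- k)%Z t); apply: Hx.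
have [h1 h2] := base_Int_part (t / (2 * PI)); rewrite -/k in h1 h2.
have tE : t = t / (2 * PI) * (2 * PI) by field; lra.
by rewrite opp_IZR; split; nra.
Qed.

Lemma is_derive_translate (G : R -> R) x d :
  is_derive G x d -> is_derive (fun h => G (x + h)) 0 d.
Proof.
move=> dG; rewrite -(Rplus_0_r x) in dG.
have := @is_derive_comp R_AbsRing R_NormedModule G (fun h => x + h) 0 d 1 dG.
rewrite scal_one; apply.
by auto_derive.
Qed.

Section Exponential.
Variables (m : nat -> R) (hm : weight_sequence m) (n : nat).

(** [phi] is [exp (E1 + i E2)], bounded because [E1] is periodic, and it solves
    [d_t phi = a phi]. *)
Lemma pureE_exp (a1 a2 E1 E2 : R -> R) :
  let a := fun z : vec n.+1 => (a1 (z ord0), a2 (z ord0)) : C in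
  let phi := fun z : vec n.+1 =>
    (exp (E1 (z ord0)) * cos (E2 (z ord0)), exp (E1 (z ord0)) * sin (E2 (z ord0))) : C in
  pureE m a -> (forall t, is_derive E1 t (a1 t)) -> (forall t, is_derive E2 t (a2 t)) ->
  (forall t, E1 (t + 2 * PI) = E1 t) -> (forall t, E2 (t + 2 * PI) = E2 t) ->
  [/\ pureE m phi, forall z, has_partial ord0 phi z (a z * phi z)%C &
    forall k z, k != ord0 -> has_partial k phi z (RtoC 0)].
Proof.
move=> a phi Ea d1 d2 p1 p2.
pose G1 t := exp (E1 t) * cos (E2 t); pose G2 t := exp (E1 t) * sin (E2 t).
have ex1 t : ex_derive E1 t by eexists; exact: d1.
have ex2 t : ex_derive E2 t by eexists; exact: d2.
have D1 t : is_derive G1 t (a1 t * G1 t - a2 t * G2 t).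
  rewrite /G1 /G2; auto_derive => //.
  by rewrite (is_derive_unique _ _ _ (d1 t)) (is_derive_unique _ _ _ (d2 t)); ring.
have D2 t : is_derive G2 t (a1 t * G2 t + a2 t * G1 t).
  rewrite /G1 /G2; auto_derive => //.
  by rewrite (is_derive_unique _ _ _ (d1 t)) (is_derive_unique _ _ _ (d2 t)); ring.
have H0 z : has_partial ord0 phi z (a z * phi z)%C.
  by split; [apply: (is_derive_ext (fun h => G1 (z ord0 + h))) |
             apply: (is_derive_ext (fun h => G2 (z ord0 + h)))];
  try (by move=> h; rewrite /phi /shift eqxx);
  [apply: is_derive_translate; exact: D1 | apply: is_derive_translate; exact: D2].
have Hk k z : k != ord0 -> has_partial k phi z (RtoC 0).
  move=> ne; have E h : phi (shift z k h) = phi z.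
    by rewrite /phi /shift eq_sym (negbTE ne).
  split; [apply: (is_derive_ext (fun _ => Re (phi z))) |
          apply: (is_derive_ext (fun _ => Im (phi z)))];
    by [move=> h; rewrite E | exact: is_derive_const].
have c0 x : continuous (fun z : vec n.+1 => z ord0) x.
  apply/filterlim_locally => eps; have := locally_ball x eps.
  by apply: filter_imp => y hy; exact: hy.
have cphi : Cont phi.
  move=> x; apply/continuous_ReIm; split.
    apply: (continuous_comp (fun z : vec n.+1 => z ord0) G1) => //.
    by apply: ex_derive_continuous; eexists; exact: D1.
  apply: (continuous_comp (fun z : vec n.+1 => z ord0) G2) => //.
  by apply: ex_derive_continuous; eexists; exact: D2.
have pphi : periodic phi.
  by move=> x k; rewrite /phi /shift; case: eqP => _ //; rewrite p1 p2.
have [M HM] : exists M, forall t, Rabs (E1 t) <= M.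
  by apply: periodic_bounded => // t; exact: ex_derive_continuous.
have bphi x : Cmod (phi x) <= 2 * exp M.
  apply: Rle_trans (Cmod_le_ReIm _) _; rewrite /phi /Re /Im /= !Rabs_mult.
  have e0 := exp_pos (E1 (x ord0)).
  rewrite (Rabs_pos_eq (exp _)); last lra.
  have eM : exp (E1 (x ord0)) <= exp M.
    by have /Rabs_le_between [_ h] := HM (x ord0); case: h => [/exp_increasing|->]; lra.
  have b1 : Rabs (cos (E2 (x ord0))) <= 1 by apply: Rabs_le; exact: COS_bound.
  have b2 : Rabs (sin (E2 (x ord0))) <= 1 by apply: Rabs_le; exact: SIN_bound.
  by have := Rabs_pos (cos (E2 (x ord0))); have := Rabs_pos (sin (E2 (x ord0))); nra.
by split=> //; exact: (pureE_linear_ode hm Ea cphi pphi bphi).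
Qed.

End Exponential.

Section TransportOperator.
Variables (n : nat) (p0 : 'I_n -> R).
Implicit Types (u w phi : vec n.+1 -> C) (zeta : 'I_n.+1 -> Z).

Definition Dop u (z : vec n.+1) : C :=
  (partial ord0 u z
   - \big[Cplus/RtoC 0]_(j < n) (RtoC (p0 j) * partial (lift ord0 j) u z))%C.

Lemma big_Cplus I (r : seq I) (F G : I -> C) :
  (\big[Cplus/RtoC 0]_(i <- r) (F i + G i) =
   \big[Cplus/RtoC 0]_(i <- r) F i + \big[Cplus/RtoC 0]_(i <- r) G i)%C.
Proof.
elim: r => [|i r IH]; first by rewrite !big_nil; ring.
by rewrite !big_cons IH; ring.
Qed.

Lemma big_Cscal I (r : seq I) (c : C) (F : I -> C) :
  (c * \big[Cplus/RtoC 0]_(i <- r) F i = \big[Cplus/RtoC 0]_(i <- r) (c * F i))%C.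
Proof. by apply: (big_morph (fun x => c * x)%C) => [x y|]; ring. Qed.

Lemma Dop_plus u w z : smooth u -> smooth w ->
  Dop (fun y => u y + w y)%C z = (Dop u z + Dop w z)%C.
Proof.
move=> su sw; rewrite /Dop partial_plus //.
rewrite (eq_bigr (fun j => RtoC (p0 j) * partial (lift ord0 j) u z +
  RtoC (p0 j) * partial (lift ord0 j) w z)%C); last first.
  by move=> j _; rewrite partial_plus //; ring.
rewrite big_Cplus.
have H (a b c d : C) : (a + b - (c + d) = a - c + (b - d))%C by ring.
exact: H.
Qed.

Lemma Dop_scal (c : C) u z : smooth u -> Dop (fun y => c * u y)%C z = (c * Dop u z)%C.
Proof.
move=> su; rewrite /Dop partial_scal //.
rewrite (eq_bigr (fun j => c * (RtoC (p0 j) * partial (lift ord0 j) u z))%C); last first.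
  by move=> j _; rewrite partial_scal //; ring.
rewrite -big_Cscal; have H (a b : C) : (c * a - c * b = c * (a - b))%C by ring.
exact: H.
Qed.

Lemma Dop_conj u z : smooth u -> Dop (fun y => Cconj (u y)) z = Cconj (Dop u z).
Proof.
move=> su; rewrite /Dop partial_conj // Cminus_conj; congr (_ - _)%C.
rewrite (big_morph Cconj Cplus_conj (_ : Cconj (RtoC 0) = RtoC 0)).
  by apply: eq_bigr => j _; rewrite partial_conj // Cmult_conj; congr Cmult; apply: C_eq; rewrite /Re /Im /=; ring.
by apply: C_eq; rewrite /Re /Im /=; ring.
Qed.

Lemma Dop_mult_t phi a u z : smooth phi -> smooth u ->
  (forall z, has_partial ord0 phi z (a z * phi z)%C) ->
  (forall k z, k != ord0 -> has_partial k phi z (RtoC 0)) ->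
  Dop (fun y => phi y * u y)%C z = (a z * phi z * u z + phi z * Dop u z)%C.
Proof.
move=> sphi su d0 dk; rewrite /Dop partial_mult //.
have [_ ->] := partial_ext d0.
rewrite (eq_bigr (fun j => phi z * (RtoC (p0 j) * partial (lift ord0 j) u z))%C); last first.
  move=> j _; rewrite partial_mult //.
  by have [_ ->] := partial_ext (fun x => dk (lift ord0 j) x isT); ring.
rewrite -big_Cscal; have H (x b c d e : C) : (x * b * c + b * d - b * e =
  x * b * c + b * (d - e))%C by ring.
exact: H.
Qed.

Definition freq zeta : R :=
  IZR (zeta ord0) - \big[Rplus/0]_(j < n) (p0 j * IZR (zeta (lift ord0 j))).

Lemma Dop_eigen zeta u z : eigen zeta u -> Dop u z = (Ci * RtoC (freq zeta) * u z)%C.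
Proof.
move=> eu; rewrite /Dop eu /freq RtoC_minus.
rewrite (eq_bigr (fun j => Ci * RtoC (p0 j * IZR (zeta (lift ord0 j))) * u z)%C); last first.
  by move=> j _; rewrite eu RtoC_mult; ring.
rewrite -(big_morph (fun r => Ci * RtoC r * u z)%C (id2 := 0) (op2 := Rplus)).
- have H (a b d e : C) : (a * b * e - a * d * e = a * (b - d) * e)%C by ring.
  exact: H.
- by move=> x y; rewrite RtoC_plus; ring.
- by ring.
Qed.

Lemma csum_big I (r : seq I) (F : I -> nat -> C) (l : I -> C) :
  (forall i, csum (F i) (l i)) ->
  csum (fun j => \big[Cplus/RtoC 0]_(i <- r) F i j) (\big[Cplus/RtoC 0]_(i <- r) l i).
Proof.
move=> H; elim: r => [|i r IH].
  rewrite big_nil (_ : (fun _ => _) = (fun _ => RtoC 0)); first exact: csum_0.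
  by apply: functional_extensionality => j; rewrite big_nil.
rewrite big_cons (_ : (fun _ => _) = (fun j => F i j + \big[Cplus/RtoC 0]_(i <- r) F i j)%C).
  exact: csum_plus.
by apply: functional_extensionality => j; rewrite big_cons.
Qed.

Lemma csum_Dop t z : summable t -> csum (fun j => Dop (t j) z) (Dop (fsum t) z).
Proof.
move=> st; have cp k : csum (fun j => partial k (t j) z) (partial k (fsum t) z).
  have [_ /(_ [:: k]) [K HK]] := st.
  by rewrite partial_fsum //; exact: (Csum_csum (fun j => HK j z)).
have -> : Dop (fsum t) z = (partial ord0 (fsum t) z + RtoC (Ropp 1) *
    \big[Cplus/RtoC 0]_(j < n) (RtoC (p0 j) * partial (lift ord0 j) (fsum t) z))%C.
  by rewrite /Dop RtoC_opp; ring.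
have -> : (fun j => Dop (t j) z) = (fun i => partial ord0 (t i) z + RtoC (Ropp 1) *
    \big[Cplus/RtoC 0]_(j < n) (RtoC (p0 j) * partial (lift ord0 j) (t i) z))%C.
  by apply: functional_extensionality => i; rewrite /Dop RtoC_opp; ring.
apply: csum_plus => //; apply: csum_scal; apply: csum_big => j.
exact: csum_scal.
Qed.

Variables (m : nat -> R) (hm : weight_sequence m).

Lemma const_solve (c : C) :
  coef_ok m (fun zeta => / (Ci * RtoC (freq zeta) - c))%C ->
  (forall zeta, (Ci * RtoC (freq zeta) - c)%C <> RtoC 0) ->
  forall g, pureE m g ->
  exists w, pureE m w /\ forall z, Dop w z = (c * w z + g z)%C.
Proof.
set d := fun zeta => _ => cok dne g Eg; have [pg [sg _]] := Eg.
have sm := summable_fterm hm Eg cok.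
exists (fsynth d g); split; first exact: in_E_pureE (in_E_fsynth hm Eg cok).
move=> z.
have ok1 : coef_ok m (fun _ : 'I_n.+1 -> Z => RtoC 1).
  by apply: (@coef_ok_bounded _ hm _ _ 1) => [|y]; [lra | rewrite Cmod_1; right].
have sm1 := summable_fterm hm Eg ok1.
have C1 : csum (fun j => fterm (fun _ => RtoC 1) g j z) (g z).
  rewrite -{2}(fsynth1 hm Eg); have [_ /(_ [::]) [K HK]] := sm1.
  exact: (Csum_csum (fun j => HK j z)).
have C2 : csum (fun j => fterm d g j z) (fsynth d g z).
  by have [_ /(_ [::]) [K HK]] := sm; exact: (Csum_csum (fun j => HK j z)).
have C3 := csum_Dop z sm.
(* Both sides are sums of series in the rate sense, so it suffices to compare the terms of index
   [j], where [D] multiplies by [i] times [freq]. *)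
apply: (csum_uniq C3).
have := csum_plus (csum_scal c C2) C1; congr csum.
apply: functional_extensionality => j.
rewrite (Dop_eigen z (eigen_fterm d j sg pg)) /fterm.
case: ifP => _; last by ring.
rewrite /d; set e := (Ci * _ - c)%C; have e0 : e <> RtoC 0 by exact: dne.
have -> : (Ci * RtoC (freq (dec j)) = e + c)%C by rewrite /e; ring.
by field.
Qed.

End TransportOperator.

(** * The scalar equation and the small divisors *)

Lemma in_E1_real_continuous m s : in_E1_real m s -> forall t, continuous s t.
Proof.
move=> [_ [ss _]] t.
have c1 : continuous (fun t : R => (fun _ => t) : vec 1) t.
  apply/filterlim_locally => eps; have := locally_ball t eps.
  by apply: filter_imp => y hy i.
have [c2 _] := proj1 (continuous_ReIm _ _) (smooth_continuous ss (x := fun _ => t)).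
exact: (continuous_comp _ (fun y : vec 1 => s (y ord0)) t c1 c2).
Qed.

Lemma in_E1_real_periodic m s : in_E1_real m s -> forall t, s (t + 2 * PI) = s t.
Proof.
move=> [ps _] t; have := ps (fun _ => t) ord0; rewrite /shift eqxx.
exact: RtoC_inj.
Qed.

Section Primitive.
Variable s : R -> R.
Hypotheses (cs : forall t, continuous s t) (ps : forall t, s (t + 2 * PI) = s t).

Lemma is_derive_primitive t : is_derive (fun t => RInt s 0 t) t (s t).
Proof.
apply: (is_derive_RInt s (fun t => RInt s 0 t) 0) => //.
apply: filter_forall => y; apply: (@RInt_correct R_CompleteNormedModule).
by apply: ex_RInt_continuous => z _.
Qed.

Lemma primitive_period t : RInt s 0 (t + 2 * PI) = RInt s 0 t + RInt s 0 (2 * PI).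
Proof.
pose F t := RInt s 0 (t + 2 * PI) - RInt s 0 t.
have dF u : is_derive F u 0.
  apply: is_derive_eq; first apply: (is_derive_minus (fun t => RInt s 0 (t + 2 * PI))).
  - apply: (is_derive_comp (fun t => RInt s 0 t) (fun t => t + 2 * PI) u).
      exact: is_derive_primitive.
    by auto_derive.
  - exact: is_derive_primitive.
  - by rewrite /minus /plus /opp /scal /= /mult /= ps; ring.
have := is_derive0_const dF t; rewrite /F Rplus_0_l RInt_point /zero /=.
by lra.
Qed.

End Primitive.

Section ScalarEquation.
Variables (m : nat -> R) (hm : weight_sequence m) (n : nat) (p0 : 'I_n -> R).
Variables (s q : R -> R) (hs : in_E1_real m s) (hq : in_E1_real m q).

Lemma variable_solve (z0 : C) :
  let c := ((RtoC (RInt s 0 (2 * PI)) + z0 * RtoC (RInt q 0 (2 * PI))) / RtoC (2 * PI))%C in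
  coef_ok m (fun zeta => / (Ci * RtoC (freq p0 zeta) - c))%C ->
  (forall zeta, (Ci * RtoC (freq p0 zeta) - c)%C <> RtoC 0) ->
  forall f, pureE m f -> exists w, pureE m w /\
    forall z, Dop p0 w z = ((RtoC (s (z ord0)) + z0 * RtoC (q (z ord0))) * w z + f z)%C.
Proof.
set s0 := RInt s _ _; set q0 := RInt q _ _ => c cok cne f Ef.
have pi2 := two_PI_gt0.
have cs := in_E1_real_continuous hs; have cq := in_E1_real_continuous hq.
have ps := in_E1_real_periodic hs; have pq := in_E1_real_periodic hq.
have Es := @pureE_real_t _ hm n _ hs; have Eq := @pureE_real_t _ hm n _ hq.
pose S t := RInt s 0 t; pose Q t := RInt q 0 t.
have dS t : is_derive S t (s t) by exact: is_derive_primitive.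
have dQ t : is_derive Q t (q t) by exact: is_derive_primitive.
have c1 : Re c * (2 * PI) = s0 + Re z0 * q0.
  by rewrite /c /Cdiv -RtoC_inv; [rewrite /Re /=; field; lra | lra].
have c2 : Im c * (2 * PI) = Im z0 * q0.
  by rewrite /c /Cdiv -RtoC_inv; [rewrite /Im /=; field; lra | lra].
clearbody c.
(* [a1 + i a2] is [s + z0 q - c], which has mean zero by [c1] and [c2]; hence its primitives [E1]
   and [E2] are periodic. *)
pose a1 t := s t + Re z0 * q t - Re c; pose a2 t := Im z0 * q t - Im c.
pose E1 t := S t + Re z0 * Q t - Re c * t; pose E2 t := Im z0 * Q t - Im c * t.
have d1 t : is_derive E1 t (a1 t).
  rewrite /E1; auto_derive; first by split; [eexists; exact: dS | split; [eexists; exact: dQ|]].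
  by rewrite (is_derive_unique _ _ _ (dS t)) (is_derive_unique _ _ _ (dQ t)) /a1; ring.
have d2 t : is_derive E2 t (a2 t).
  rewrite /E2; auto_derive; first by eexists; exact: dQ.
  by rewrite (is_derive_unique _ _ _ (dQ t)) /a2; ring.
have pE1 t : E1 (t + 2 * PI) = E1 t.
  rewrite /E1 /S /Q !primitive_period // -/s0 -/q0; lra.
have pE2 t : E2 (t + 2 * PI) = E2 t.
  rewrite /E2 /Q !primitive_period // -/q0; lra.
have Ea : pureE m (fun z : vec n.+1 => (a1 (z ord0), a2 (z ord0)) : C).
  have -> : (fun z : vec n.+1 => (a1 (z ord0), a2 (z ord0)) : C) =
     (fun z => (RtoC (s (z ord0)) + z0 * RtoC (q (z ord0))) + - c)%C.
    by apply: functional_extensionality => z; apply: C_eq;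
      rewrite /a1 /a2 /Re /Im /=; ring.
  apply: pureE_plus; [exact: hm | | exact: pureE_const].
  by apply: pureE_plus => //; apply: pureE_mult => //; exact: pureE_const.
have Eb : pureE m (fun z : vec n.+1 => (- a1 (z ord0), - a2 (z ord0)) : C).
  have -> : (fun z : vec n.+1 => (- a1 (z ord0), - a2 (z ord0)) : C) =
     (fun z => RtoC (Ropp 1) * (a1 (z ord0), a2 (z ord0)))%C.
    by apply: functional_extensionality => z; apply: C_eq; rewrite /Re /Im /=; ring.
  by apply: pureE_mult => //; exact: pureE_const.
have [Ephi dphi0 dphik] := pureE_exp hm Ea d1 d2 pE1 pE2.
have dn (F G : R -> R) : (forall t, is_derive F t (G t)) ->
    forall t, is_derive (fun t => - F t) t (- G t).
  by move=> dF t; exact: (is_derive_opp F t (G t)).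
(* The inverse [psi] of [phi] is obtained as the exponential of the opposite primitive, so no
   stability of the class under inversion is required. *)
have [] := @pureE_exp _ hm n (fun t => - a1 t) (fun t => - a2 t) (fun t => - E1 t)
  (fun t => - E2 t) Eb (dn _ _ d1) (dn _ _ d2).
- by move=> t; rewrite pE1.
- by move=> t; rewrite pE2.
set phi := fun z => _ in Ephi dphi0 dphik; set psi := (X in pureE m X) => Epsi _ _.
have inv z : (phi z * psi z = RtoC 1)%C.
  have e : exp (E1 (z ord0)) * exp (- E1 (z ord0)) = 1.
    by rewrite -exp_plus Rplus_opp_r exp_0.
  have := sin2_cos2 (E2 (z ord0)); rewrite /Rsqr => sc.
  apply: C_eq; rewrite /phi /psi /Re /Im /= cos_neg sin_neg; last by ring.
  transitivity (exp (E1 (z ord0)) * exp (- E1 (z ord0)) *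
    (sin (E2 (z ord0)) * sin (E2 (z ord0)) + cos (E2 (z ord0)) * cos (E2 (z ord0)))).
    by ring.
  by rewrite e sc Rmult_1_l.
have [w [Ew Hw]] := const_solve hm cok cne (pureE_mult hm Epsi Ef).
exists (fun z => phi z * w z)%C; split; first exact: pureE_mult.
move=> z; rewrite (Dop_mult_t p0 z (pureE_smooth Ephi) (pureE_smooth Ew) dphi0 dphik) Hw.
have -> : ((a1 (z ord0), a2 (z ord0)) : C) =
    (RtoC (s (z ord0)) + z0 * RtoC (q (z ord0)) - c)%C.
  by apply: C_eq; rewrite /a1 /a2 /Re /Im /=; ring.
transitivity ((RtoC (s (z ord0)) + z0 * RtoC (q (z ord0))) * (phi z * w z) +
  phi z * psi z * f z)%C; first by ring.
by rewrite inv; ring.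
Qed.

Lemma coef_ok_Re (c : C) : Re c <> 0 ->
  coef_ok m (fun zeta : 'I_n.+1 -> Z => / (Ci * RtoC (freq p0 zeta) - c))%C /\
  (forall zeta, (Ci * RtoC (freq p0 zeta) - c)%C <> RtoC 0).
Proof.
move=> c0; have r0 : 0 < Rabs (Re c) by exact: Rabs_pos_lt.
have low zeta : Rabs (Re c) <= Cmod (Ci * RtoC (freq p0 zeta) - c).
  apply: Rle_trans (re_le_Cmod _); right; rewrite -Rabs_Ropp; congr Rabs.
  by rewrite /Re /=; ring.
have ne zeta : (Ci * RtoC (freq p0 zeta) - c)%C <> RtoC 0.
  by move=> e; have := low zeta; rewrite e Cmod_0; lra.
split=> //; apply: (@coef_ok_bounded _ hm _ _ (/ Rabs (Re c))).
  exact: Rinv_0_lt_compat.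
move=> zeta; rewrite Cmod_inv //.
exact: Rinv_le_contravar.
Qed.

End ScalarEquation.

(** The lower bound [v] excludes the infimum [- oo], and the finite terms exclude [+ oo]; these are
    the values at which [real] would return the default 0. *)
Lemma le_real_Inf_seq (v : R) (x : nat -> R) : (forall j, v <= x j) ->
  v <= real (Inf_seq (fun j => Rbar.Finite (x j))).
Proof.
move=> H; have := Inf_seq_correct (fun j => Rbar.Finite (x j)).
case: (Inf_seq _) => [l | | ] /=.
- move=> hl; apply: le_epsilon => eps e0.
  have [_ [j hj]] := hl (mkposreal _ e0); have := H j; move: hj => /=; lra.
- by move=> /(_ (x 0%N) 0%N) /=; lra.
- by move=> /(_ v) [j /=]; have := H j; lra.
Qed.

(** The progression is [2 PI (tau - y)] with [y] not an integer, so its distance to 0 is attained at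
    one of the two integers next to [y]. *)
Lemma arith_progression_gap (b : R) :
  (forall tau : Z, 2 * PI * IZR tau + b <> 0) ->
  exists d, 0 < d /\ forall tau : Z, d <= Rabs (2 * PI * IZR tau + b).
Proof.
move=> ne; have pi2 := two_PI_gt0.
pose y := - b / (2 * PI).
have E tau : 2 * PI * IZR tau + b = 2 * PI * (IZR tau - y) by rewrite /y; field; lra.
set k := Int_part y; have [h1 h2] := base_Int_part y; rewrite -/k in h1 h2.
have h3 : IZR k <> y by move=> e; apply: (ne k); rewrite E e; ring.
exists (2 * PI * Rmin (y - IZR k) (IZR k + 1 - y)); split.
  by apply: Rmult_lt_0_compat => //; apply: Rmin_glb_lt; lra.
move=> tau; rewrite E Rabs_mult (Rabs_pos_eq (2 * PI)); last lra.
apply: Rmult_le_compat_l; first lra.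
case: (Z.le_gt_cases tau k) => h.
  apply: Rle_trans (Rmin_l _ _) _; rewrite Rabs_minus_sym.
  apply: Rle_trans (Rle_abs _); have := IZR_le _ _ h; lra.
apply: Rle_trans (Rmin_r _ _) _; apply: Rle_trans (Rle_abs _).
have : IZR (k + 1) <= IZR tau by apply: IZR_le; lia.
by rewrite plus_IZR; lra.
Qed.

(** * From the Diophantine condition to bounds on the inverse divisors *)

Section SmallDivisors.
Variables (n : nat) (p0 : 'I_n -> R).
Implicit Types (xi : 'I_n -> Z) (zeta : 'I_n.+1 -> Z).

(** Finiteness of balls in the frequency lattice, phrased with codes so that a minimum over a ball
    becomes an induction on [nat]. *)
Lemma enc_below_bound (B : R) : exists J, forall xi, zsize xi <= B -> (enc xi < J)%N.
Proof.
have [J hJ] := INR_unbounded ((2 * B) ^ encdeg n).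
exists J => xi hB; apply/leP; apply: INR_lt; apply: Rlt_trans hJ.
have := enc_bound xi; have x1 := zsize_ge1 xi.
have : (2 * zsize xi) ^ encdeg n <= (2 * B) ^ encdeg n by apply: pow_incr; lra.
by lra.
Qed.

Lemma uniform_gap (G : ('I_n -> Z) -> Z -> R) (B : R) :
  (forall xi, exists d, 0 < d /\ forall tau, d <= G xi tau) ->
  exists d, 0 < d /\ forall xi, zsize xi <= B -> forall tau, d <= G xi tau.
Proof.
move=> H; have [J HJ] := enc_below_bound B.
have [d [d0 Hd]] : exists d, 0 < d /\ forall j, (j < J)%N -> forall tau, d <= G (dec j) tau.
  elim: J {HJ} => [|J [d [d0 IH]]]; first by exists 1; split; [lra|].
  have [d' [d0' H']] := H (dec J); exists (Rmin d d'); split; first exact: Rmin_glb_lt.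
  move=> j; rewrite ltnS leq_eqVlt => /orP[/eqP -> | hj] tau.
    exact: Rle_trans (Rmin_r _ _) (H' tau).
  exact: Rle_trans (Rmin_l _ _) (IH j hj tau).
by exists d; split=> // xi hB tau; rewrite -(encK xi); apply: Hd; exact: HJ.
Qed.

Lemma sum_le_const (T : eqType) (r : seq T) (F : T -> R) M : (forall i, F i <= M) ->
  \big[Rplus/0]_(i <- r) F i <= INR (size r) * M.
Proof.
move=> H; elim: r => [|i r IH]; first by rewrite big_nil /=; lra.
by rewrite big_cons [size _]/= S_INR; have := H i; lra.
Qed.

Lemma le_sum_nonneg (T : eqType) (r : seq T) (F : T -> R) i : (forall i, 0 <= F i) -> i \in r ->
  F i <= \big[Rplus/0]_(i <- r) F i.
Proof.
move=> H.
have pos r' : 0 <= \big[Rplus/0]_(i <- r') F i.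
  by elim: r' => [|j r' IH]; rewrite ?big_nil ?big_cons; [lra | have := H j; lra].
elim: r => //= j r IH; rewrite inE big_cons => /orP[/eqP -> | /IH].
  by have := pos r; lra.
by have := H j; lra.
Qed.

Lemma normZ_ge xi k : Rabs (IZR (xi k)) <= normZ xi.
Proof.
rewrite -sqrt_Rsqr_abs /normZ; apply: sqrt_le_1_alt.
have := @le_sum_nonneg _ (index_enum 'I_n) (fun j => IZR (xi j) ^ 2) k.
by rewrite /Rsqr /= Rmult_1_r; apply=> [i|]; [rewrite Rmult_1_r; nra | exact: mem_index_enum].
Qed.

Lemma normZ_le xi M : 0 <= M -> (forall k, Rabs (IZR (xi k)) <= M) -> normZ xi <= INR n * M.
Proof.
move=> M0 H; have n0 := pos_INR n.
rewrite -(sqrt_Rsqr (INR n * M)); last exact: Rmult_le_pos.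
apply: sqrt_le_1_alt.
have S := @sum_le_const _ (index_enum 'I_n) (fun j => IZR (xi j) ^ 2) (M ^ 2).
have sz : size (index_enum 'I_n) = n by rewrite [index_enum _]unlock -enumT size_enum_ord.
rewrite sz in S; apply: Rle_trans (S _) _.
  by move=> k; rewrite -(pow2_abs (IZR _)); apply: pow_incr; split; [exact: Rabs_pos | exact: H].
have nn : INR n <= INR n * INR n.
  case: (n) => [|p]; first by rewrite /=; lra.
  by rewrite S_INR; have := pos_INR p; nra.
by rewrite /Rsqr; have : 0 <= M * M; nra.
Qed.

Lemma zsize_le_normZ xi : zsize xi <= 1 + normZ xi.
Proof.
rewrite /zsize; apply: Rplus_le_compat_l.
case: (eqVneq (zmax xi) 0%N) => [-> | /eqP h]; first exact: sqrt_pos.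
by have [k ->] := zmax_attained h; exact: normZ_ge.
Qed.

Variables (m : nat -> R) (hm : weight_sequence m).

(** The Diophantine bound handles [normZ xi >= gamma]. The remaining [xi] are finitely many, and for
    each of them the divisors over all [tau] form a progression that avoids 0. *)
Lemma coef_ok_small_divisor (theta : R) :
  (forall xi tau, 2 * PI * IZR tau + 2 * PI * dotZ xi p0 <> theta) ->
  small_divisor_bound m p0 theta ->
  let c := (Ci * RtoC (theta / (2 * PI)))%C in
  coef_ok m (fun zeta : 'I_n.+1 -> Z => / (Ci * RtoC (freq p0 zeta) - c))%C /\
  (forall zeta, (Ci * RtoC (freq p0 zeta) - c)%C <> RtoC 0).
Proof.
move=> nr sdb c; have pi2 := two_PI_gt0.
(* [D] contains [- p0 . grad], whereas the Diophantine bound is written with [tau + xi . p0]; hence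
   the sign. *)
pose xi_of zeta : 'I_n -> Z := fun j => (- zeta (lift ord0 j))%Z.
pose G xi tau := Rabs (2 * PI * IZR tau + 2 * PI * dotZ xi p0 - theta).
have dE zeta : Cmod (Ci * RtoC (freq p0 zeta) - c) = G (xi_of zeta) (zeta ord0) / (2 * PI).
  have -> : (Ci * RtoC (freq p0 zeta) - c = Ci * RtoC (freq p0 zeta - theta / (2 * PI)))%C.
    by rewrite /c RtoC_minus; ring.
  rewrite Cmod_mult Cmod_Ci Rmult_1_l Cmod_R /G.
  have -> : freq p0 zeta - theta / (2 * PI) =
      (2 * PI * IZR (zeta ord0) + 2 * PI * dotZ (xi_of zeta) p0 - theta) * / (2 * PI).
    have -> : dotZ (xi_of zeta) p0 =
        - \big[Rplus/0]_(j < n) (p0 j * IZR (zeta (lift ord0 j))).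
      rewrite (big_morph Ropp Ropp_plus_distr Ropp_0).
      by apply: eq_bigr => j _; rewrite /xi_of opp_IZR; ring.
    by rewrite /freq; field; lra.
  rewrite Rabs_mult (Rabs_pos_eq (/ _)) //.
  by left; exact: Rinv_0_lt_compat.
have Gpos xi tau : 0 < G xi tau.
  by apply: Rabs_pos_lt => h; apply: (nr xi tau); lra.
have ne zeta : (Ci * RtoC (freq p0 zeta) - c)%C <> RtoC 0.
  move=> e; have := dE zeta; rewrite e Cmod_0 => h.
  have := Gpos (xi_of zeta) (zeta ord0).
  have : 0 < G (xi_of zeta) (zeta ord0) / (2 * PI) by apply: Rdiv_lt_0_compat.
  by lra.
split=> // eps e0.
have n1 : 0 < INR n + 1 by exact: INR1_gt0.
(* The Euclidean norm of [xi] and the maximum norm of [zeta] are compared by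
   [1 + normZ xi <= (n + 1) zsize zeta]; the factor [n + 1] is absorbed into [eps]. *)
have e1 : 0 < eps / (INR n + 1) by exact: Rdiv_lt_0_compat.
have [gamma [K [g0 [K0 HK]]]] := sdb _ e1.
have [d [d0 Hd]] : exists d, 0 < d /\ forall xi, zsize xi <= 1 + gamma -> forall tau, d <= G xi tau.
  apply: uniform_gap => xi.
  have [|d [d0 hd]] := arith_progression_gap (b := 2 * PI * dotZ xi p0 - theta).
    by move=> tau h; apply: (nr xi tau); lra.
  exists d; split=> // tau; have := hd tau; rewrite /G; congr (_ <= Rabs _); ring.
exists (2 * PI / K + 2 * PI / d); split.
  by apply: Rplus_lt_0_compat; exact: Rdiv_lt_0_compat.
move=> zeta v v0 hv; rewrite Cmod_inv // dE.
set xi := xi_of zeta; set g := G xi _; have gp : 0 < g by exact: Gpos.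
have -> : / (g / (2 * PI)) * v = 2 * PI * (v / g) by field; lra.
have key x : 0 < x -> x * v <= g -> 2 * PI * (v / g) <= 2 * PI / x.
  move=> x0 hx; apply: Rmult_le_compat_l; first lra.
  apply: (Rmult_le_reg_r (x * g)); first exact: Rmult_lt_0_compat.
  have -> : v / g * (x * g) = x * v by field; lra.
  by have -> : / x * (x * g) = g by field; lra.
have pK : 0 < 2 * PI / K by exact: Rdiv_lt_0_compat.
have pd : 0 < 2 * PI / d by exact: Rdiv_lt_0_compat.
case: (Rle_lt_dec gamma (normZ xi)) => hg.
  suff : 2 * PI * (v / g) <= 2 * PI / K by lra.
  apply: key => //; apply: Rle_trans (HK xi (zeta ord0) hg).
  apply: Rmult_le_compat_l; first lra.
  apply: le_real_Inf_seq => j; apply: Rle_trans (hv j) _.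
  have x1 := zsize_ge1 zeta; have nz : 0 <= normZ xi by exact: sqrt_pos.
  rewrite -Rpow_mult_distr; apply: Rmult_le_compat_l.
    by have := wf_ge1 hm j; rewrite /wf; lra.
  apply: Rinv_le_contravar; first by apply: pow_lt; apply: Rmult_lt_0_compat; lra.
  apply: pow_incr; split; first by apply: Rmult_le_pos; lra.
  have hn : normZ xi <= INR n * INR (zmax zeta).
    apply: normZ_le; first exact: pos_INR.
    by move=> k; rewrite /xi /xi_of opp_IZR Rabs_Ropp; exact: zmax_ge.
  have -> : eps * zsize zeta = eps / (INR n + 1) * ((INR n + 1) * zsize zeta) by field; lra.
  apply: Rmult_le_compat_l; first lra.
  by rewrite /zsize; have := pos_INR n; have := pos_INR (zmax zeta); lra.
suff : 2 * PI * (v / g) <= 2 * PI / d by lra.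
apply: key => //.
have v1 : v <= 1 by have := hv 0%N; rewrite /wf ws_m0 //= /Rdiv Rinv_1 !Rmult_1_r.
have hz := zsize_le_normZ xi.
have : d <= g by apply: Hd; lra.
by nra.
Qed.

End SmallDivisors.

(** * Reduction to scalar equations *)

Lemma Cconj_RtoC (r : R) : Cconj (RtoC r) = RtoC r.
Proof. by apply: C_eq; rewrite /Re /Im /= ?Ropp_0. Qed.

Lemma Cconj_Ci : Cconj Ci = (- Ci)%C.
Proof. by apply: C_eq; rewrite /Re /Im /=; ring. Qed.

Lemma CconjK (z : C) : Cconj (Cconj z) = z.
Proof. by apply: C_eq; rewrite /Re /Im /=; ring. Qed.

Lemma Cmult_conj_Cmod (z : C) : (z * Cconj z)%C = RtoC (Cmod z ^ 2).
Proof.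
rewrite /Cmod -Rsqr_pow2 Rsqr_sqrt; last by apply: Rplus_le_le_0_compat; exact: pow2_ge_0.
by apply: C_eq; rewrite /Re /Im /=; ring.
Qed.

Lemma Ci2 : (Ci * Ci = RtoC (Ropp 1))%C.
Proof. by apply: C_eq; rewrite /Re /Im /=; ring. Qed.

Definition Cconj_simpl := (Cplus_conj, Cmult_conj, Cconj_RtoC, Cconj_Ci, CconjK).

Section Solve.
Variables (m : nat -> R) (hm : weight_sequence m) (n : nat) (p0 : 'I_n -> R).
Variables (s q : R -> R) (hs : in_E1_real m s) (hq : in_E1_real m q).
Variables (alpha : C) (delta : R).

Let s0 := RInt s 0 (2 * PI).
Let q0 := RInt q 0 (2 * PI).

(* [w |-> L w + i mu w] intertwines the multiplication by [i mu] with [L]. *)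
Lemma solve_elliptic : alpha <> RtoC 0 -> Cmod alpha < Rabs delta ->
  let mu := sqrt (delta ^ 2 - Cmod alpha ^ 2) in
  let c := ((RtoC s0 + Ci * RtoC mu * RtoC q0) / RtoC (2 * PI))%C in
  coef_ok m (fun zeta => / (Ci * RtoC (freq p0 zeta) - c))%C ->
  (forall zeta, (Ci * RtoC (freq p0 zeta) - c)%C <> RtoC 0) ->
  forall f, pureE m f -> exists u, pureE m u /\
    forall z, operP p0 alpha delta s q u z = f z.
Proof.
move=> a0 had mu c cok cne f Ef.
have ap : 0 < Cmod alpha by exact: (proj1 (Cmod_gt_0 _)).
have sqlt : 0 < delta ^ 2 - Cmod alpha ^ 2 by rewrite -(pow2_abs delta); nra.
have mu0 : 0 < mu by exact: sqrt_lt_R0.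
have mu2 : mu ^ 2 = delta ^ 2 - Cmod alpha ^ 2 by rewrite /mu -Rsqr_pow2 Rsqr_sqrt //; lra.
(* If [delta = - mu], then [mu^2 = delta^2], which would force [alpha = 0]. *)
have dm : delta + mu <> 0.
  move=> e; have dE : delta = - mu by lra.
  by move: mu2; rewrite dE; nra.
have [a aE] : exists a, a = (Ci * RtoC (delta + mu))%C by eexists.
(* [e] equals [|a|^2 - |alpha|^2], the determinant of the real-linear map sending [w] to
   [a w + alpha conj w]. As it is nonzero, [g] can be taken as the preimage of [f]. *)
pose e := 2 * mu * (delta + mu).
have e0 : e <> 0 by rewrite /e; apply: Rmult_integral_contrapositive; split; lra.
have [g gE] : exists g, g = (fun z => RtoC (/ e) * (Cconj a * f z + (- alpha) * Cconj (f z)))%C.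
  by eexists.
have Eg : pureE m g.
  rewrite gE.
  apply: pureE_mult => //; first exact: pureE_const.
  apply: pureE_plus => //; apply: pureE_mult => //; try exact: pureE_const.
  exact: pureE_conj.
have [w [Ew Hw]] := variable_solve hm hs hq cok cne Eg.
have Ewc := pureE_conj Ew.
have sw := pureE_smooth Ew; have swc := pureE_smooth Ewc.
exists (fun z => a * w z + alpha * Cconj (w z))%C; split.
  by apply: pureE_plus => //; apply: pureE_mult => //; exact: pureE_const.
move=> z; rewrite /operP -/(Dop p0 _ z) Dop_plus; [|exact: smooth_scal..].
rewrite !Dop_scal // Dop_conj // Hw.
have fE : (a * g z + alpha * Cconj (g z) = f z)%C.
  rewrite gE !Cconj_simpl Copp_conj.
  transitivity (RtoC (/ e) * ((a * Cconj a - alpha * Cconj alpha) * f z))%C; first by ring.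
  have -> : (a * Cconj a - alpha * Cconj alpha = RtoC e)%C.
    rewrite (Cmult_conj_Cmod alpha) aE !Cconj_simpl.
    have -> : (Ci * RtoC (delta + mu) * (- Ci * RtoC (delta + mu)) =
      - (Ci * Ci) * RtoC ((delta + mu) * (delta + mu)))%C by rewrite RtoC_mult; ring.
    have -> : Cmod alpha ^ 2 = delta ^ 2 - mu ^ 2 by lra.
    by rewrite Ci2; apply: C_eq; rewrite /e /Re /Im /=; ring.
  by rewrite Cmult_assoc -RtoC_mult Rinv_l //; ring.
(* The relation [L^2 = - mu^2], that is [delta^2 - mu^2 = |alpha|^2], written so that [ring] can use
   it as the coefficient of [q w]. *)
have key : (Ci * Ci * RtoC (delta + mu) * RtoC (mu - delta) - alpha * Cconj alpha = RtoC 0)%C.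
  rewrite Cmult_conj_Cmod Ci2 -!RtoC_mult -RtoC_minus; congr RtoC.
  have -> : Cmod alpha ^ 2 = delta ^ 2 - mu ^ 2 by lra.
  by ring.
rewrite -[RHS]fE aE !Cconj_simpl.
set S := RtoC (s _); set Q := RtoC (q _); set W := w z; set Wb := Cconj W.
set G := g z; set Gb := Cconj G.
transitivity (Ci * RtoC (delta + mu) * G + alpha * Gb + Q * W *
  (Ci * Ci * RtoC (delta + mu) * RtoC (mu - delta) - alpha * Cconj alpha))%C.
  by rewrite RtoC_plus RtoC_minus; ring.
by rewrite key; ring.
Qed.

(* [L + lam] and [- (L - lam)] map into the eigenspaces of [L] for [lam] and
   [- lam], and [(L + lam) - (L - lam) = 2 lam]. *)
Lemma solve_hyperbolic : Rabs delta < Cmod alpha ->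
  let lam := sqrt (Cmod alpha ^ 2 - delta ^ 2) in
  s0 + lam * q0 <> 0 -> s0 - lam * q0 <> 0 ->
  forall f, pureE m f -> exists u, pureE m u /\
    forall z, operP p0 alpha delta s q u z = f z.
Proof.
move=> had lam hp hn f Ef.
have sqlt : 0 < Cmod alpha ^ 2 - delta ^ 2.
  by rewrite -(pow2_abs delta); have := Rabs_pos delta; nra.
have lam0 : 0 < lam by exact: sqrt_lt_R0.
have lam2 : lam ^ 2 = Cmod alpha ^ 2 - delta ^ 2 by rewrite /lam -Rsqr_pow2 Rsqr_sqrt //; lra.
have pi2 := two_PI_gt0.
(* Both scalar equations get the same right-hand side [g = f / (2 lam)]: the images of [g] under
   [L + lam] and [- (L - lam)] add up to [2 lam g = f]. *)
have [g gE] : exists g, g = (fun z => RtoC (/ (2 * lam)) * f z)%C by eexists.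
have Eg : pureE m g by rewrite gE; apply: pureE_mult => //; exact: pureE_const.
have sol (r : R) : s0 + r * q0 <> 0 -> exists w, pureE m w /\
    forall z, Dop p0 w z = ((RtoC (s (z ord0)) + RtoC r * RtoC (q (z ord0))) * w z + g z)%C.
  move=> hr.
  have [|cok cne] := @coef_ok_Re m hm n p0
    ((RtoC s0 + RtoC r * RtoC q0) / RtoC (2 * PI))%C; last exact: (variable_solve hm hs hq cok cne Eg).
  rewrite -RtoC_mult -RtoC_plus -RtoC_div; [|lra].
  rewrite /Re /=; apply: Rmult_integral_contrapositive; split=> //.
  by apply: Rinv_neq_0_compat; lra.
have [U [EU HU]] := sol lam hp.
have [V [EV HV]] : exists w, pureE m w /\ forall z, Dop p0 w z =
    ((RtoC (s (z ord0)) + RtoC (- lam) * RtoC (q (z ord0))) * w z + g z)%C.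
  by apply: sol; lra.
have EUc := pureE_conj EU; have EVc := pureE_conj EV.
have sU := pureE_smooth EU; have sUc := pureE_smooth EUc.
have sV := pureE_smooth EV; have sVc := pureE_smooth EVc.
(* [A] and [B] are the complex-linear parts of [L + lam] and of [- (L - lam)]; the antilinear parts
   are [alpha conj] and [- alpha conj]. *)
have [A AE] : exists A, A = (Ci * RtoC delta + RtoC lam)%C by eexists.
have [B BE] : exists B, B = (RtoC lam - Ci * RtoC delta)%C by eexists.
exists (fun z => (A * U z + alpha * Cconj (U z)) + (B * V z + (- alpha) * Cconj (V z)))%C.
split.
  by do !apply: pureE_plus => //; apply: pureE_mult => //; exact: pureE_const.
move=> z; rewrite /operP -/(Dop p0 _ z).
rewrite Dop_plus; [|by apply: smooth_plus; exact: smooth_scal ..].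
rewrite !Dop_plus; [|exact: smooth_scal ..].
rewrite !Dop_scal // !Dop_conj // HU HV !Cconj_simpl Copp_conj.
have -> : f z = (RtoC lam * g z + RtoC lam * g z)%C.
  rewrite gE !Cmult_assoc -RtoC_mult -Cmult_plus_distr_r -RtoC_plus.
  have -> : lam * / (2 * lam) + lam * / (2 * lam) = 1 by field; lra.
  by ring.
have key : (RtoC lam * RtoC lam - Ci * Ci * RtoC delta * RtoC delta -
    alpha * Cconj alpha = RtoC 0)%C.
  rewrite Cmult_conj_Cmod Ci2 -!RtoC_mult -!RtoC_minus; congr RtoC.
  have -> : Cmod alpha ^ 2 = lam ^ 2 + delta ^ 2 by lra.
  by ring.
have AC : Cconj A = B by rewrite AE BE; apply: C_eq; rewrite /Re /Im /=; ring.
have BC : Cconj B = A by rewrite AE BE; apply: C_eq; rewrite /Re /Im /=; ring.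
rewrite AC BC RtoC_opp AE BE.
set S := RtoC (s _); set Q := RtoC (q _).
transitivity (RtoC lam * g z + RtoC lam * g z + Q * (U z - V z) *
  (RtoC lam * RtoC lam - Ci * Ci * RtoC delta * RtoC delta - alpha * Cconj alpha))%C.
  by ring.
by rewrite key; ring.
Qed.

End Solve.

Theorem theorem4p2 (m : nat -> R) (hm : weight_sequence m)
    (n : nat) (hn : (1 <= n)%N)
    (alpha : C) (halpha : alpha <> RtoC 0) (delta : R) (p0 : 'I_n -> R)
    (q s : R -> R) (hqE : in_E1_real m q) (hsE : in_E1_real m s)
    (hq : forall t : R, 0 <= q t) (hq0 : 0 < RInt q 0 (2 * PI)) :
  let q0 := RInt q 0 (2 * PI) in
  let s0 := RInt s 0 (2 * PI) in
  let A0 := (RtoC s0 + Ci * RtoC delta * RtoC q0)%C in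
  let B0 := (alpha * RtoC q0)%C in
  let no_resonance :=
    ~ exists (xi : 'I_n -> Z) (tau : Z), resonant p0 A0 B0 xi tau in
  (Cmod A0 < Cmod B0)
  \/ (Cmod B0 <= Cmod A0 /\ Rabs delta < Cmod alpha /\ no_resonance)
  \/ (Cmod alpha < Rabs delta /\ s0 <> 0)
  \/ (Cmod alpha < Rabs delta /\ s0 = 0 /\ no_resonance /\
      small_divisor_bound m p0 (q0 * sqrt (delta ^ 2 - Cmod alpha ^ 2))) ->
  forall f : vec n.+1 -> C, in_E m f ->
  exists u : vec n.+1 -> C, in_E m u /\
    forall z : vec n.+1, operP p0 alpha delta s q u z = f z.
Proof.
move=> q0 s0 A0 B0 no_resonance hyp f /in_E_pureE Ef.
suff [u [Eu Hu]] : exists u, pureE m u /\ forall z, operP p0 alpha delta s q u z = f z.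
  by exists u; split=> //; exact: pureE_in_E.
have pi2 := two_PI_gt0; have q0p : 0 < q0 by [].
have A2 : Cmod A0 ^ 2 = s0 ^ 2 + (delta * q0) ^ 2.
  rewrite /Cmod -Rsqr_pow2 Rsqr_sqrt; last by apply: Rplus_le_le_0_compat; exact: pow2_ge_0.
  by rewrite /A0 /=; ring.
have Bm : Cmod B0 = Cmod alpha * q0 by rewrite /B0 Cmod_mult Cmod_R Rabs_pos_eq //; lra.
have al0 : 0 < Cmod alpha by exact: (proj1 (Cmod_gt_0 _)).
have res xi tau : 4 * PI ^ 2 * (IZR tau + dotZ xi p0) ^ 2 = Cmod A0 ^ 2 - Cmod B0 ^ 2 ->
    s0 * (IZR tau + dotZ xi p0) = 0 -> resonant p0 A0 B0 xi tau.
  move=> h1 h2; split; last by rewrite pow2_abs.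
  by move: h2; rewrite /A0 /Re /= => h2; rewrite -[RHS]h2; ring.
have hyperbolic : Rabs delta < Cmod alpha -> Cmod A0 ^ 2 <> Cmod B0 ^ 2 ->
    exists u, pureE m u /\ forall z, operP p0 alpha delta s q u z = f z.
  move=> had ne; set lam := sqrt (Cmod alpha ^ 2 - delta ^ 2).
  have lam2 : lam ^ 2 = Cmod alpha ^ 2 - delta ^ 2.
    rewrite /lam -Rsqr_pow2 Rsqr_sqrt // -(pow2_abs delta).
    by have := Rabs_pos delta; nra.
  (* The product is [s0^2 - lam^2 q0^2], which is [|A0|^2 - |B0|^2]. *)
  have ne2 : (s0 + lam * q0) * (s0 - lam * q0) <> 0.
    move=> h; apply: ne; rewrite A2 Bm !Rpow_mult_distr.
    have -> : Cmod alpha ^ 2 = lam ^ 2 + delta ^ 2 by lra.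
    by lra.
  have h1 : s0 + lam * q0 <> 0 by move=> h; apply: ne2; rewrite h; ring.
  have h2 : s0 - lam * q0 <> 0 by move=> h; apply: ne2; rewrite h; ring.
  exact: (solve_hyperbolic hm p0 hsE hqE had h1 h2 Ef).
case: hyp => [lt | [[le [had nr]] | [[had sne] | [had [s00 [nr sdb]]]]]].
- have lt2 : Cmod A0 ^ 2 < Cmod B0 ^ 2 by have := Cmod_ge_0 A0; nra.
  apply: hyperbolic; last lra.
  (* If [|alpha| <= |delta|], then [|B0|^2 <= (delta q0)^2 <= |A0|^2], against the assumption. *)
  apply: Rnot_le_lt => h; move: lt2; rewrite A2 Bm !Rpow_mult_distr -(pow2_abs delta).
  have : Cmod alpha ^ 2 <= Rabs delta ^ 2 by nra.
  by have := pow2_ge_0 s0; have := pow2_ge_0 q0; nra.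
(* If [|A0| = |B0|], the zero frequency is already resonant. *)
- apply: hyperbolic => // h; apply: nr; exists (fun _ => 0%Z), 0%Z.
  have d0 : dotZ (fun _ => 0%Z) p0 = 0.
    by apply: (big_ind (fun x => x = 0)) => // [x y -> ->|j _]; rewrite ?Rplus_0_r ?Rmult_0_l.
  by apply: res; rewrite d0 ?h; ring.
- have [|cok cne] := @coef_ok_Re m hm n p0 ((RtoC s0 +
    Ci * RtoC (sqrt (delta ^ 2 - Cmod alpha ^ 2)) * RtoC q0) / RtoC (2 * PI))%C.
    rewrite /Cdiv -RtoC_inv; last lra.
    have -> : Re ((RtoC s0 + Ci * RtoC (sqrt (delta ^ 2 - Cmod alpha ^ 2)) * RtoC q0) * RtoC (/ (2 * PI)))%C =
      s0 * / (2 * PI) by rewrite /Re /=; ring.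
    apply: Rmult_integral_contrapositive; split=> //.
    by apply: Rinv_neq_0_compat; lra.
  exact: (solve_elliptic hm hsE hqE halpha had cok cne Ef).
- set mu := sqrt (delta ^ 2 - Cmod alpha ^ 2) in sdb.
  have mu2 : mu ^ 2 = delta ^ 2 - Cmod alpha ^ 2.
    by rewrite /mu -Rsqr_pow2 Rsqr_sqrt // -(pow2_abs delta); nra.
  have [|cok cne] := coef_ok_small_divisor hm _ sdb.
    (* With [s0 = 0] the first resonance equation is trivial and the second reads
       [2 PI |tau + xi . p0| = q0 mu], so a vanishing divisor is a resonance. *)
    move=> xi tau h; apply: nr; exists xi, tau; apply: res; last by rewrite s00; ring.
    rewrite A2 Bm s00 (Rpow_mult_distr delta) (Rpow_mult_distr (Cmod alpha)).
    have -> : delta ^ 2 = mu ^ 2 + Cmod alpha ^ 2 by lra.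
    transitivity ((2 * PI * IZR tau + 2 * PI * dotZ xi p0) ^ 2); first by ring.
    by rewrite h; ring.
  apply: (solve_elliptic hm hsE hqE halpha had _ _ Ef); rewrite -/s0 -/q0 -/mu s00;
  have -> : ((0 + Ci * mu * q0) / (2 * PI)%R = Ci * (q0 * mu / (2 * PI))%R)%C
    by rewrite /Cdiv -RtoC_inv; [rewrite /Rdiv !RtoC_mult; ring | lra].
  + exact: cok.
  + exact: cne.
Qed.
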